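(* Write the Taylor expansion of $F(\mathbf{t},\mathbf{y};\Lambda)$ around the origin in $\mathbf{t}$ as $F(\mathbf{t},\mathbf{y};\Lambda)=\sum_{\mathbf{k}\in\mathbb{N}_0^{\sharp\Lambda}}C(\mathbf{k},\mathbf{y};\Lambda)\prod_{f\in\Lambda}\frac{t_f^{k_f}}{k_f!}$. Then for every $\mathbf{k}=(k_f)_{f\in\Lambda}\in\mathbb{N}_0^{\sharp\Lambda}$ and every $\mathbf{y}\in V\setminus\bigcup_{f\in\widetilde\Lambda\cap\Lambda_1}(\mathfrak{H}_{\Lambda\setminus\{f\}}+\mathbb{Z}^r)$, $$S(\mathbf{k},\mathbf{y};\Lambda)=\Bigl(\prod_{f\in\Lambda}-\frac{(2\pi\sqrt{-1})^{k_f}}{k_f!}\Bigr)C(\mathbf{k},\mathbf{y};\Lambda).$$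
   Context: Fix an integer $r\ge1$, $V=\mathbb{R}^r$ with standard inner product $\langle\cdot,\cdot\rangle$. An element $f=(\vec f,b_f)\in V\times\mathbb{C}$ is the affine functional $f(\mathbf{v})=\langle\vec f,\mathbf{v}\rangle+b_f$. Let $\Lambda\subset(\mathbb{Z}^r\setminus\{0\})\times\mathbb{C}$ be finite with the $\mathbb{Z}$-module generated by $\vec\Lambda=\{\vec f:f\in\Lambda\}$ of rank $r$. $\widetilde\Lambda=\{f\in\Lambda:$ the module generated by $\vec\Lambda\setminus\{\vec f\}$ has rank $\neq r\}$. For $H\subset\Lambda$ generating a module of rank $r-1$, $\mathfrak{H}_H=\sum_{g\in H}\mathbb{R}\vec g$. For $\mathbf{k}=(k_f)\in\mathbb{N}_0^{\sharp\Lambda}$ ($\mathbb{N}_0=\{0,1,\dots\}$) put $\Lambda_k=\{f:k_f=k\}$, $\Lambda_+=\{f:k_f>0\}$. Define $$Z(N;\mathbf{k},\mathbf{y};\Lambda)=(-1)^{\sharp\Lambda_0}\sum_{\substack{\mathbf{v}\in\mathbb{Z}^r,\ |v_j|\le N\ (1\le j\le r)\\ f(\mathbf{v})\ne0\ (f\in\Lambda_+),\ f(\mathbf{v})=0\ (f\in\Lambda_0)}}e^{2\pi\sqrt{-1}\langle\mathbf{y},\mathbf{v}\rangle}\prod_{f\in\Lambda_+}f(\mathbf{v})^{-k_f}$$ and $S(\mathbf{k},\mathbf{y};\Lambda)=\lim_{N\to\infty}Z(N;\mathbf{k},\mathbf{y};\Lambda)$. Let $\mathscr{B}$ be the set of $B\subset\Lambda$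 with $r$ elements such that $\vec B$ is a basis of $V$; for $f\in B$, $\vec f^B$ is the dual basis vector ($\langle\vec g,\vec f^B\rangle=\delta_{gf}$, $g,f\in B$); $\langle\vec B\rangle=\sum_{f\in B}\mathbb{Z}\vec f$. Let $\mathscr{R}$ be the set of $R\subset\Lambda$ with $r-1$ elements with linearly independent vectors, and fix $\phi\in V\setminus\bigcup_{R\in\mathscr{R}}\mathfrak{H}_R$. Put $\{\mathbf{y}\}_{B,f}=\{\langle\mathbf{y},\vec f^B\rangle\}$ if $\langle\phi,\vec f^B\rangle>0$ and $=1-\{-\langle\mathbf{y},\vec f^B\rangle\}$ if $\langle\phi,\vec f^B\rangle<0$, with $\{a\}=a-\lfloor a\rfloor$. Define for $\mathbf{t}=(t_f)_{f\in\Lambda}$ $$F(\mathbf{t},\mathbf{y};\Lambda)=\sum_{B\in\mathscr{B}}\Bigl(\prod_{g\in\Lambda\setminus B}\frac{t_g}{t_g-2\pi\sqrt{-1}b_g-\sum_{f\in B}(t_f-2\pi\sqrt{-1}b_f)\langle\vec g,\vec f^B\rangle}\Bigr)\frac{1}{\sharp(\mathbb{Z}^r/\langle\vec B\rangle)}\sum_{\mathbf{w}\in\mathbb{Z}^r/\langle\vec B\rangle}\prod_{f\in B}\frac{t_f e^{(t_f-2\pi\sqrt{-1}b_f)\{\mathbf{y}+\mathbf{w}\}_{B,f}}}{e^{t_f-2\pi\sqrt{-1}b_f}-1},$$ which is holomorphic in $\mathbf{t}$ near the origin. *)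

(* Defs.v *)
From HB Require Import structures.
From mathcomp Require Import all_boot all_order all_algebra finmap.
From mathcomp Require Import all_classical all_reals all_analysis.
From mathcomp Require summability.
From mathcomp Require Export complex.
Import Order.TTheory GRing.Theory Num.Theory numFieldNormedType.Exports.

Set Implicit Arguments.
Unset Strict Implicit.
Unset Printing Implicit Defensive.

Local Open Scope classical_set_scope.
Local Open Scope ring_scope.
Local Open Scope complex_scope.

Definition cexp (R : realType) (z : R[i]) : R[i] :=
  (expR (complex.Re z))%:C * (cos (complex.Im z) +i* sin (complex.Im z)).

Definition twopii (R : realType) : R[i] := (2 * pi)%:C * 'i.

Definition frac (R : realType) (a : R) : R := a - (Num.floor a)%:~R.

Definition dot (R : realType) (r : nat) (u v : 'rV[R]_r) : R :=
  \sum_(j < r) u 0 j * v 0 j.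

Definition realvec (R : realType) (r : nat) (v : 'rV[int]_r) : 'rV[R]_r :=
  map_mx intr v.

(* Rank of the Z-submodule of Z^r generated by s, i.e. dim_Q of its
   extension of scalars to Q. *)
Definition zrank (r : nat) (s : seq 'rV[int]_r) : nat :=
  \dim <<[seq map_mx (intr : int -> rat) v | v <- s]>>%VS.

Section Arrangement.
Context {R : realType} {r : nat} {L : {fset 'rV[int]_r * R[i]}}.
Implicit Types (f g : L) (B H : {set L}) (k : {ffun L -> nat}).
Implicit Types (t : {ffun L -> R[i]}) (y phi : 'rV[R]_r).

Definition ivec f : 'rV[int]_r := (fsval f).1.
Definition vec f : 'rV[R]_r := realvec R (ivec f).
Definition off f : R[i] := (fsval f).2.
Definition aff f (v : 'rV[R]_r) : R[i] := (dot (vec f) v)%:C + off f.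

Definition gen_rank H : nat := zrank [seq ivec g | g <- enum H].

(* The vector of f is removed from the set of vectors, hence also for every
   other element of L that has the same vector. *)
Definition tildeL : {set L} :=
  [set f : L | zrank [seq v <- [seq ivec g | g : L] | v != ivec f] != r]%SET.

(* Defined only for H of rank r - 1; we give it the value set0 otherwise.
   For f in tildeL, the set of all g != f has rank r - 1 unless some g != f
   has the same vector as f, and then its rank is r. *)
Definition hyperplane H : set 'rV[R]_r :=
  [set u | (gen_rank H).+1 = r /\ u \in <<[seq vec g | g <- enum H]>>%VS].

Definition excluded k : set 'rV[R]_r :=
  \bigcup_(f in [set f : L | f \in tildeL /\ k f = 1%N])
    [set u + realvec R w | u in hyperplane [set~ f]%SET & w in [set: 'rV[int]_r]].

Definition box k (N : nat) : set 'rV[int]_r :=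
  [set v : 'rV[int]_r | [/\ forall j, `|v 0 j| <= N%:Z,
               forall f, (0 < k f)%N -> aff f (realvec R v) != 0 &
               forall f, k f = 0%N -> aff f (realvec R v) = 0]].

Definition Zsum k y (N : nat) : R[i] :=
  (-1) ^+ #|[set f : L | k f == 0%N]%SET| *
  \sum_(v \in box k N)
    cexp (twopii R * (dot y (realvec R v))%:C) *
    \prod_(f : L | (0 < k f)%N) aff f (realvec R v) ^- k f.

Definition bases : {set {set L}} :=
  [set B : {set L} | (#|B| == r) && basis_of fullv [seq vec f | f <- enum B]]%SET.

Definition corank1 : {set {set L}} :=
  [set H : {set L} | (#|H|.+1 == r) && free [seq vec f | f <- enum H]]%SET.

Definition generic phi : Prop :=
  forall H, H \in corank1 -> ~ hyperplane H phi.

Definition dual B f : 'rV[R]_r :=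
  xget 0 [set u | forall g, g \in B -> dot (vec g) u = (g == f)%:R].

Definition yfrac phi y B f : R :=
  let a := dot y (dual B f) in
  if 0 < dot phi (dual B f) then frac a else 1 - frac (- a).

Definition lattice B : set 'rV[int]_r :=
  [set v | exists a : L -> int, v = \sum_(f in B) ivec f *~ a f].

(* Z^r / <B>, as the set of cosets of <B>. *)
Definition quot B : set (set 'rV[int]_r) :=
  range (fun v : 'rV[int]_r => [set v + u | u in lattice B]).

Definition tshift t f : R[i] := t f - twopii R * off f.

Definition den t B g : R[i] :=
  tshift t g - \sum_(f in B) tshift t f * (dot (vec g) (dual B f))%:C.

(* The summand of a coset c is evaluated at a chosen representative
   [xget 0 c]; it does not depend on that choice. *)
Definition Fgen phi y t : R[i] :=
  \sum_(B in bases)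
    (\prod_(g : L | g \notin B) (t g / den t B g)) *
    (#|` fset_set (quot B)|%:R)^-1 *
    \sum_(c \in quot B)
      \prod_(f in B)
        (t f * cexp (tshift t f * (yfrac phi (y + realvec R (xget 0 c)) B f)%:C)
         / (cexp (tshift t f) - 1)).

(* The t at which no denominator in [Fgen] vanishes. The complement is nowhere
   dense but may contain the origin: the singularities of [Fgen] near the
   origin are removable. *)
Definition regular t : Prop :=
  forall B, B \in bases ->
    (forall g, g \notin B -> den t B g != 0) /\
    (forall f, f \in B -> cexp (tshift t f) != 1).

(* C is the family of Taylor coefficients at the origin of the holomorphic
   extension G of F, where the expression F is meaningful on the dense set D.
   The sum over k is the limit over the net of finite sets of exponents, i.e.
   convergence is absolute. *)
Definition taylor0 (D : set {ffun L -> R[i]}) (F : {ffun L -> R[i]} -> R[i])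
    (C : {ffun L -> nat} -> R[i]) : Prop :=
  exists (rho : R) (G : {ffun L -> R[i]} -> R[i]), 0 < rho /\
  forall t, (forall f, `|t f| < rho%:C) ->
    (D t -> G t = F t) /\
    summability.partial_sum
      (fun k => C k * \prod_(f : L) (t f ^+ k f / ((k f)`!)%:R))
      @ summability.totally --> (G t : (R[i] : numFieldType)).

End Arrangement.

Arguments tildeL {R r} L.
Arguments bases {R r} L.
Arguments corank1 {R r} L.
Arguments generic {R r} L phi.
Arguments gen_rank {R r L} H.
Arguments regular {R r} L t.
Arguments Fgen {R r} L phi y t.

(* Main.v *)
(** In the variable [t_f], the factor of [f] in the lattice sum is a Taylor
    coefficient of [t / (t - 2 pi i f(v))], so that, up to constants, the truncated
    sums are the coefficients of a generating function. For a basis [B] of [V],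
    orthogonality of the characters of [Z^r / <B>] turns the sum over [Z^r] into a
    product of one-dimensional sums, and these are the Fourier expansions of
    [t e^(T y) / (e^T - 1)]. A larger arrangement [A] contains a linear relation
    [sum_h gamma_h h = 0]; it makes the sums for [A] and for the [A \ h] satisfy
    [(sum_h gamma_h t_h - 2 pi i d) X_A = sum_h gamma_h t_h X_(A \ h)], a relation
    which determines [X_A] and which the expression [F] satisfies as well.

    These limits exist a priori only for [y] with no integral coordinate. The
    coefficients are right continuous in the direction [phi]. On the other hand,
    summation by parts along the elements [f] that lie in every basis and have
    [k_f = 1] gives sums that converge absolutely and are continuous in [y]; the
    factors [1 - e^(2 pi i <y, u_f>)] it introduces do not vanish exactly when [y]
    is not excluded. *)
Require Import Defs.
From mathcomp Require Import all_boot all_order all_algebra finmap.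
From mathcomp Require Import all_classical all_reals all_analysis.
From mathcomp Require Import ring lra zify.
Import Order.TTheory GRing.Theory Num.Theory numFieldNormedType.Exports.
Set Implicit Arguments.
Unset Strict Implicit.
Unset Printing Implicit Defensive.
Local Open Scope classical_set_scope.
Local Open Scope ring_scope.
Local Open Scope complex_scope.

Local Notation frac := Defs.frac.
#[local] Existing Instance summability.totally_filter.

(** * Complex limits and unconditional sums *)

(** The obstacle is conditional convergence: for exponents equal to 1 the sums over cubes need not
    converge absolutely, so that the full sum cannot simply be rearranged along a basis or
    multiplied by a relation. The relation of a circuit, however, holds exactly for the truncated
    sums at every [N], because all subarrangements are summed over the same cube, and division by
    its linear factor is a finite recursion on coefficients, which commutes with limits. For a
    single basis, differences along multiples of the dual vectors produce an absolutely convergent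
    sum, whose value does not depend on the shape of the regions; the boundary terms live near the
    faces of the cube and tend to 0. The one-dimensional expansion is obtained from finite Fourier
    inversion over roots of unity, with only finite sums and dominated convergence. Genericity of
    [phi] makes all coordinates [<y + e phi, f^B>] leave the integers at once for small [e > 0]. The
    denominators of [F] may vanish at the origin, so its coefficients are pinned down on curves that
    start there and consist of regular points for small positive parameters. *)

Definition cnorm (R : realType) (z : R[i]) : R := Normc.normc z.
Arguments cnorm : simpl never.

Section ComplexNorm.
Context {R : realType}.
Implicit Types (z w : R[i]) (x : R).

Lemma normE z : `|z| = (cnorm z)%:C.
Proof. by []. Qed.

Lemma cnorm_ge0 z : 0 <= cnorm z.
Proof. by case: z => a b; rewrite sqrtr_ge0. Qed.

Lemma cnorm0 : cnorm (0 : R[i]) = 0.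
Proof. exact: Normc.normc0. Qed.

Lemma cnorm1 : cnorm (1 : R[i]) = 1.
Proof. exact: Normc.normc1. Qed.

Lemma cnorm_eq0 z : (cnorm z == 0) = (z == 0).
Proof.
by apply/eqP/eqP => [/Normc.eq0_normc //|->]; rewrite cnorm0.
Qed.

Lemma cnorm_gt0 z : (0 < cnorm z) = (z != 0).
Proof. by rewrite lt_def cnorm_ge0 andbT cnorm_eq0. Qed.

Lemma cnormM z w : cnorm (z * w) = cnorm z * cnorm w.
Proof. exact: Normc.normcM. Qed.

Lemma cnormV z : cnorm z^-1 = (cnorm z)^-1.
Proof. exact: Normc.normcV. Qed.

Lemma cnormN z : cnorm (- z) = cnorm z.
Proof. exact: normcN. Qed.

Lemma cnormD z w : cnorm (z + w) <= cnorm z + cnorm w.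
Proof. exact: le_normcD. Qed.

Lemma cnormB z w : cnorm (z - w) <= cnorm z + cnorm w.
Proof. by rewrite -(cnormN w) cnormD. Qed.

Lemma cnorm_distC z w : cnorm (z - w) = cnorm (w - z).
Proof. by rewrite -cnormN opprB. Qed.

Lemma cnorm_dist_sub z w : cnorm z - cnorm w <= cnorm (z - w).
Proof. by rewrite lerBlDr (le_trans _ (cnormD _ _)) // subrK. Qed.

Lemma cnormX z n : cnorm (z ^+ n) = cnorm z ^+ n.
Proof. by elim: n => [|n IH]; rewrite ?cnorm1 // !exprS cnormM IH. Qed.

Lemma cnorm_prod (I : Type) (s : seq I) (P : pred I) (F : I -> R[i]) :
  cnorm (\prod_(i <- s | P i) F i) = \prod_(i <- s | P i) cnorm (F i).
Proof. exact: (big_morph _ cnormM cnorm1). Qed.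

Lemma cnorm_sum (I : Type) (s : seq I) (P : pred I) (F : I -> R[i]) :
  cnorm (\sum_(i <- s | P i) F i) <= \sum_(i <- s | P i) cnorm (F i).
Proof.
elim/big_rec2: _ => [|i x z _ H]; first by rewrite cnorm0.
by rewrite (le_trans (cnormD _ _)) // lerD2l.
Qed.

Lemma cnorm_real x : cnorm x%:C = `|x|.
Proof. by rewrite /cnorm /= expr0n addr0 sqrtr_sqr. Qed.

Lemma cnorm_i : cnorm ('i : R[i]) = 1.
Proof. by rewrite /cnorm /= expr0n /= expr1n add0r sqrtr1. Qed.

Lemma normr_Re z : `|complex.Re z| <= cnorm z.
Proof.
case: z => a b; rewrite /cnorm /= -sqrtr_sqr ler_wsqrtr // lerDl.
exact: sqr_ge0.
Qed.

Lemma normr_Im z : `|complex.Im z| <= cnorm z.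
Proof.
case: z => a b; rewrite /cnorm /= -sqrtr_sqr ler_wsqrtr // lerDr.
exact: sqr_ge0.
Qed.

Lemma cnorm_le_ReIm z : cnorm z <= `|complex.Re z| + `|complex.Im z|.
Proof.
rewrite {1}(complexE z) (le_trans (cnormD _ _)) // cnormM cnorm_i mul1r.
by rewrite !cnorm_real.
Qed.

Lemma cnorm_int (n : int) : cnorm (n%:~R : R[i]) = `|n|%:~R.
Proof. by rewrite -(rmorph_int (real_complex R)) cnorm_real intr_norm. Qed.

End ComplexNorm.

(** The norm of [R[i]] takes its values in [R[i]]; convergence is phrased with the real-valued
    [cnorm] so that estimates stay in the ordered field [R]. [ccvgP] identifies the two notions. *)
Definition ccvg (R : realType) (T : Type) (F : set_system T) (u : T -> R[i])
  (l : R[i]) : Prop :=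
  forall e : R, 0 < e -> F [set x | cnorm (u x - l) < e].

Section ComplexLimits.
Context {R : realType} {T : Type} {F : set_system T}.
Implicit Types (u v : T -> R[i]) (l : R[i]).

Lemma ccvgP {FF : Filter F} u l :
  ccvg F u l <-> u @ F --> (l : (R[i] : numFieldType)).
Proof.
have P := @cvgrPdist_lt (R[i] : numFieldType) (R[i] : numFieldType) T F FF u l.
split=> [ul|/(P.1) ul e e0].
  apply/(P.2) => e; rewrite ltcE /= => /andP[/eqP e1 e0].
  have := ul _ e0; apply: filterS => x /= ux; rewrite normE ltcE /= e1 eqxx /=.
  by rewrite cnorm_distC.
have /ul : 0 < e%:C by rewrite ltcR.
by apply: filterS => x /=; rewrite normE ltcR cnorm_distC.
Qed.

Lemma ccvg_cst {FF : Filter F} l : ccvg F (fun=> l) l.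
Proof. by move=> e e0; apply: filterE => x /=; rewrite subrr cnorm0. Qed.

Lemma ccvgD {FF : Filter F} u v l m :
  ccvg F u l -> ccvg F v m -> ccvg F (fun x => u x + v x) (l + m).
Proof.
move=> /ccvgP ul /ccvgP vm; apply/ccvgP.
exact: (@cvgD (R[i] : numFieldType) (R[i] : numFieldType) T F FF u v l m ul vm).
Qed.

Lemma ccvgM {FF : Filter F} u v l m :
  ccvg F u l -> ccvg F v m -> ccvg F (fun x => u x * v x) (l * m).
Proof.
move=> /ccvgP ul /ccvgP vm; apply/ccvgP.
exact: (@cvgM (R[i] : numFieldType) T F FF u v l m ul vm).
Qed.

Lemma ccvgN {FF : Filter F} u l : ccvg F u l -> ccvg F (fun x => - u x) (- l).
Proof.
move=> /ccvgP ul; apply/ccvgP.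
exact: (@cvgN (R[i] : numFieldType) (R[i] : numFieldType) T F FF u l ul).
Qed.

Lemma ccvgB {FF : Filter F} u v l m :
  ccvg F u l -> ccvg F v m -> ccvg F (fun x => u x - v x) (l - m).
Proof. by move=> ul vm; apply: ccvgD => //; apply: ccvgN. Qed.

Lemma ccvgMl {FF : Filter F} u l m :
  ccvg F u l -> ccvg F (fun x => m * u x) (m * l).
Proof. by move=> ul; apply: ccvgM => //; apply: ccvg_cst. Qed.

Lemma ccvgV {FF : Filter F} u l :
  l != 0 -> ccvg F u l -> ccvg F (fun x => (u x)^-1) l^-1.
Proof.
move=> l0 /ccvgP ul; apply/ccvgP.
exact: (@cvgV (R[i] : numFieldType) T F FF u l l0 ul).
Qed.

Lemma ccvg_sum {FF : Filter F} (I : Type) (s : seq I) (P : pred I)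
    (u : I -> T -> R[i]) (l : I -> R[i]) :
  (forall i, P i -> ccvg F (u i) (l i)) ->
  ccvg F (fun x => \sum_(i <- s | P i) u i x) (\sum_(i <- s | P i) l i).
Proof.
move=> ul; elim: s => [|i s IH].
  rewrite big_nil; have -> : (fun x => \sum_(i <- [::] | P i) u i x) = fun=> 0.
    by apply/funext => x; rewrite big_nil.
  exact: ccvg_cst.
rewrite big_cons.
have -> : (fun x => \sum_(j <- i :: s | P j) u j x) =
  fun x => if P i then u i x + \sum_(j <- s | P j) u j x
           else \sum_(j <- s | P j) u j x.
  by apply/funext => x; rewrite big_cons.
by case: ifPn => // Pi; apply: ccvgD => //; apply: ul.
Qed.

Lemma ccvg_prod {FF : Filter F} (I : Type) (s : seq I) (P : pred I)
    (u : I -> T -> R[i]) (l : I -> R[i]) :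
  (forall i, P i -> ccvg F (u i) (l i)) ->
  ccvg F (fun x => \prod_(i <- s | P i) u i x) (\prod_(i <- s | P i) l i).
Proof.
move=> ul; elim: s => [|i s IH].
  rewrite big_nil; have -> : (fun x => \prod_(i <- [::] | P i) u i x) = fun=> 1.
    by apply/funext => x; rewrite big_nil.
  exact: ccvg_cst.
rewrite big_cons.
have -> : (fun x => \prod_(j <- i :: s | P j) u j x) =
  fun x => if P i then u i x * \prod_(j <- s | P j) u j x
           else \prod_(j <- s | P j) u j x.
  by apply/funext => x; rewrite big_cons.
by case: ifPn => // Pi; apply: ccvgM => //; apply: ul.
Qed.

Lemma ccvg_unique {FF : ProperFilter F} u l m :
  ccvg F u l -> ccvg F u m -> l = m.
Proof.
move=> ul um; apply/eqP; rewrite -subr_eq0 -cnorm_eq0; apply/negPn/negP => lm.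
have e0 : 0 < cnorm (l - m) / 2 by rewrite divr_gt0 // lt_def lm cnorm_ge0.
have [x /= []] := @filter_ex _ _ FF _ (filterI (ul _ e0) (um _ e0)).
move=> /= H1 H2; have := cnormB (u x - m) (u x - l).
have -> : u x - m - (u x - l) = l - m by ring.
move: H1 H2 => /=; lra.
Qed.

Lemma near_eq_ccvg {FF : Filter F} u v l :
  F [set x | u x = v x] -> ccvg F u l -> ccvg F v l.
Proof.
move=> uv ul e e0; apply: filterS (filterI uv (ul _ e0)) => x /= [<-] //.
Qed.

Lemma eq_ccvg u v l : u =1 v -> ccvg F u l -> ccvg F v l.
Proof. by move=> /funext ->. Qed.

Lemma ccvg_cnorm_le {FF : ProperFilter F} u l (M : R) :
  F [set x | cnorm (u x) <= M] -> ccvg F u l -> cnorm l <= M.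
Proof.
move=> uM ul; apply/ler_addgt0Pr => e e0.
have [x /= [H1 H2]] := @filter_ex _ _ FF _ (filterI uM (ul _ e0)).
have := cnorm_dist_sub l (u x); rewrite cnorm_distC; move: H1 H2 => /=; lra.
Qed.

Lemma ccvg_squeeze {FF : Filter F} u l (b : T -> R) :
  F [set x | cnorm (u x - l) <= b x] -> b @ F --> (0 : R) ->
  ccvg F u l.
Proof.
move=> ub /cvgrPdist_lt b0 e e0; apply: filterS (filterI ub (b0 _ e0)).
move=> x /= [H]; rewrite sub0r normrN => H2.
by rewrite (le_lt_trans H) // (le_lt_trans (ler_norm _)).
Qed.

End ComplexLimits.

Lemma ccvg_real (R : realType) (T : Type) (F : set_system T) (FF : Filter F)
  (u : T -> R) (l : R) : u @ F --> l -> ccvg F (fun x => (u x)%:C) l%:C.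
Proof.
move=> /cvgrPdist_lt ul e /ul; apply: filterS => x /=.
by rewrite -rmorphB /= cnorm_real distrC.
Qed.

Notation totally := summability.totally.

Definition bounded_sums (R : realType) (I : choiceType) (b : I -> R) : Prop :=
  exists M : R, forall J : {fset I}, \sum_(i <- J) b i <= M.

Definition abs_summable (R : realType) (I : choiceType) (a : I -> R[i]) : Prop :=
  bounded_sums (fun i => cnorm (a i)).

Definition has_sum (R : realType) (I : choiceType) (a : I -> R[i]) (s : R[i]) :
  Prop := ccvg totally (fun J : {fset I} => \sum_(i <- J) a i) s.

Section FsetSums.
Context {R : realType} {I : choiceType}.
Implicit Types (J K : {fset I}) (b : I -> R).

Lemma sum_fset_sub (V : nmodType) (F : I -> V) J K : (J `<=` K)%fset ->
  \sum_(i <- K) F i = \sum_(i <- J) F i + \sum_(i <- (K `\` J)%fset) F i.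
Proof.
move=> JK; rewrite (big_fsetID _ (mem J)) /=; congr (_ + _).
  apply: eq_fbigl => i; rewrite !inE; apply/andP/idP => [[]//|iJ].
  by split=> //; apply: (fsubsetP JK).
by apply: eq_fbigl => i; rewrite !inE /= andbC.
Qed.

Lemma ler_sum_fset b J K : (forall i, 0 <= b i) -> (J `<=` K)%fset ->
  \sum_(i <- J) b i <= \sum_(i <- K) b i.
Proof.
by move=> b0 JK; rewrite (sum_fset_sub _ JK) lerDl sumr_ge0.
Qed.

(** A finite set [J0] whose sum comes within [e] of the supremum of all finite sums leaves at most
    [e] for any set disjoint from it. *)
Lemma bounded_sums_tail b e : (forall i, 0 <= b i) -> bounded_sums b -> 0 < e ->
  exists J0, forall J, [disjoint J & J0]%fset -> \sum_(i <- J) b i <= e.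
Proof.
move=> b0 [M bM] e0.
pose E := [set x : R | exists J, x = \sum_(i <- J) b i].
have hE : has_sup E.
  by split; [exists 0, fset0; rewrite big_seq_fset0|exists M => x [J ->]].
have [_ [J0 ->] HJ0] := sup_adherent e0 hE.
exists J0 => J dJ.
have : \sum_(i <- (J0 `|` J)%fset) b i <= sup E.
  by apply: sup_upper_bound => //; exists (J0 `|` J)%fset.
rewrite (sum_fset_sub _ (fsubsetUl J0 J)).
have -> : ((J0 `|` J) `\` J0 = J)%fset.
  apply/fsetP => i; rewrite !inE; case: (boolP (i \in J)) => iJ.
    by rewrite orbT andbT; apply: (fdisjointP dJ).
  by rewrite orbF; case: (_ \in _).
by move: HJ0; lra.
Qed.

Lemma bounded_sums_delta (i0 : I) : bounded_sums (fun i => (i == i0)%:R : R).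
Proof.
exists 1 => J; case: (boolP (i0 \in J)) => iJ.
  rewrite (big_fsetD1 i0 iJ) /= eqxx big_seq big1 ?addr0 // => i.
  by rewrite !inE => /andP[/negbTE ->].
rewrite big_seq big1 ?ler01 // => i iJ'; case: eqP => // ii.
by move: iJ; rewrite -ii iJ'.
Qed.

Lemma bounded_sums_le b b' : (forall i, b i <= b' i) -> bounded_sums b' ->
  bounded_sums b.
Proof.
by move=> bb [M HM]; exists M => J; rewrite (le_trans _ (HM J)) // ler_sum.
Qed.

Lemma bounded_sumsZ (c : R) b : 0 <= c -> bounded_sums b ->
  bounded_sums (fun i => c * b i).
Proof.
by move=> c0 [M HM]; exists (c * M) => J; rewrite -mulr_sumr ler_wpM2l.
Qed.

Lemma bounded_sumsD b b' : bounded_sums b -> bounded_sums b' ->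
  bounded_sums (fun i => b i + b' i).
Proof.
by move=> [M HM] [N HN]; exists (M + N) => J; rewrite big_split lerD.
Qed.

Lemma bounded_sums_sum (T : Type) (s : seq T) (b : T -> I -> R) :
  (forall t, bounded_sums (b t)) -> bounded_sums (fun i => \sum_(t <- s) b t i).
Proof.
move=> bs; elim: s => [|t s IH].
  by exists 0 => J; rewrite big1 // => i _; rewrite big_nil.
have [M HM] := bounded_sumsD (bs t) IH.
by exists M => J; rewrite (le_trans _ (HM J)) // ler_sum // => i _; rewrite big_cons.
Qed.

End FsetSums.

Lemma bounded_sums_inj (R : realType) (I K : choiceType) (h : I -> K)
    (b : K -> R) : injective h -> bounded_sums b -> bounded_sums (b \o h).
Proof.
move=> hi [M HM]; exists M => J; rewrite (le_trans _ (HM (h @` J)%fset)) //.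
by rewrite big_imfset //= => x y _ _; apply: hi.
Qed.

Section HasSum.
Context {R : realType} {I : choiceType}.
Implicit Types (J K : {fset I}) (a b : I -> R[i]) (s t : R[i]).

Lemma near_totally (P : set {fset I}) :
  (exists J0, forall J, (J0 `<=` J)%fset -> P J) -> totally P.
Proof. by move=> [J0 HJ]; exists J0. Qed.

Lemma totallyP (P : set {fset I}) :
  totally P -> exists J0, forall J, (J0 `<=` J)%fset -> P J.
Proof. by move=> [J0 _ HJ]; exists J0. Qed.

Lemma has_sum_unique a s t : has_sum a s -> has_sum a t -> s = t.
Proof. exact: ccvg_unique. Qed.

Lemma real_net_cauchy (x : {fset I} -> R) :
  (forall e, 0 < e -> exists J0, forall J, (J0 `<=` J)%fset ->
     `|x J - x J0| <= e) -> exists l : R, x @ totally --> l.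
Proof.
move=> H; have PF : ProperFilter (x @ totally).
  by apply: fmap_proper_filter; apply: summability.totally_filter.
have /cauchy_exP/cauchy_cvgP : cauchy_ex (x @ totally).
  move=> e e0; have e20 : 0 < e / 2 by rewrite divr_gt0.
  have [J0 HJ] := H _ e20; exists (x J0).
  apply: (@near_totally (x @^-1` ball (x J0) e)); exists J0 => J /HJ.
  by rewrite /= /ball /= distrC; lra.
by move=> c; exists (lim (x @ totally)).
Qed.

Lemma sum_diff_le a J0 J e :
  (forall K, [disjoint K & J0]%fset -> \sum_(i <- K) cnorm (a i) <= e) ->
  (J0 `<=` J)%fset -> cnorm (\sum_(i <- J) a i - \sum_(i <- J0) a i) <= e.
Proof.
move=> H JJ; rewrite (sum_fset_sub _ JJ) addrC addKr.
apply: le_trans (cnorm_sum _ _ _) (H _ _).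
by apply/fdisjointP => i; rewrite !inE => /andP[].
Qed.

(** Completeness enters only through [R]: the nets of real and imaginary parts are Cauchy because
    both are dominated by the tails of the norms. *)
Lemma abs_summable_has_sum a : abs_summable a -> exists s, has_sum a s.
Proof.
move=> sa.
have T := bounded_sums_tail (fun i => cnorm_ge0 (a i)) sa.
have Csum : forall (g : {additive R[i] -> R}), (forall z, `|g z| <= cnorm z) ->
    exists l : R, (fun J => g (\sum_(i <- J) a i)) @ totally --> l.
  move=> g hg; apply: real_net_cauchy => e e0.
  have [J0 HJ] := T _ e0; exists J0 => J JJ; rewrite -raddfB.
  exact: le_trans (hg _) (sum_diff_le HJ JJ).
have [l Hl] := Csum (@complex.Re R : {additive R[i] -> R}) normr_Re.
have [m Hm] := Csum (@complex.Im R : {additive R[i] -> R}) normr_Im.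
exists (l%:C + 'i * m%:C).
have -> : has_sum a (l%:C + 'i * m%:C) = ccvg totally (fun J : {fset I} =>
    (complex.Re (\sum_(i <- J) a i))%:C
    + 'i * (complex.Im (\sum_(i <- J) a i))%:C) (l%:C + 'i * m%:C).
  by congr ccvg; apply/funext => J; rewrite -complexE.
by apply: ccvgD; [|apply: ccvgMl]; apply: ccvg_real.
Qed.

Lemma has_sum_tail a s J0 e :
  (forall K, [disjoint K & J0]%fset -> \sum_(i <- K) cnorm (a i) <= e) ->
  has_sum a s -> cnorm (s - \sum_(i <- J0) a i) <= e.
Proof.
move=> H sa; apply: (@ccvg_cnorm_le _ _ totally _
  (fun J => \sum_(i <- J) a i - \sum_(i <- J0) a i)).
  by apply: near_totally; exists J0 => J; apply: sum_diff_le.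
by apply: ccvgB => //; apply: ccvg_cst.
Qed.

Lemma has_sum_cnorm_le a s M : (forall J, \sum_(i <- J) cnorm (a i) <= M) ->
  has_sum a s -> cnorm s <= M.
Proof.
move=> H sa; have := @has_sum_tail a s fset0 M _ sa.
by rewrite big_seq_fset0 subr0; apply=> K _; apply: H.
Qed.

Lemma has_sum_cst0 : has_sum (fun _ : I => 0) (0 : R[i]).
Proof.
rewrite /has_sum (_ : (fun J : {fset I} => _) = fun=> 0); first exact: ccvg_cst.
by apply/funext => J; rewrite big1.
Qed.

Lemma has_sumD a b s t : has_sum a s -> has_sum b t ->
  has_sum (fun i => a i + b i) (s + t).
Proof.
move=> sa sb; rewrite /has_sum (_ : (fun J : {fset I} => _) =
  fun J => \sum_(i <- J) a i + \sum_(i <- J) b i); first exact: ccvgD.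
by apply/funext => J; rewrite big_split.
Qed.

Lemma has_sumZ c a s : has_sum a s -> has_sum (fun i => c * a i) (c * s).
Proof.
move=> sa; rewrite /has_sum (_ : (fun J : {fset I} => _) =
  fun J => c * \sum_(i <- J) a i); first exact: ccvgMl.
by apply/funext => J; rewrite mulr_sumr.
Qed.

Lemma has_sumB a b s t : has_sum a s -> has_sum b t ->
  has_sum (fun i => a i - b i) (s - t).
Proof.
move=> sa /(has_sumZ (-1)); rewrite mulN1r => sb; have := has_sumD sa sb.
by congr has_sum; apply/funext => i; rewrite mulN1r.
Qed.

Lemma has_sum_sum (T : Type) (r : seq T) (P : pred T) (a : T -> I -> R[i])
    (s : T -> R[i]) : (forall x, P x -> has_sum (a x) (s x)) ->
  has_sum (fun i => \sum_(x <- r | P x) a x i) (\sum_(x <- r | P x) s x).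
Proof.
move=> sa; rewrite /has_sum (_ : (fun J : {fset I} => _) =
  fun J => \sum_(x <- r | P x) \sum_(i <- J) a x i).
  by apply: ccvg_sum => x Px; apply: sa.
by apply/funext => J; rewrite exchange_big.
Qed.

Lemma has_sum_fin a J0 : (forall i, i \notin J0 -> a i = 0) ->
  has_sum a (\sum_(i <- J0) a i).
Proof.
move=> a0 e e0; apply: near_totally; exists J0 => J JJ /=.
rewrite (sum_fset_sub _ JJ) addrC addKr big_seq big1 ?cnorm0 //.
by move=> i; rewrite !inE => /andP[/a0].
Qed.

Lemma eq_has_sum a b s : a =1 b -> has_sum a s -> has_sum b s.
Proof. by move=> /funext ->. Qed.

(** Dominated convergence along an arbitrary filter, the tool for exchanging limits with infinite
    sums: outside one finite [J0] all tails are at most [e / 4], and on [J0] the limit is taken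
    termwise. *)
Theorem dominated_ccvg (T : Type) (F : set_system T) (FF : ProperFilter F)
    (a : T -> I -> R[i]) (l : I -> R[i]) (d : I -> R) (s : T -> R[i]) t :
  bounded_sums d ->
  F [set x | (forall i, cnorm (a x i) <= d i) /\ has_sum (a x) (s x)] ->
  (forall i, ccvg F (a^~ i) (l i)) -> has_sum l t -> ccvg F s t.
Proof.
move=> sd Fa al lt e e0.
have ld i : cnorm (l i) <= d i.
  by apply: ccvg_cnorm_le (al i); apply: filterS Fa => x [H _]; apply: H.
have d0 i : 0 <= d i by apply: le_trans (ld i); apply: cnorm_ge0.
have e40 : 0 < e / 4 by rewrite divr_gt0.
have [J0 HJ] := bounded_sums_tail d0 sd e40.
have tl (c : I -> R[i]) : (forall i, cnorm (c i) <= d i) ->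
    forall K, [disjoint K & J0]%fset -> \sum_(i <- K) cnorm (c i) <= e / 4.
  by move=> cd K /HJ; apply: le_trans; apply: ler_sum => i _.
have H1 := has_sum_tail (tl _ ld) lt.
have := @ccvg_sum R T F FF I J0 xpredT (fun i => a^~ i) l (fun i _ => al i).
move=> /(_ _ e40) H2; apply: filterS (filterI Fa H2) => x /= [[ad sx] H3].
have H4 := has_sum_tail (tl _ ad) sx.
rewrite (_ : s x - t = (s x - \sum_(i <- J0) a x i)
  + (\sum_(i <- J0) a x i - \sum_(i <- J0) l i)
  - (t - \sum_(i <- J0) l i)); last by ring.
apply: le_lt_trans (cnormB _ _) _; rewrite -ltrBrDr.
by apply: le_lt_trans (cnormD _ _) _; move: H1 H3 H4 => /=; lra.
Qed.

Lemma abs_summable_has_sum_le a (d : I -> R) : bounded_sums d ->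
  (forall i, cnorm (a i) <= d i) -> exists s, has_sum a s.
Proof. by move=> sd ad; apply: abs_summable_has_sum; apply: bounded_sums_le sd. Qed.

Lemma exhaust_ccvg (T : Type) (F : set_system T) (FF : ProperFilter F)
    (K : T -> {fset I}) a s : abs_summable a -> has_sum a s ->
  (forall i, F [set x | i \in K x]) ->
  ccvg F (fun x => \sum_(i <- K x) a i) s.
Proof.
move=> sa hs FK.
apply: (@dominated_ccvg _ F _ (fun x i => if i \in K x then a i else 0) a
  (fun i => cnorm (a i)) _ _ sa) => //.
- apply: filterE => x; split.
    by move=> i; case: ifP => // _; rewrite cnorm0 cnorm_ge0.
  rewrite (_ : \sum_(i <- K x) a i =
    \sum_(i <- K x) if i \in K x then a i else 0).
    by apply: has_sum_fin => i /negbTE ->.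
  by rewrite big_seq [RHS]big_seq; apply: eq_bigr => i ->.
- move=> i; apply: near_eq_ccvg (ccvg_cst (a i)).
  by apply: filterS (FK i) => x /= ->.
Qed.

End HasSum.

Section Reindex.
Context {R : realType} {I K : choiceType} (h : I -> K) (h_inj : injective h).

Lemma fset_preimage (J : {fset K}) : exists A : {fset I},
  forall k, (k \in (h @` A)%fset) = (k \in J) && `[< range h k >].
Proof.
have fJ : finite_set (h @^-1` [set` J]).
  by apply: finite_preimage; [move=> x y _ _; apply: h_inj|].
exists (fset_set (h @^-1` [set` J])) => k; apply/imfsetP/andP => [[i /=]|].
  by rewrite in_fset_set // inE /= => iJ ->; split=> //; apply/asboolP; exists i.
move=> [kJ /asboolP[i _ hi]]; exists i; rewrite //= in_fset_set // inE /= hi //.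
Qed.

Lemma has_sum_inj (a : K -> R[i]) (s : R[i]) :
  (forall k, ~ range h k -> a k = 0) -> has_sum (a \o h) s -> has_sum a s.
Proof.
move=> a0 hs e e0; have [J0 HJ] := totallyP (hs e e0).
apply: near_totally; exists (h @` J0)%fset => J JJ /=.
have [A HA] := fset_preimage J.
have -> : \sum_(i <- J) a i = \sum_(i <- A) (a \o h) i.
  have hA : {in A &, injective h} by move=> x y _ _; apply: h_inj.
  transitivity (\sum_(k <- (h @` A)%fset) a k); last by rewrite big_imfset.
  apply/esym; apply: big_fset_incl => [|k kJ]; first by apply/fsubsetP => k; rewrite HA => /andP[].
  by rewrite HA kJ /= => /asboolPn/a0.
apply: HJ; apply/fsubsetP => i iJ.
have : h i \in (h @` A)%fset.
  rewrite HA; apply/andP; split; last by apply/asboolP; exists i.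
  by apply: (fsubsetP JJ); apply: in_imfset.
by move=> /imfsetP[j /= jA /h_inj ->].
Qed.

Lemma has_sum_comp (a : K -> R[i]) (s : R[i]) : abs_summable a ->
  (forall k, ~ range h k -> a k = 0) -> has_sum a s -> has_sum (a \o h) s.
Proof.
move=> sa a0 hs.
have /abs_summable_has_sum[t ht] : abs_summable (a \o h).
  exact: (bounded_sums_inj h_inj sa).
by rewrite (has_sum_unique hs (has_sum_inj a0 ht)).
Qed.

End Reindex.

Section ProductSum.
Context {R : realType} {T : finType} {I : choiceType}.

Definition ffun_val (J : {fset I}) (k : {ffun T -> J}) : {ffun T -> I} :=
  [ffun f => val (k f)].

Definition fset_ffun (J : {fset I}) : {fset {ffun T -> I}} :=
  [fset ffun_val k | k in {: {ffun T -> J}}]%fset.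

Lemma mem_fset_ffun (J : {fset I}) (k : {ffun T -> I}) :
  (k \in fset_ffun J) = [forall f, k f \in J].
Proof.
apply/imfsetP/forallP => [[k' _ ->] f|kJ]; first by rewrite ffunE; apply: valP.
by exists [ffun f => [` kJ f]%fset] => //; apply/ffunP => f; rewrite !ffunE.
Qed.

Lemma sum_fset_ffun (S : comPzSemiRingType) (J : {fset I}) (a : T -> I -> S) :
  \sum_(k <- fset_ffun J) \prod_f a f (k f) = \prod_f \sum_(i <- J) a f i.
Proof.
rewrite big_imfset /=; last first.
  move=> k k' _ _ /ffunP kk; apply/ffunP => f; apply: val_inj.
  by have := kk f; rewrite !ffunE.
under [RHS]eq_bigr do rewrite big_seq_fsetE /=.
rewrite bigA_distr_bigA /= big_enum /=.
by apply: eq_bigr => k _; apply: eq_bigr => f _; rewrite ffunE.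
Qed.

Lemma sub_fset_ffun (J : {fset {ffun T -> I}}) :
  exists A : {fset I}, (J `<=` fset_ffun A)%fset.
Proof.
exists (\bigcup_(k <- J) [fset k f | f : T])%fset; apply/fsubsetP => k kJ.
rewrite mem_fset_ffun; apply/forallP => f; apply/bigfcupP; exists k.
  by rewrite kJ.
by apply/imfsetP; exists f.
Qed.

Lemma bounded_sums_prod (b : T -> I -> R) : (forall f i, 0 <= b f i) ->
  (forall f, bounded_sums (b f)) ->
  bounded_sums (fun k : {ffun T -> I} => \prod_f b f (k f)).
Proof.
move=> b0 bs; have /choice[M HM] : forall f, exists M : R,
  forall J : {fset I}, \sum_(i <- J) b f i <= M := bs.
exists (\prod_f M f) => J; have [A JA] := sub_fset_ffun J.
apply: le_trans (ler_sum_fset _ JA) _.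
  by move=> k; apply: prodr_ge0.
rewrite sum_fset_ffun; apply: ler_prod => f _.
by rewrite HM andbT sumr_ge0.
Qed.

Lemma abs_summable_prod (a : T -> I -> R[i]) :
  (forall f, abs_summable (a f)) ->
  abs_summable (fun k : {ffun T -> I} => \prod_f a f (k f)).
Proof.
move=> sa; have := bounded_sums_prod (fun f i => cnorm_ge0 (a f i)) sa.
by apply: bounded_sums_le => k; rewrite cnorm_prod.
Qed.

(** The sets [fset_ffun J] are cofinal among the finite sets of families, and over them the sum
    factorizes; absolute summability identifies the limit along them with the unconditional sum. *)
Lemma has_sum_prod (a : T -> I -> R[i]) (s : T -> R[i]) :
  (forall f, abs_summable (a f)) -> (forall f, has_sum (a f) (s f)) ->
  has_sum (fun k : {ffun T -> I} => \prod_f a f (k f)) (\prod_f s f).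
Proof.
move=> sa hs; have su := abs_summable_prod sa.
have [t ht] := abs_summable_has_sum su.
suff -> : \prod_f s f = t by [].
apply: (@ccvg_unique _ _ totally _
  (fun J : {fset I} => \sum_(k <- fset_ffun J) \prod_f a f (k f))).
  rewrite (_ : (fun J => _) = fun J : {fset I} => \prod_f \sum_(i <- J) a f i).
    by apply: ccvg_prod => f _; apply: hs.
  by apply/funext => J; rewrite sum_fset_ffun.
apply: exhaust_ccvg => // k; apply: near_totally.
have [A] := sub_fset_ffun [fset k]%fset; rewrite fsub1set mem_fset_ffun.
move=> /forallP kA; exists A => J AJ /=; rewrite mem_fset_ffun.
by apply/forallP => f; apply: (fsubsetP AJ).
Qed.

End ProductSum.

(** * The complex exponential *)

Section NatSums.
Context {R : realType}.

Lemma fset_nat_bounded (J : {fset nat}) :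
  exists N, (J `<=` [fset i in iota 0 N])%fset.
Proof.
exists (\max_(i <- J) i).+1; apply/fsubsetP => i iJ.
have mem_iota0 N : (i < N)%N -> i \in [fset i in iota 0 N]%fset.
  by move=> iN; rewrite !inE mem_iota.
apply: mem_iota0; rewrite ltnS (big_seq_fsetE _ _ xpredT).
exact: (@leq_bigmax _ (fun x : J => \val x) [` iJ]%fset).
Qed.

Lemma sum_fset_iota (V : nmodType) (F : nat -> V) N :
  \sum_(i <- [fset i in iota 0 N]%fset) F i = \sum_(i < N) F i.
Proof.
rewrite -[RHS](big_mkord xpredT) /index_iota subn0.
apply: perm_big; apply: uniq_perm; rewrite ?fset_uniq ?iota_uniq //.
by move=> i; rewrite !inE.
Qed.

Lemma bounded_sums_nat (b : nat -> R) M : (forall n, 0 <= b n) ->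
  (forall N, \sum_(i < N) b i <= M) ->
  forall J : {fset nat}, \sum_(i <- J) b i <= M.
Proof.
move=> b0 bM J; have [N JN] := fset_nat_bounded J.
by rewrite (le_trans (ler_sum_fset b0 JN)) // sum_fset_iota.
Qed.

Lemma geometric_sum_le (q : R) : 0 <= q < 1 ->
  forall J : {fset nat}, \sum_(i <- J) q ^+ i <= (1 - q)^-1.
Proof.
move=> /andP[q0 q1]; apply: bounded_sums_nat => [n|N]; first exact: exprn_ge0.
have q10 : 0 < 1 - q by lra.
rewrite -[leLHS](mulfK (lt0r_neq0 q10)) ler_piMl ?invr_ge0 ?(ltW q10) //.
have -> : (\sum_(i < N) q ^+ i) * (1 - q) = 1 - q ^+ N.
  have := subrX1 q N; set s := \sum_(i < N) _ => H; rewrite mulrC.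
  by apply: oppr_inj; rewrite opprB H; ring.
by rewrite gerBl exprn_ge0.
Qed.

Lemma has_sum_series (a : nat -> R[i]) s : abs_summable a -> has_sum a s ->
  ccvg \oo (fun N => \sum_(i < N) a i) s.
Proof.
move=> sa hs; rewrite (_ : (fun N => _) =
  fun N => \sum_(i <- [fset i in iota 0 N]%fset) a i).
  apply: exhaust_ccvg => // i; exists i.+1 => //= N /= iN.
  by rewrite !inE mem_iota.
by apply/funext => N; rewrite sum_fset_iota.
Qed.

Lemma series_has_sum (a : nat -> R[i]) s : abs_summable a ->
  ccvg \oo (fun N => \sum_(i < N) a i) s -> has_sum a s.
Proof.
move=> sa cs; have [t ht] := abs_summable_has_sum sa.
by rewrite (ccvg_unique cs (has_sum_series sa ht)).
Qed.

(** Pairs are coded as functions on [bool], so that the product theorem for finite families yields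
    the Cauchy product; the triangles exhaust the set of pairs. *)
Definition bpair (i j : nat) : {ffun bool -> nat} := [ffun x => if x then i else j].

Definition antidiag n : {fset {ffun bool -> nat}} :=
  [fset bpair (val j) (n - val j) | j in 'I_n.+1]%fset.

Fixpoint triangle N : {fset {ffun bool -> nat}} :=
  if N is M.+1 then (triangle M `|` antidiag M)%fset else fset0.

Lemma mem_antidiag n k : (k \in antidiag n) = (k true + k false == n)%N.
Proof.
apply/imfsetP/eqP => [[j /= _ ->]|kn].
  by rewrite !ffunE subnKC // -ltnS.
have kn' : (k true < n.+1)%N by rewrite ltnS -kn leq_addr.
exists (Ordinal kn') => //=; apply/ffunP => -[]; rewrite ffunE //.
by rewrite -kn addKn.
Qed.

Lemma mem_triangle N k : (k \in triangle N) = (k true + k false < N)%N.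
Proof.
elim: N => [|N IH] /=; first by rewrite inE.
by rewrite inE IH mem_antidiag ltnS [RHS]leq_eqVlt orbC.
Qed.

Lemma sum_triangle (S : pzSemiRingType) (a b : nat -> S) N :
  \sum_(k <- triangle N) a (k true) * b (k false) =
  \sum_(n < N) \sum_(j < n.+1) a j * b (n - j)%N.
Proof.
elim: N => [|N IH]; first by rewrite big_seq_fset0 big_ord0.
rewrite big_ord_recr /= -IH (sum_fset_sub _ (fsubsetUl _ _)); congr (_ + _).
have -> : ((triangle N `|` antidiag N) `\` triangle N = antidiag N)%fset.
  apply/fsetP => k; rewrite !inE mem_triangle mem_antidiag.
  by case: ltngtP => // ->; rewrite ltnn.
rewrite big_imfset /=.
  by rewrite big_enum /=; apply: eq_bigr => j _; rewrite !ffunE.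
by move=> i j _ _ /ffunP/(_ true); rewrite !ffunE => /val_inj.
Qed.

Section Cauchy.
Context {a b : nat -> R[i]} (sa : abs_summable a) (sb : abs_summable b).

Let sab : abs_summable (fun k : {ffun bool -> nat} => a (k true) * b (k false)).
Proof.
have := @abs_summable_prod R bool nat (fun x => if x then a else b).
have -> : (fun k : {ffun bool -> nat} => a (k true) * b (k false)) =
   fun k => \prod_x (if x then a else b) (k x).
  by apply/funext => k; rewrite big_bool.
by apply=> -[].
Qed.

Lemma abs_summable_cauchy :
  abs_summable (fun n => \sum_(j < n.+1) a j * b (n - j)%N).
Proof.
have [M HM] := sab; exists M; apply: bounded_sums_nat => [n|N].
  exact: cnorm_ge0.
apply: le_trans (HM (triangle N)).
rewrite (_ : \sum_(i <- triangle N) _ =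
  \sum_(k <- triangle N) cnorm (a (k true)) * cnorm (b (k false))).
  rewrite (@sum_triangle R (fun i => cnorm (a i)) (fun i => cnorm (b i))); apply: ler_sum => n _.
  apply: le_trans (cnorm_sum _ _ _) _; apply: ler_sum => j _.
  by rewrite cnormM.
by apply: eq_bigr => k _; rewrite cnormM.
Qed.

Lemma has_sum_cauchy s t : has_sum a s -> has_sum b t ->
  has_sum (fun n => \sum_(j < n.+1) a j * b (n - j)%N) (s * t).
Proof.
move=> ha hb; apply: series_has_sum; first exact: abs_summable_cauchy.
rewrite (_ : (fun N => _) =
   fun N => \sum_(k <- triangle N) a (k true) * b (k false)).
  apply: exhaust_ccvg => //; last first.
    move=> k; exists (k true + k false).+1 => //= N /= kN.
    by rewrite mem_triangle.
  have := @has_sum_prod R bool nat (fun x => if x then a else b)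
    (fun x => if x then s else t).
  have -> : (fun k : {ffun bool -> nat} => a (k true) * b (k false)) =
    fun k => \prod_x (if x then a else b) (k x).
    by apply/funext => k; rewrite big_bool.
  by rewrite big_bool /=; apply=> -[].
by apply/funext => N; rewrite sum_triangle.
Qed.

End Cauchy.

End NatSums.

Section ComplexExp.
Context {R : realType}.
Implicit Types (z w : R[i]) (x : R).

Lemma cexpD z w : cexp (z + w) = cexp z * cexp w.
Proof.
case: z w => [a b] [c d]; rewrite /cexp /= expRD cosD sinD.
apply/eqP; rewrite eq_complex /=; apply/andP; split; apply/eqP; ring.
Qed.

Lemma cexp0 : cexp (0 : R[i]) = 1.
Proof. by rewrite /cexp /= expR0 cos0 sin0 mul1r. Qed.

Lemma cexpNK z : cexp z * cexp (- z) = 1.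
Proof. by rewrite -cexpD subrr cexp0. Qed.

Lemma cexp_neq0 z : cexp z != 0.
Proof.
by apply/eqP => z0; have := cexpNK z; rewrite z0 mul0r => /eqP; rewrite eq_sym oner_eq0.
Qed.

Lemma cexpN z : cexp (- z) = (cexp z)^-1.
Proof. by apply: (mulfI (cexp_neq0 z)); rewrite cexpNK divff ?cexp_neq0. Qed.

Lemma cexpMn z n : cexp (z *+ n) = cexp z ^+ n.
Proof. by elim: n => [|n IH]; rewrite ?cexp0 // mulrS exprS cexpD IH. Qed.

Lemma cnorm_cexp z : cnorm (cexp z) = expR (complex.Re z).
Proof.
rewrite /cexp cnormM cnorm_real ger0_norm ?expR_ge0 //.
by rewrite /cnorm /= cos2Dsin2 sqrtr1 mulr1.
Qed.

Lemma exp_coeff_sum_le (x : R) : 0 <= x ->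
  forall J : {fset nat}, \sum_(n <- J) x ^+ n / n`!%:R <= expR x.
Proof.
move=> x0; apply: bounded_sums_nat => [n|N].
  by rewrite divr_ge0 ?exprn_ge0.
rewrite -(big_mkord xpredT (fun n => x ^+ n / n`!%:R)).
apply: (@nondecreasing_cvgn_le _ (series (exp_coeff x))).
  apply/nondecreasing_seqP => n; rewrite /series /= big_nat_recr //= lerDl.
  exact: exp_coeff_ge0.
exact: is_cvg_series_exp_coeff.
Qed.

Lemma abs_summable_cexp z : abs_summable (fun n => z ^+ n / n`!%:R).
Proof.
exists (expR (cnorm z)) => J; apply: le_trans (exp_coeff_sum_le (cnorm_ge0 z) J).
apply: ler_sum => n _; rewrite cnormM cnormX cnormV.
by rewrite -(rmorph_nat (real_complex R)) cnorm_real ger0_norm.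
Qed.

Lemma ccvg_complex (T : Type) (F : set_system T) (FF : Filter F) (u v : T -> R)
    (l m : R) : u @ F --> l -> v @ F --> m ->
  ccvg F (fun i => u i +i* v i) (l +i* m).
Proof.
move=> ul vm; rewrite [l +i* m]complexE (_ : (fun i => _) =
  fun i => (u i)%:C + 'i * (v i)%:C).
  by apply: ccvgD; [|apply: ccvgMl]; apply: ccvg_real.
by apply/funext => i; rewrite [LHS]complexE.
Qed.

Lemma Re_sum (I : Type) (s : seq I) (F : I -> R[i]) :
  complex.Re (\sum_(i <- s) F i) = \sum_(i <- s) complex.Re (F i).
Proof. exact: (raddf_sum (@complex.Re R : {additive R[i] -> R})). Qed.

Lemma Im_sum (I : Type) (s : seq I) (F : I -> R[i]) :
  complex.Im (\sum_(i <- s) F i) = \sum_(i <- s) complex.Im (F i).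
Proof. exact: (raddf_sum (@complex.Im R : {additive R[i] -> R})). Qed.

Lemma has_sum_expR x : has_sum (fun n => x%:C ^+ n / n`!%:R) (expR x)%:C.
Proof.
apply: series_has_sum; first exact: abs_summable_cexp.
rewrite (_ : (fun N => _) = fun N => (series (exp_coeff x) N)%:C).
  by apply: ccvg_real; apply: is_cvg_series_exp_coeff.
apply/funext => N; rewrite /series /= big_mkord rmorph_sum.
by apply: eq_bigr => n _; rewrite rmorphM /= rmorphXn fmorphV rmorph_nat.
Qed.

Lemma has_sum_cis x :
  has_sum (fun n => ('i * x%:C) ^+ n / n`!%:R) (cos x +i* sin x).
Proof.
apply: series_has_sum; first exact: abs_summable_cexp.
rewrite (_ : (fun N => _) =
  fun N => series (cos_coeff x) N +i* series (sin_coeff x) N).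
  apply: ccvg_complex; rewrite ?unlock.
    exact: is_cvg_series_cos_coeff.
  exact: is_cvg_series_sin_coeff.
apply/funext => N; rewrite /series /= !big_mkord.
have co n : ('i * x%:C) ^+ n / n`!%:R = cos_coeff x n +i* sin_coeff x n.
  rewrite [RHS]complexE /cos_coeff /sin_coeff /= exprMn.
  rewrite !(rmorphM, rmorphXn, fmorphV, rmorph_nat, rmorphN1) /=.
  have -> : ('i : R[i]) ^+ n = (~~ odd n)%:R * (-1) ^+ n./2
                           + 'i * ((odd n)%:R * (-1) ^+ n.-1./2).
    rewrite -{1}(odd_double_half n); case: (boolP (odd n)) => on.
      rewrite /= add1n exprS -mul2n exprM sqr_i mul0r add0r mul1r.
      by congr (_ * _ ^+ _); rewrite -[in RHS](odd_double_half n) on /= half_double.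
    by rewrite /= add0n -mul2n exprM sqr_i mul0r mulr0 addr0 mul1r.
  by rewrite ?complexiE; ring.
apply/eqP; rewrite eq_complex /= Re_sum Im_sum; apply/andP; split; apply/eqP.
  by apply: eq_bigr => n _; rewrite co.
by apply: eq_bigr => n _; rewrite co.
Qed.

(** [cexp] is defined in polar form; its power series is the Cauchy product of those of [exp a] and
    [exp (i b)], by the binomial theorem. *)
Lemma has_sum_cexp z : has_sum (fun n => z ^+ n / n`!%:R) (cexp z).
Proof.
case: z => a b; rewrite /cexp /=.
have := has_sum_cauchy (abs_summable_cexp a%:C) (abs_summable_cexp ('i * b%:C))
  (has_sum_expR a) (has_sum_cis b).
apply: eq_has_sum => n; rewrite [a +i* b]complexE /= exprDn mulr_suml.
rewrite (reindex_inj rev_ord_inj) /=; apply: eq_bigr => j _.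
rewrite subSS subKn; last by rewrite -ltnS.
have jn : (j <= n)%N by rewrite -ltnS.
have n0 (m : nat) : (m`!%:R : R[i]) != 0.
  by rewrite pnatr_eq0 -lt0n fact_gt0.
rewrite -(bin_fact jn) !natrM -mulr_natr.
have nb : ('C(n, j)%:R : R[i]) != 0 by rewrite pnatr_eq0 -lt0n bin_gt0.
field; by rewrite !n0 nb.
Qed.

(** From the square on, the series is [|z|^2] times a series dominated by the geometric one of ratio
    at most 1/2, whose sum is at most 2. *)
Lemma cexp_approx z : cnorm z <= 2^-1 ->
  cnorm (cexp z - 1 - z) <= 2 * cnorm z ^+ 2.
Proof.
move=> z2; have z0 := cnorm_ge0 z.
have := @has_sum_tail _ _ (fun n => z ^+ n / n`!%:R) (cexp z)
   [fset i in iota 0 2]%fset (2 * cnorm z ^+ 2) _ (has_sum_cexp z).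
rewrite sum_fset_iota !big_ord_recr big_ord0 /= add0r !divr1 expr0 expr1.
rewrite opprD addrA; apply=> K dK.
have -> : \sum_(n <- K) cnorm (z ^+ n / n`!%:R) =
          \sum_(n <- K) cnorm z ^+ 2 * (cnorm z ^+ (n - 2) / n`!%:R).
  rewrite big_seq [RHS]big_seq; apply: eq_bigr => n nK.
  have n2 : (2 <= n)%N.
    by have := fdisjointP dK _ nK; rewrite !inE; case: (n) => [|[]].
  rewrite mulrA -exprD subnKC // cnormM cnormX cnormV.
  by rewrite -(rmorph_nat (real_complex R)) cnorm_real ger0_norm.
rewrite -mulr_sumr mulrC ler_wpM2r ?exprn_ge0 //.
have K2 : {in K &, injective (fun n => (n - 2)%N)}.
  move=> m n mK nK /=; have := fdisjointP dK _ nK; have := fdisjointP dK _ mK.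
  by rewrite !inE; case: (m) => [|[|m']] //; case: (n) => [|[|n']] //= _ _; lia.
apply: le_trans (_ : \sum_(n <- K) cnorm z ^+ (n - 2) <= _).
  apply: ler_sum => n _; rewrite ler_piMr ?exprn_ge0 // invf_le1 ?ltr0n ?fact_gt0 //.
  by rewrite ler1n fact_gt0.
have -> : \sum_(n <- K) cnorm z ^+ (n - 2) =
    \sum_(n <- [fset (n - 2)%N | n in K]%fset) cnorm z ^+ n by rewrite big_imfset.
apply: le_trans (@geometric_sum_le _ (cnorm z) _ _) _; first by apply/andP; lra.
have h0 : 0 < 1 - cnorm z by lra.
by rewrite -[leRHS]invrK lef_pV2 ?posrE //; lra.
Qed.

Lemma cexp_sub1_le z : cnorm z <= 2^-1 -> cnorm (cexp z - 1) <= 2 * cnorm z.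
Proof.
move=> z2; have := cexp_approx z2; have z0 := cnorm_ge0 z.
have := cnormD (cexp z - 1 - z) z; rewrite subrK.
by move: (cnorm _) (cnorm (_ - _)) (cnorm (_ - _ - _)) z0 z2 => a b c; nra.
Qed.

Lemma cexp_sub1_ge z : cnorm z <= 4^-1 -> cnorm z / 2 <= cnorm (cexp z - 1).
Proof.
move=> z4; have z2 : cnorm z <= 2^-1 by move: z4; lra.
have := cexp_approx z2; have z0 := cnorm_ge0 z.
have := cnormB (cexp z - 1 - z) (cexp z - 1).
have -> : cexp z - 1 - z - (cexp z - 1) = - z by ring.
rewrite cnormN.
by move: (cnorm _) (cnorm (_ - _)) (cnorm (_ - _ - _)) z0 z4 => a b c; nra.
Qed.

Lemma ccvg_cexp (T : Type) (F : set_system T) (FF : Filter F) (u : T -> R[i]) l :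
  ccvg F u l -> ccvg F (fun i => cexp (u i)) (cexp l).
Proof.
move=> ul e e0.
have l0 : 0 < cnorm (cexp l) by rewrite cnorm_gt0 cexp_neq0.
pose d := Num.min 2^-1 (e / cnorm (cexp l) / 4).
have d0 : 0 < d by rewrite lt_min invr_gt0 ltr0n /= !divr_gt0.
apply: filterS (ul _ d0) => i /=; rewrite lt_min => /andP[h1 h2].
have -> : cexp (u i) - cexp l = cexp l * (cexp (u i - l) - 1).
  by rewrite cexpD cexpN; field; rewrite cexp_neq0.
rewrite cnormM mulrC -ltr_pdivlMr //.
apply: le_lt_trans (cexp_sub1_le (ltW h1)) _.
have : 0 < e / cnorm (cexp l) by rewrite divr_gt0.
by move: h2; move: (cnorm _) (e / _) => a b; lra.
Qed.

Let c0 : R := cos (3 * pi / 8).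

(** Writing [e^z + 1 = e^(z/2) (e^(z/2) + e^(-z/2))], the real part of the second factor is a sum of
    two exponentials, at least 1, times [cos (Im z / 2)]; the hypothesis keeps this angle within
    [3 pi / 8 < pi / 2], whence [c0]. *)
Lemma cexp_add1_ge : exists2 c : R, 0 < c &
  forall z, `|complex.Re z| <= 1 -> `|complex.Im z| <= 3 * pi / 4 ->
  c <= cnorm (cexp z + 1).
Proof.
have p0 := @pi_gt0 R.
have c0_gt0 : 0 < c0 by apply: cos_gt0_pihalf; apply/andP; lra.
exists (c0 * expR (- 2^-1)) => [|z zr zi]; first by rewrite mulr_gt0 ?expR_gt0.
have -> : cexp z + 1 = cexp (z / 2) * (cexp (z / 2) + cexp (- (z / 2))).
  by rewrite mulrDr cexpNK -cexpD -splitr.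
have Rh (w : R[i]) : complex.Re (w / 2) = complex.Re w / 2.
  case: w => a b; have -> : (2 : R[i])^-1 = (2^-1)%:C.
    by rewrite fmorphV /= rmorph_nat.
  by rewrite /=; ring.
have Ih (w : R[i]) : complex.Im (w / 2) = complex.Im w / 2.
  case: w => a b; have -> : (2 : R[i])^-1 = (2^-1)%:C.
    by rewrite fmorphV /= rmorph_nat.
  by rewrite /=; ring.
rewrite cnormM cnorm_cexp mulrC ler_pM ?expR_ge0 ?(ltW c0_gt0) //.
  by rewrite ler_expR Rh; move: zr; rewrite ler_norml; lra.
apply: le_trans (normr_Re _); apply: le_trans (ler_norm _).
have -> : complex.Re (cexp (z / 2) + cexp (- (z / 2))) =
   (expR (complex.Re z / 2) + expR (- (complex.Re z / 2))) * cos (complex.Im z / 2).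
  rewrite /cexp -Rh -Ih; move: (z / 2) => [a b] /=; rewrite cosN; ring.
have cc : c0 <= cos (complex.Im z / 2).
  have zi2 : `|complex.Im z / 2| <= 3 * pi / 8.
    by rewrite normrM (ger0_norm (_ : 0 <= 2^-1)) //; move: zi; lra.
  rewrite -(cos_norm (complex.Im z / 2)) leNgt ltr_cos -?leNgt //.
    by rewrite in_itv /=; apply/andP; lra.
  by rewrite in_itv /= normr_ge0 /=; move: zi2; lra.
have e1 : 1 <= expR (complex.Re z / 2) + expR (- (complex.Re z / 2)).
  have := expR_ge0 (complex.Re z / 2); have := expR_ge0 (- (complex.Re z / 2)).
  case: (leP 0 (complex.Re z / 2)) => h.
    by have := expR_ge1Dx (complex.Re z / 2); move: h; lra.
  by have := expR_ge1Dx (- (complex.Re z / 2)); move: h; lra.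
by move: cc e1 c0_gt0; move: (cos _) (_ + _) c0 => a b c; nra.
Qed.

(** In this strip 0 is the only zero of [e^z - 1]. By [e^z - 1 = (e^(z/2) + 1) (e^(z/2) - 1)] each
    halving costs a factor [c], since the halved imaginary part is in the range of
    [cexp_add1_ge]. *)
Lemma cexp_sub1_strip : exists2 c : R, 0 < c &
  forall z, `|complex.Re z| <= 1 -> `|complex.Im z| <= 3 * pi / 2 ->
  c * cnorm z <= cnorm (cexp z - 1).
Proof.
have [c cp Hc] := cexp_add1_ge.
have p0 := @pi_gt0 R; have p4 : (pi : R) < 4 by have := @pihalf_lt2 R; lra.
have H2 (w : R[i]) : `|complex.Re w| <= 1 -> `|complex.Im w| <= 3 * pi / 2 ->
    [/\ `|complex.Re (w / 2)| <= 1, `|complex.Im (w / 2)| <= 3 * pi / 2 &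
    c * cnorm (cexp (w / 2) - 1) <= cnorm (cexp w - 1)].
  move=> wr wi.
  have h2 : (2 : R[i])^-1 = (2^-1)%:C by rewrite fmorphV /= rmorph_nat.
  have Rh : complex.Re (w / 2) = complex.Re w / 2.
    by rewrite h2; case: (w) => a b /=; ring.
  have Ih : complex.Im (w / 2) = complex.Im w / 2.
    by rewrite h2; case: (w) => a b /=; ring.
  have wr2 : `|complex.Re (w / 2)| <= 1.
    by rewrite Rh normrM (ger0_norm (_ : 0 <= 2^-1)) //; move: wr (normr_ge0 (complex.Re w)); lra.
  have wi2 : `|complex.Im (w / 2)| <= 3 * pi / 4.
    by rewrite Ih normrM (ger0_norm (_ : 0 <= 2^-1)) //; move: wi; lra.
  split=> //; first by move: wi2; lra.
  have -> : cexp w - 1 = (cexp (w / 2) + 1) * (cexp (w / 2) - 1).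
    by rewrite {1}(splitr w) cexpD; ring.
  by rewrite cnormM ler_wpM2r ?cnorm_ge0 // Hc.
have Hp p : forall w : R[i], `|complex.Re w| <= 1 -> `|complex.Im w| <= 3 * pi / 2 ->
    c ^+ p * cnorm (cexp (w / 2 ^+ p) - 1) <= cnorm (cexp w - 1).
  elim: p => [|p IH] w wr wi; first by rewrite expr0 mul1r divr1.
  have [r2 i2 H] := H2 w wr wi; apply: le_trans H.
  rewrite exprS -mulrA ler_wpM2l ?(ltW cp) //; apply: le_trans (IH _ r2 i2).
  by rewrite exprS invfM mulrA.
(* Five halvings suffice: [|z| <= 1 + 3 pi / 2 <= 7], so [|z| / 32 <= 1/4], where [cexp_sub1_ge]
   loses only a factor 2. *)
exists (c ^+ 5 / 64) => [|z zr zi]; first by rewrite divr_gt0 // exprn_gt0.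
apply: le_trans (Hp 5 z zr zi).
have nz : cnorm (z / 2 ^+ 5) = cnorm z / 32.
  rewrite cnormM cnormV cnormX -(rmorph_nat (real_complex R)) cnorm_real.
  by rewrite ger0_norm //; congr (_ / _); ring.
have z7 : cnorm (z / 2 ^+ 5) <= 4^-1.
  by rewrite nz; have := cnorm_le_ReIm z; move: zr zi p4; lra.
have := cexp_sub1_ge z7; rewrite nz => H.
rewrite -mulrA ler_wpM2l ?exprn_ge0 ?(ltW cp) //; apply: le_trans H; lra.
Qed.

End ComplexExp.

Definition echar (R : realType) (x : R) : R[i] := cexp (twopii R * x%:C).

Section Character.
Context {R : realType}.
Implicit Types (x y : R).

Lemma twopii_neq0 : twopii R != 0.
Proof.
rewrite /twopii mulf_neq0 //; last by rewrite -cnorm_gt0 cnorm_i.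
by rewrite -cnorm_gt0 cnorm_real normr_gt0 mulf_neq0 // gt_eqF // pi_gt0.
Qed.

Lemma cnorm_twopii : cnorm (twopii R) = 2 * pi.
Proof.
rewrite /twopii cnormM cnorm_i mulr1 cnorm_real ger0_norm //.
by rewrite mulr_ge0 // pi_ge0.
Qed.

Lemma Re_twopiiM (z : R[i]) : complex.Re (twopii R * z) = - (2 * pi) * complex.Im z.
Proof. by case: z => a b; rewrite /twopii -?complexiE /=; ring. Qed.

Lemma Im_twopiiM (z : R[i]) : complex.Im (twopii R * z) = 2 * pi * complex.Re z.
Proof. by case: z => a b; rewrite /twopii -?complexiE /=; ring. Qed.

Lemma echarE x : echar x = cos (2 * pi * x) +i* sin (2 * pi * x).
Proof. by rewrite /echar /cexp Re_twopiiM Im_twopiiM /= mulr0 expR0 mul1r. Qed.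

Lemma echarD x y : echar (x + y) = echar x * echar y.
Proof. by rewrite /echar rmorphD mulrDr cexpD. Qed.

Lemma echar0 : echar (0 : R) = 1.
Proof. by rewrite /echar rmorph0 mulr0 cexp0. Qed.

Lemma echarN x : echar (- x) = (echar x)^-1.
Proof. by rewrite /echar rmorphN mulrN cexpN. Qed.

Lemma cnorm_echar x : cnorm (echar x) = 1.
Proof. by rewrite /echar cnorm_cexp Re_twopiiM /= mulr0 expR0. Qed.

Lemma echarMn x n : echar (x *+ n) = echar x ^+ n.
Proof. by rewrite /echar raddfMn /= mulrnAr cexpMn. Qed.

Lemma echar1 : echar (1 : R) = 1.
Proof. by rewrite echarE mulr1 mulrC mulr_natr cos2pi sin2pi. Qed.

Lemma echar_int (n : int) : echar (n%:~R : R) = 1.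
Proof.
case: n => n; first by rewrite -[(Posz n)%:~R]/(1 *+ n) echarMn echar1 expr1n.
by rewrite NegzE intrN echarN -[(Posz n.+1)%:~R]/(1 *+ n.+1) echarMn echar1 expr1n invr1.
Qed.

Lemma echarDint x (n : int) : echar (x + n%:~R) = echar x.
Proof. by rewrite echarD echar_int mulr1. Qed.

Lemma echar_frac x : echar (frac x) = echar x.
Proof. by rewrite /frac echarD -rmorphN echar_int mulr1. Qed.

Lemma frac_ge0 x : 0 <= frac x.
Proof. by rewrite /frac subr_ge0 ge_floor. Qed.

Lemma frac_lt1 x : frac x < 1.
Proof. by rewrite /frac; have := floorD1_gt x; rewrite intrD; lra. Qed.

(** If the fractional part [a] were nonzero, [sin (pi a) > 0] would make
    [cos (2 pi a) = 1 - 2 sin^2 (pi a)] less than 1. *)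
Lemma echar_eq1 x : echar x = 1 -> exists n : int, x = n%:~R.
Proof.
move=> x1; exists (Num.floor x); apply/eqP; rewrite -subr_eq0 -/(frac x).
apply/negPn/negP => f0.
have f1 : 0 < frac x by rewrite lt_def f0 frac_ge0.
have := x1; rewrite -echar_frac echarE => -[c1 _].
have p0 := @pi_gt0 R.
have s0 : 0 < sin (pi * frac x).
  apply: sin_gt0_pi; rewrite mulr_gt0 //= -[ltRHS]mulr1 ltr_pM2l //.
  exact: frac_lt1.
have : cos ((pi * frac x) *+ 2) = 1.
  by rewrite -mulr_natl mulrA c1.
rewrite cos_mulr2n cos2sin2; move: s0; set s := sin _; nra.
Qed.

Lemma ccvg_echar (T : Type) (F : set_system T) (FF : Filter F) (u : T -> R) l :
  u @ F --> l -> ccvg F (fun i => echar (u i)) (echar l).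
Proof. by move=> ul; apply: ccvg_cexp; apply: ccvgMl; apply: ccvg_real. Qed.

End Character.

(** * One-dimensional Fourier expansion *)

Section IntSums.
Context {R : realType}.

Lemma bounded_sums_int (b : nat -> R) : (forall n, 0 <= b n) ->
  bounded_sums b -> bounded_sums (fun n : int => b `|n|%N).
Proof.
move=> b0 [M HM]; exists (M + M) => J.
rewrite (big_fsetID _ (fun n : int => 0 <= n)) /=; apply: lerD.
  apply: le_trans (HM [fset `|n|%N | n in [fset n in J | (0 <= n)%R]]%fset).
  rewrite [leRHS]big_imfset // => m n /=; rewrite !inE => /andP[_ m0] /andP[_ n0] mn.
  by rewrite -(gez0_abs m0) -(gez0_abs n0) mn.
apply: le_trans (HM [fset `|n|%N | n in [fset n in J | ~~ (0 <= n)%R]]%fset).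
rewrite [leRHS]big_imfset // => m n /=; rewrite !inE -!ltNge => /andP[_ m0] /andP[_ n0] mn.
by apply: oppr_inj; rewrite -(ltz0_abs m0) -(ltz0_abs n0) mn.
Qed.

(** The exponent exceeds 1 by [1/(q+1)] only: comparing a product over the whole arrangement with
    one over a basis gains just such a small power. For [q = 0] this is the quadratic weight. *)
Definition wt (q : nat) (n : int) : R :=
  ((1 + `|n|%:~R) `^ (1 + q.+1%:R^-1))^-1.

Lemma wt_ge0 q n : 0 <= wt q n.
Proof. by rewrite invr_ge0 powR_ge0. Qed.

Lemma wt0E n : wt 0 n = ((1 + `|n|%:~R) ^+ 2)^-1.
Proof. by rewrite /wt invr1 -[1 + 1]/(2%:R) powR_mulrn // addr_ge0. Qed.

(* With x = m^(1/q) and y = (m+1)^(1/q), the inequality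
   1 = y^q - x^q <= q (y - x) y^(q-1) bounds y^-(q+1) by q (1/x - 1/y). *)
Lemma powR_telescope (q m : nat) : (0 < m)%N ->
  (m.+1%:R `^ (1 + q.+1%:R^-1))^-1 <=
  q.+1%:R * ((m%:R `^ q.+1%:R^-1)^-1 - (m.+1%:R `^ q.+1%:R^-1)^-1) :> R.
Proof.
move=> m0; set p : R := q.+1%:R^-1.
set x := m%:R `^ p; set y := m.+1%:R `^ p.
have x0 : 0 < x by rewrite powR_gt0 // ltr0n.
have y0 : 0 < y by rewrite powR_gt0 // ltr0n.
have xy : x <= y by rewrite ge0_ler_powR ?nnegrE ?ler_nat // invr_ge0.
have pq : p * q.+1%:R = 1 by rewrite mulVf.
have xq : x ^+ q.+1 = m%:R by rewrite -powR_mulrn ?powR_ge0 // -powRrM pq powRr1.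
have yq : y ^+ q.+1 = m.+1%:R by rewrite -powR_mulrn ?powR_ge0 // -powRrM pq powRr1.
have -> : m.+1%:R `^ (1 + p) = y ^+ q.+2.
  rewrite powRD; last by rewrite pnatr_eq0 implybT.
  by rewrite powRr1 // exprSr yq.
have H : 1 <= (y - x) * (q.+1%:R * y ^+ q).
  have := subrXX y x q.+1; rewrite xq yq -(natr1 m) addrC addKr => H1.
  rewrite [leLHS]H1 ler_wpM2l ?subr_ge0 //.
  apply: le_trans (_ : \sum_(i < q.+1) y ^+ q <= _).
    apply: ler_sum => i _ /=.
    have -> : y ^+ q = y ^+ (q - i) * y ^+ i by rewrite -exprD subnK // -ltnS.
    by rewrite ler_wpM2l ?exprn_ge0 ?lerXn2r ?nnegrE ?(ltW x0) ?(ltW y0).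
  by rewrite sumr_const card_ord mulr_natl.
have -> : q.+1%:R * (x^-1 - y^-1) = (y - x) * (q.+1%:R * y ^+ q) / (x * y ^+ q.+1).
  by rewrite exprS; field; rewrite expf_neq0 ?gt_eqF.
apply: le_trans (_ : (x * y ^+ q.+1)^-1 <= _).
  have xyq : x * y ^+ q.+1 <= y ^+ q.+2.
    by rewrite [leRHS]exprS ler_wpM2r ?exprn_ge0 ?(ltW y0).
  have xq0 : 0 < x * y ^+ q.+1 by rewrite mulr_gt0 // exprn_gt0.
  have yq0 : 0 < y ^+ q.+2 by rewrite exprn_gt0.
  by rewrite lef_pV2 ?posrE.
by rewrite -[leLHS]mul1r ler_wpM2r // invr_ge0 mulr_ge0 ?exprn_ge0 ?(ltW x0) ?(ltW y0).
Qed.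

Lemma bounded_sums_wt q : bounded_sums (wt q).
Proof.
pose b (m : nat) : R := (m.+1%:R `^ (1 + q.+1%:R^-1))^-1.
have b0 m : 0 <= b m by rewrite invr_ge0 powR_ge0.
have : bounded_sums b.
  exists (1 + q.+1%:R); apply: bounded_sums_nat => // N.
  apply: le_trans (_ : \sum_(i < N.+1) b i <= _).
    by rewrite big_ord_recr /= lerDl.
  apply: le_trans (_ : 1 + q.+1%:R * (1 - (N.+1%:R `^ q.+1%:R^-1)^-1) <= _).
    elim: N => [|N IH].
      by rewrite big_ord_recr big_ord0 /= add0r /b !powR1 invr1 subrr mulr0 addr0.
    rewrite big_ord_recr /=; have := @powR_telescope q N.+1 isT.
    move: IH; rewrite /b; move: (\sum_(i < N.+1) _) => S.
    by rewrite !mulrBr; lra.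
  by rewrite lerD2l ler_piMr // gerBl invr_ge0 powR_ge0.
move=> /(bounded_sums_int b0); apply: bounded_sums_le => n.
by rewrite /b /wt -(natr1 `|n|%N) [_ + 1]addrC -abszE.
Qed.

Definition intbox (m : nat) : {fset int} :=
  [fset (Posz (val i) - Posz m) | i in 'I_(2 * m).+1]%fset.

Lemma mem_intbox m n : (n \in intbox m) = (`|n|%N <= m)%N.
Proof.
apply/imfsetP/idP => [[i _ ->]|nm].
  by move: (ltn_ord i) => /=; lia.
have h : (absz (n + Posz m)%R < (2 * m).+1)%N by lia.
by exists (Ordinal h) => //=; lia.
Qed.

Lemma sum_intbox (V : nmodType) (F : int -> V) m :
  \sum_(n <- intbox m) F n = \sum_(i < (2 * m).+1) F (Posz i - Posz m).
Proof.
rewrite big_imfset /=; first by rewrite big_enum.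
by move=> i j _ _ /addIr [] /val_inj.
Qed.

(** A Peetre-type inequality: translating the argument changes the weight by at most a constant
    factor, so that differences can be estimated at one point. *)
Lemma shift_weight (n d : int) :
  (1 + `|n|%:~R : R) <= (1 + `|d|%:~R) * (1 + `|n - d|%:~R).
Proof.
have -> : (1 + `|d|%:~R) * (1 + `|n - d|%:~R) =
   ((1 + `|d|) * (1 + `|n - d|))%:~R :> R by rewrite rmorphM !rmorphD.
rewrite -[1 + _](rmorphD intr 1 `|n|) ler_int; nia.
Qed.

Lemma seq_min_pos (F : int -> R) (s : seq int) : (forall n, 0 <= F n) ->
  exists2 c : R, 0 < c & forall n, n \in s -> F n != 0 -> c <= F n.
Proof.
move=> F0; elim: s => [|m s [c c0 Hc]]; first by exists 1.
have [Fm|Fm] := eqVneq (F m) 0.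
  exists c => // n; rewrite inE => /orP[/eqP->|/Hc//]; by rewrite Fm eqxx.
exists (Num.min c (F m)); first by rewrite lt_min c0 lt_def Fm F0.
by move=> n; rewrite inE ge_min => /orP[/eqP->|/Hc H /H ->//]; rewrite lexx orbT.
Qed.

Lemma int_shift_lower (b : R[i]) : exists2 c : R, 0 < c &
  forall n : int, n%:~R + b != 0 -> c * (1 + `|n|%:~R) <= cnorm (n%:~R + b).
Proof.
(* Beyond [N] the reverse triangle inequality suffices, since [2 |b| < N]; on the finitely many
   remaining integers the smallest nonzero value serves. *)
pose N := (Num.trunc (2 * cnorm b)).+2.
have [c c0 Hc] := @seq_min_pos (fun n => cnorm (n%:~R + b)) (intbox N)
  (fun n => cnorm_ge0 _).
have N1 : 0 < 1 + N%:R :> R by rewrite ltr_pwDl.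
exists (Num.min (c / (1 + N%:R)) 4^-1) => [|n nb].
  by rewrite lt_min divr_gt0 //= invr_gt0.
have n0 : 0 <= 1 + `|n|%:~R :> R by rewrite addr_ge0.
have [nN|nN] := leqP `|n|%N N.
  apply: le_trans (Hc n _ _); rewrite ?mem_intbox ?cnorm_eq0 //.
  apply: le_trans (_ : c / (1 + N%:R) * (1 + `|n|%:~R) <= _).
    by rewrite ler_wpM2r // ge_min lexx.
  rewrite -mulrA ler_piMr ?(ltW c0) // mulrC ler_pdivrMr // mul1r lerD2l.
  by rewrite -abszE -[N%:R]/((Posz N)%:~R) ler_int.
apply: le_trans (_ : 4^-1 * (1 + `|n|%:~R) <= _).
  by rewrite ler_wpM2r // ge_min lexx orbT.
have := cnorm_dist_sub (n%:~R : R[i]) (- b); rewrite opprK cnormN cnorm_int.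
have : (N%:R : R) <= `|n|%:~R by rewrite -abszE -[N%:R]/((Posz N)%:~R) ler_int lez_nat ltnW.
have : 2 * cnorm b < (Num.trunc (2 * cnorm b)).+1%:R.
  by have /andP[] := truncn_itv (mulr_ge0 (ler0n R 2) (cnorm_ge0 b)).
rewrite /N; move: (Num.trunc _) => t; rewrite -(natr1 t.+1) -(natr1 t).
have := ler0n R t; have := cnorm_ge0 b.
by move: (`|n|%:~R) (cnorm b) (t%:R) => a d e; lra.
Qed.

End IntSums.

Lemma ccvg_rate (R : realType) (u : nat -> R[i]) (l : R[i]) (K : R) (m0 : nat) :
  (forall m, (m0 <= m)%N -> cnorm (u m - l) <= K / m.+1%:R) -> ccvg \oo u l.
Proof.
move=> H; apply: (@ccvg_squeeze _ _ _ _ _ _ (fun m => K * m.+1%:R^-1)).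
  by exists m0 => // m /= /H.
by rewrite -[X in _ --> X](mulr0 K); apply: cvgMr; apply: cvg_harmonic.
Qed.

(* The finite Fourier expansion of x |-> exp(T x) over the (2m+1)-th roots of
   unity; its coefficients [fcoef] tend to 1/(T - 2 pi i n). *)
Section FiniteFourier.
Context {R : realType} (T : R[i]) (T1 : cexp T != 1).

Definition fnode (m : nat) (n : int) : R[i] :=
  (T - twopii R * n%:~R) / (2 * m).+1%:R.

Definition fcoef (m : nat) (n : int) : R[i] :=
  ((2 * m).+1%:R * (cexp (fnode m n) - 1))^-1.

Lemma cexpMr (z : R[i]) n : cexp (z * n%:R) = cexp z ^+ n.
Proof. by rewrite mulr_natr cexpMn. Qed.

Lemma echarMr (x : R) n : echar (x * n%:R) = echar x ^+ n.
Proof. by rewrite mulr_natr echarMn. Qed.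

Lemma M_neq0 (m : nat) : ((2 * m).+1%:R : R[i]) != 0.
Proof. by rewrite pnatr_eq0. Qed.

Lemma cexp_int (n : int) : cexp (twopii R * n%:~R) = 1.
Proof. by rewrite -(rmorph_int (real_complex R)) -[LHS]/(echar n%:~R) echar_int. Qed.

Lemma cexp_Bint (n : int) : cexp (T - twopii R * n%:~R) = cexp T.
Proof. by rewrite cexpD cexpN cexp_int invr1 mulr1. Qed.

Lemma cexp_fnodeX m n : cexp (fnode m n) ^+ (2 * m).+1 = cexp T.
Proof. by rewrite -cexpMr /fnode divfK ?M_neq0 // cexp_Bint. Qed.

Lemma cexp_fnode_neq1 m n : cexp (fnode m n) - 1 != 0.
Proof.
rewrite subr_eq0; apply/eqP => h; have := cexp_fnodeX m n.
by rewrite h expr1n => /esym/eqP; apply/negP.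
Qed.

Lemma T_neq n : T - twopii R * n%:~R != 0.
Proof.
apply/eqP => h; move: T1; rewrite -(cexp_Bint n) h cexp0 eqxx //.
Qed.

Lemma fcoefE m n : fcoef m n =
  (\sum_(l < (2 * m).+1) cexp (fnode m n) ^+ l)
  / ((2 * m).+1%:R * (cexp T - 1)).
Proof.
have := subrX1 (cexp (fnode m n)) (2 * m).+1; rewrite cexp_fnodeX => ->.
rewrite /fcoef; set S := \sum_(l < _) _ => //.
have S0 : S != 0.
  have : cexp T - 1 != 0 by rewrite subr_eq0.
  have := subrX1 (cexp (fnode m n)) (2 * m).+1; rewrite cexp_fnodeX => ->.
  by rewrite mulf_eq0 negb_or => /andP[].
move: (M_neq0 m) (cexp_fnode_neq1 m n) S0.
move: (_%:R) S (cexp _ - 1) => a d e a0 e0 d0; field; by rewrite a0 e0 d0.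
Qed.

Lemma cexp_fnodeXl m n l : cexp (fnode m n) ^+ l =
  cexp (T * (l%:R / (2 * m).+1%:R)) * echar (- (n%:~R * (l%:R / (2 * m).+1%:R))).
Proof.
rewrite -cexpMr /echar -cexpD /fnode; congr cexp.
rewrite rmorphN rmorphM /= rmorph_int rmorphM /= fmorphV !rmorph_nat.
by move: (M_neq0 m); move: (_.+1%:R) => a a0; field.
Qed.

Lemma sum_echar_eq0 m (d : int) : (0 < `|d|%N < (2 * m).+1)%N ->
  \sum_(n <- intbox m) echar (n%:~R * (d%:~R / (2 * m).+1%:R)) = 0 :> R[i].
Proof.
move=> /andP[d0 dM]; rewrite sum_intbox.
set z := echar (d%:~R / (2 * m).+1%:R : R).
have M0 : ((2 * m).+1%:R : R) != 0 by rewrite pnatr_eq0.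
have z1 : z != 1.
  apply/eqP => /echar_eq1[k] /(congr1 (fun x => x * (2 * m).+1%:R)).
  rewrite divfK // -[(2 * m).+1%:R]/((Posz (2 * m).+1)%:~R) -rmorphM /=.
  move=> /intr_inj dk; move: d0 dM; rewrite dk abszM /=.
  by case: (`|k|%N) => [|k'] //; rewrite mulSn; lia.
have -> : \sum_(i < (2 * m).+1) echar ((Posz i - Posz m)%:~R * (d%:~R / (2 * m).+1%:R)) =
   echar (- (m%:R * (d%:~R / (2 * m).+1%:R))) * \sum_(i < (2 * m).+1) z ^+ i.
  rewrite mulr_sumr; apply: eq_bigr => i _; rewrite -echarMr -echarD; congr echar.
  by rewrite rmorphB /= -!pmulrn; ring.
have : (z - 1) * (\sum_(i < (2 * m).+1) z ^+ i) = 0.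
  rewrite -subrX1 -echarMr divfK // echar_int subrr //.
by move=> /eqP; rewrite mulf_eq0 subr_eq0 (negbTE z1) /= => /eqP ->; rewrite mulr0.
Qed.

(** Inverse discrete Fourier transform: once [fcoef] is written as a geometric sum over [l], the sum
    over [n] of the characters vanishes unless [l = j]. *)
Lemma sum_fcoef m j : (j < (2 * m).+1)%N ->
  \sum_(n <- intbox m) echar (n%:~R * (j%:R / (2 * m).+1%:R)) * fcoef m n =
  cexp (T * (j%:R / (2 * m).+1%:R)) / (cexp T - 1).
Proof.
move=> jM; have MC := M_neq0 m.
have T0 : cexp T - 1 != 0 by rewrite subr_eq0.
have sM : size (intbox m) = (2 * m).+1.
  have := sum_intbox (fun=> 1%N) m; rewrite sum1_size => ->.
  by rewrite sum1_card card_ord.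
have E l n : echar (n%:~R * (j%:R / (2 * m).+1%:R)) * cexp (fnode m n) ^+ l =
    cexp (T * (l%:R / (2 * m).+1%:R)) *
    echar (n%:~R * ((Posz j - Posz l)%:~R / (2 * m).+1%:R)).
  rewrite cexp_fnodeXl mulrCA; congr (_ * _); rewrite -echarD; congr echar.
  by rewrite intrB -!pmulrn mulrBl mulrBr.
have D : \sum_(l < (2 * m).+1) \sum_(n <- intbox m)
     echar (n%:~R * (j%:R / (2 * m).+1%:R)) * cexp (fnode m n) ^+ l =
     cexp (T * (j%:R / (2 * m).+1%:R)) * (2 * m).+1%:R.
  rewrite (bigD1 (Ordinal jM)) //= [X in _ + X]big1 => [|l lj].
    rewrite addr0 (eq_bigr (fun=> cexp (T * (j%:R / (2 * m).+1%:R)))) => [|n _].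
      by rewrite big_const_seq /= count_predT iter_addr_0 sM mulr_natr.
    by rewrite E subrr mul0r mulr0 echar0 mulr1.
  have lj' : (0 < absz (Posz j - Posz l)%R < (2 * m).+1)%N.
    have := ltn_ord l; have : (nat_of_ord l != j) by [].
    by move: (jM); lia.
  under eq_bigr do rewrite E.
  by rewrite -mulr_sumr sum_echar_eq0 // mulr0.
under eq_bigr do rewrite fcoefE mulrA mulr_sumr.
rewrite -mulr_suml exchange_big /= D.
by rewrite invfM mulrA mulfK.
Qed.

Lemma fcoef_period m (n : int) : fcoef m (n + Posz (2 * m).+1) = fcoef m n.
Proof.
rewrite /fcoef; suff -> : fnode m (n + Posz (2 * m).+1) = fnode m n - twopii R * 1%:~R.
  by rewrite cexpD cexpN cexp_int invr1 mulr1.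
rewrite /fnode rmorphD /= -!pmulrn.
by move: (M_neq0 m); move: (_.+1%:R) => a a0; field.
Qed.

(** Summation by parts on the cyclic group of order [M = 2m+1] has no boundary terms; the factor
    [1 - e(j/M)] buys the quadratic decay of the differences, which [fcoef] itself lacks. *)
Lemma sum_diff_fcoef m j : (j < (2 * m).+1)%N ->
  \sum_(n <- intbox m) echar (n%:~R * (j%:R / (2 * m).+1%:R))
     * (fcoef m n - fcoef m (n - 1)) =
  (1 - echar (j%:R / (2 * m).+1%:R)) * (cexp (T * (j%:R / (2 * m).+1%:R)) / (cexp T - 1)).
Proof.
move=> jM; rewrite -(sum_fcoef jM); set al := j%:R / _.
pose P n := echar (n%:~R * al) * fcoef m n.
have Pper (n : int) : P (n + Posz (2 * m).+1) = P n.
  rewrite /P fcoef_period rmorphD /= mulrDl echarD; congr (_ * _).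
  have -> : (Posz (2 * m).+1)%:~R * al = j%:R.
    by rewrite -pmulrn mulrC divfK ?pnatr_eq0.
  by rewrite -[j%:R]/((Posz j)%:~R) echar_int mulr1.
have -> : \sum_(n <- intbox m) echar (n%:~R * al) * (fcoef m n - fcoef m (n - 1)) =
  \sum_(n <- intbox m) P n - echar al * \sum_(n <- intbox m) P (n - 1).
  rewrite mulr_sumr -sumrB; apply: eq_bigr => n _; rewrite mulrBr /P mulrA -echarD.
  by congr (_ - echar _ * _); rewrite rmorphB /=; ring.
have -> : \sum_(n <- intbox m) P (n - 1) = \sum_(n <- intbox m) P n.
  rewrite !sum_intbox big_ord_recl [RHS]big_ord_recr /= addrC; congr (_ + _).
    by apply: eq_bigr => i _; congr P; rewrite /bump /=; lia.
  by rewrite -Pper; congr P; lia.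
by rewrite mulrBl mul1r.
Qed.

Lemma fcoef_cvg n : ccvg \oo (fun m => fcoef m n) (T - twopii R * n%:~R)^-1.
Proof.
apply: ccvgV; first exact: T_neq.
set z := T - twopii R * n%:~R.
apply: (@ccvg_rate _ _ _ (2 * cnorm z ^+ 2) (Num.trunc (2 * cnorm z)).+1) => m mz.
have zn := cnorm_ge0 z.
have cM : cnorm ((2 * m).+1%:R : R[i]) = (2 * m).+1%:R.
  by rewrite -(rmorph_nat (real_complex R)) cnorm_real ger0_norm.
have M0 : 0 < (2 * m).+1%:R :> R by rewrite ltr0n.
have nf : cnorm (fnode m n) = cnorm z / (2 * m).+1%:R.
  by rewrite /fnode cnormM cnormV cM.
have mz2 : 2 * cnorm z <= (2 * m).+1%:R.
  have /andP[_ h] := truncn_itv (mulr_ge0 (ler0n R 2) zn).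
  apply: le_trans (ltW h) _; rewrite ler_nat.
  by move: mz; move: (Num.trunc _) => t; lia.
have f2 : cnorm (fnode m n) <= 2^-1.
  by rewrite nf ler_pdivrMr // mulrC ler_pdivlMr // mulrC.
have -> : (2 * m).+1%:R * (cexp (fnode m n) - 1) - z =
          (2 * m).+1%:R * (cexp (fnode m n) - 1 - fnode m n).
  have hf : (2 * m).+1%:R * fnode m n = z by rewrite /fnode mulrC divfK ?M_neq0.
  by rewrite [RHS]mulrBr hf.
rewrite cnormM cM; apply: le_trans (_ : (2 * m).+1%:R * (2 * cnorm (fnode m n) ^+ 2) <= _).
  by rewrite ler_wpM2l ?cexp_approx.
rewrite nf; have -> : (2 * m).+1%:R * (2 * (cnorm z / (2 * m).+1%:R) ^+ 2) =
  2 * cnorm z ^+ 2 / (2 * m).+1%:R by field; rewrite gt_eqF.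
rewrite ler_wpM2l ?mulr_ge0 ?exprn_ge0 // lef_pV2 ?posrE ?ltr0n // ler_nat; lia.
Qed.

(** The bound is uniform in [m], as dominated convergence requires: the difference has a numerator
    of order [1/M] and a denominator at least a constant times [(1 + |n|) (1 + |n-1|) / M], so [M]
    cancels. *)
Lemma fcoef_diff_le : exists K : R, exists m0 : nat, forall m, (m0 <= m)%N ->
  forall n, (`|n|%N <= m)%N -> cnorm (fcoef m n - fcoef m (n - 1)) <= K * wt 0 n.
Proof.
have [c c0 Hc] := @cexp_sub1_strip R.
have [d d0 Hd] := int_shift_lower (- (T / twopii R)).
have p0 := @pi_gt0 R; have p2 := @pi_ge2 R.
have t0 := twopii_neq0 (R := R).
have tn := cnorm_ge0 T.
have low n : 2 * pi * d * (1 + `|n|%:~R) <= cnorm (T - twopii R * n%:~R).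
  have -> : T - twopii R * n%:~R = - twopii R * (n%:~R - T / twopii R).
    by field.
  rewrite cnormM cnormN cnorm_twopii -mulrA ler_wpM2l ?mulr_ge0 ?(ltW p0) //.
  apply: Hd; apply/eqP => h; have /eqP := T_neq n; apply.
  have -> : T - twopii R * n%:~R = - twopii R * (n%:~R - T / twopii R).
    by field.
  by rewrite h mulr0.
(* Large enough for the nodes with [|n| <= m + 1] to lie in the strip of [cexp_sub1_strip] and for
   [2 pi / M] to be at most 1/2. *)
pose m0 := ((Num.trunc (cnorm T)).+1 + 13)%N.
exists (expR (cnorm T) * (4 * pi) * 2 / (c * (2 * pi * d)) ^+ 2), m0 => m mm n nm.
have mT : cnorm T + 13 <= m%:R.
  have /andP[_ h] := truncn_itv tn.
  apply: le_trans (_ : (Num.trunc (cnorm T)).+1%:R + 13 <= _).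
    by rewrite lerD2r ltW.
  by rewrite -natrD ler_nat.
set M := (2 * m).+1; have ME : M%:R = 2 * m%:R + 1 :> R by rewrite /M -natr1 natrM.
have M0 : 0 < M%:R :> R by rewrite ltr0n.
have cM : cnorm (M%:R : R[i]) = M%:R.
  by rewrite -(rmorph_nat (real_complex R)) cnorm_real ger0_norm.
have MV : (M%:R : R[i])^-1 = (M%:R^-1)%:C by rewrite fmorphV /= rmorph_nat.
have reM (z : R[i]) : complex.Re (z / M%:R) = complex.Re z / M%:R.
  by rewrite MV; case: z => a b /=; ring.
have imM (z : R[i]) : complex.Im (z / M%:R) = complex.Im z / M%:R.
  by rewrite MV; case: z => a b /=; ring.
have nM k : (`|k|%N <= m.+1)%N -> `|k%:~R| <= m%:R + 1 :> R.
  by move=> km; rewrite -intr_norm -abszE natr1 -[leRHS]/((Posz m.+1)%:~R) ler_int.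
have reT k : complex.Re (T - twopii R * k%:~R) = complex.Re T.
  rewrite raddfB /= Re_twopiiM -(rmorph_int (real_complex R)) /=; ring.
have imT k : complex.Im (T - twopii R * k%:~R) = complex.Im T - 2 * pi * k%:~R.
  by rewrite raddfB /= Im_twopiiM -(rmorph_int (real_complex R)).
have lowf k : (`|k|%N <= m.+1)%N ->
    c * (2 * pi * d) * (1 + `|k|%:~R) / M%:R <= cnorm (cexp (fnode m k) - 1).
  move=> km; apply: le_trans (Hc _ _ _).
  - rewrite -!mulrA ler_wpM2l ?(ltW c0) // /fnode cnormM cnormV cM !mulrA.
    by rewrite ler_wpM2r ?invr_ge0 ?(ltW M0).
  - rewrite /fnode reM reT normrM (ger0_norm (_ : 0 <= M%:R^-1)) ?invr_ge0 ?(ltW M0) //.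
    rewrite ler_pdivrMr // mul1r; apply: le_trans (normr_Re _) _.
    by rewrite ME; move: mT tn; lra.
  rewrite /fnode imM imT normrM (ger0_norm (_ : 0 <= M%:R^-1)) ?invr_ge0 ?(ltW M0) //.
  rewrite ler_pdivrMr //; apply: le_trans (ler_normB _ _) _.
  have := normr_Im T; have := nM _ km; rewrite normrM ger0_norm ?mulr_ge0 ?(ltW p0) //.
  rewrite ME; move: mT tn p2; move: (`|k%:~R|) (`|complex.Im T|) (m%:R) (cnorm T) pi.
  by move=> a b e f g; nra.
have w1 (k : int) : 0 < 1 + `|k|%:~R :> R by rewrite ltr_pwDl // ler0z.
have E : fcoef m n - fcoef m (n - 1) = cexp (fnode m n) * (echar M%:R^-1 - 1)
   / (M%:R * ((cexp (fnode m n) - 1) * (cexp (fnode m (n - 1)) - 1))).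
  have -> : cexp (fnode m n) * (echar M%:R^-1 - 1) =
            cexp (fnode m (n - 1)) - cexp (fnode m n).
    rewrite mulrBr mulr1 /echar -cexpD; congr (cexp _ - _).
    rewrite -MV /fnode -/M intrB mulr1z; move: (M_neq0 m); rewrite -/M.
    by move: (M%:R) => a a0'; field.
  rewrite /fcoef -/M; move: (cexp_fnode_neq1 m n) (cexp_fnode_neq1 m (n - 1)).
  move: (M_neq0 m); rewrite -/M; move: (cexp (fnode m n)) (cexp _) (M%:R).
  by move=> a b e e0 a0' b0; field; rewrite e0 a0' b0.
have nume : cnorm (cexp (fnode m n) * (echar M%:R^-1 - 1)) <=
    expR (cnorm T) * (4 * pi / M%:R).
  rewrite cnormM ler_pM ?cnorm_ge0 //.
    rewrite cnorm_cexp ler_expR reM reT; apply: le_trans (ler_norm _) _.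
    rewrite normrM (ger0_norm (_ : 0 <= M%:R^-1)) ?invr_ge0 ?(ltW M0) //.
    rewrite ler_pdivrMr //; apply: le_trans (normr_Re _) _.
    by rewrite ler_peMr // ler1n.
  have nz : cnorm (twopii R * (M%:R^-1)%:C) = 2 * pi / M%:R.
    by rewrite cnormM cnorm_twopii cnorm_real ger0_norm ?invr_ge0 ?(ltW M0).
  apply: le_trans (cexp_sub1_le _) _; rewrite nz; last by lra.
  rewrite ler_pdivrMr // ME; have := @pihalf_lt2 R; move: mT tn; lra.
have wn : (1 + `|n|%:~R : R) <= 2 * (1 + `|n - 1|%:~R).
  by have := @shift_weight R n 1; rewrite normr1.
rewrite E cnormM cnormV wt0E.
set den := M%:R * _; have den0 : 0 < cnorm den.
  by rewrite cnorm_gt0 !mulf_neq0 ?cexp_fnode_neq1 ?M_neq0.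
rewrite ler_pdivrMr //; apply: le_trans nume _.
have dge : (c * (2 * pi * d)) ^+ 2 * ((1 + `|n|%:~R) * (1 + `|n - 1|%:~R)) / M%:R <= cnorm den.
  rewrite /den !cnormM cM.
  have h1 := lowf n (leqW nm).
  have h2 : (absz (n - 1)%R <= m.+1)%N by clear -nm; lia.
  have := lowf _ h2 => {}h2.
  apply: le_trans (_ : M%:R * ((c * (2 * pi * d) * (1 + `|n|%:~R) / M%:R) *
    (c * (2 * pi * d) * (1 + `|n - 1|%:~R) / M%:R)) <= _).
    by rewrite le_eqVlt; apply/orP; left; apply/eqP; field; rewrite gt_eqF.
  have k0 : 0 <= c * (2 * pi * d) by rewrite !mulr_ge0 ?(ltW c0) ?(ltW p0) ?(ltW d0).
  rewrite ler_wpM2l ?(ltW M0) // ler_pM //.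
    by rewrite !mulr_ge0 ?invr_ge0 ?(ltW (w1 _)) ?(ltW M0) ?(ltW c0) ?(ltW p0) ?(ltW d0).
  by rewrite !mulr_ge0 ?invr_ge0 ?(ltW (w1 _)) ?(ltW M0) ?(ltW c0) ?(ltW p0) ?(ltW d0).
have k0 : 0 < c * (2 * pi * d) by rewrite !mulr_gt0.
have w20 := w1 n; have w21 := w1 (n - 1).
have K0 : 0 <= expR (cnorm T) * (4 * pi) * 2 / (c * (2 * pi * d)) ^+ 2 / (1 + `|n|%:~R) ^+ 2.
  by rewrite !mulr_ge0 ?expR_ge0 ?invr_ge0 ?exprn_ge0 ?(ltW k0) ?(ltW w20) ?(ltW p0).
apply: le_trans (ler_wpM2l K0 dge).
set k := c * _ in k0 *; set A := 1 + `|n|%:~R in wn w20 *.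
set B := 1 + _ in wn w21 *; set E0 := expR _.
have -> : E0 * (4 * pi) * 2 / k ^+ 2 / A ^+ 2 * (k ^+ 2 * (A * B) / M%:R) =
   E0 * (4 * pi / M%:R) * (2 * B / A).
  by field; rewrite !gt_eqF.
rewrite ler_peMr ?mulr_ge0 ?expR_ge0 ?invr_ge0 ?(ltW p0) ?(ltW M0) //.
by rewrite ler_pdivlMr // mul1r.
Qed.

End FiniteFourier.

(** Limit of the finite expansions as the grid is refined. The Fourier series itself converges only
    conditionally; its product with [1 - e(al)], a series of differences, is dominated. *)
Lemma has_sum_fourier (R : realType) (T : R[i]) (al : R) : cexp T != 1 ->
  0 <= al < 1 ->
  has_sum (fun n : int => echar (n%:~R * al)
     * ((T - twopii R * n%:~R)^-1 - (T - twopii R * (n - 1)%:~R)^-1))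
   ((1 - echar al) * (cexp (T * al%:C) / (cexp T - 1))).
Proof.
move=> T1 /andP[a0 a1].
have [K0 [m0 HK]] := fcoef_diff_le T1; pose K := `|K0|.
have HK' m n : (m0 <= m)%N -> (`|n|%N <= m)%N ->
    cnorm (fcoef T m n - fcoef T m (n - 1)) <= K * wt 0 n.
  move=> h1 h2; apply: le_trans (HK m h1 n h2) _.
  by rewrite ler_wpM2r ?wt_ge0 ?ler_norm.
have sw : bounded_sums (fun n => K * wt (R := R) 0 n).
  by apply: bounded_sumsZ; rewrite ?normr_ge0 //; apply: bounded_sums_wt.
(* The quotients [j m / (2m+1)] are grid points tending to [al]; [al < 1] keeps [j m] in the range
   of [sum_diff_fcoef]. *)
pose j m := Num.trunc (al * (2 * m).+1%:R).
have jl m : (j m < (2 * m).+1)%N.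
  rewrite -(ltr_nat R); have h : 0 <= al * (2 * m).+1%:R by rewrite mulr_ge0.
  have /andP[h1 _] := truncn_itv h; apply: le_lt_trans h1 _.
  by rewrite gtr_pMl // ltr0n.
have jc : (fun m => (j m)%:R / (2 * m).+1%:R) @ \oo --> al.
  apply/cvgrPdist_lt => e e0.
  have := @cvg_harmonic R => /cvgrPdist_lt/(_ e e0)[N _ HN].
  exists N => // m /= /HN /=; rewrite sub0r normrN ger0_norm ?invr_ge0 // => hm.
  apply: le_lt_trans hm.
  have h : 0 <= al * (2 * m).+1%:R by rewrite mulr_ge0.
  have /andP[h1 h2] := truncn_itv h.
  have M0 : 0 < (2 * m).+1%:R :> R by rewrite ltr0n.
  have -> : al - (j m)%:R / (2 * m).+1%:R = (al * (2 * m).+1%:R - (j m)%:R) / (2 * m).+1%:R.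
    by field; rewrite gt_eqF.
  rewrite ger0_norm; last by rewrite divr_ge0 ?subr_ge0.
  apply: le_trans (_ : 1 / (2 * m).+1%:R <= _).
    rewrite ler_wpM2r ?invr_ge0 //; move: h2; rewrite -/(j m) -(natr1 (j m)); lra.
  by rewrite mul1r lef_pV2 ?posrE ?ltr0n // ler_nat; lia.
pose a m (n : int) := if n \in intbox m then
  echar (n%:~R * ((j m)%:R / (2 * m).+1%:R)) * (fcoef T m n - fcoef T m (n - 1)) else 0.
pose l (n : int) := echar (n%:~R * al)
     * ((T - twopii R * n%:~R)^-1 - (T - twopii R * (n - 1)%:~R)^-1).
have al_l n : ccvg \oo (a^~ n) (l n).
  apply: (@near_eq_ccvg _ _ _ _ (fun m => echar (n%:~R * ((j m)%:R / (2 * m).+1%:R))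
    * (fcoef T m n - fcoef T m (n - 1)))).
    by exists `|n|%N => // m /= nm; rewrite /a mem_intbox nm.
  apply: ccvgM; last by apply: ccvgB; apply: fcoef_cvg.
  by apply: ccvg_echar; apply: cvgMr.
have ad m : (m0 <= m)%N -> forall n, cnorm (a m n) <= K * wt 0 n.
  move=> mm n; rewrite /a mem_intbox; case: ifPn => h.
    by rewrite cnormM cnorm_echar mul1r HK'.
  by rewrite cnorm0 mulr_ge0 ?normr_ge0 ?wt_ge0.
have [t ht] : exists t, has_sum l t.
  apply: (abs_summable_has_sum_le sw) => n.
  by apply: ccvg_cnorm_le (al_l n); exists m0 => // m /= /ad.
suff -> : (1 - echar al) * (cexp (T * al%:C) / (cexp T - 1)) = t by [].
apply: (@ccvg_unique _ _ \oo _ (fun m => (1 - echar ((j m)%:R / (2 * m).+1%:R)) *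
   (cexp (T * ((j m)%:R / (2 * m).+1%:R)) / (cexp T - 1)))).
  apply: ccvgM; first by apply: ccvgB; [apply: ccvg_cst|apply: ccvg_echar].
  apply: ccvgM; last exact: ccvg_cst.
  apply: ccvg_cexp; apply: ccvgMl; apply: eq_ccvg (ccvg_real _ jc) => m.
  by rewrite rmorphM fmorphV !rmorph_nat.
apply: (@dominated_ccvg _ _ _ \oo _ a l _ _ _ sw) => //.
exists m0 => // m /= mm; split; first exact: ad.
rewrite -(sum_diff_fcoef T1 (jl m)) (_ : \sum_(n <- intbox m) _ = \sum_(n <- intbox m) a m n).
  by apply: has_sum_fin => n nm; rewrite /a (negbTE nm).
by rewrite big_seq [RHS]big_seq; apply: eq_bigr => n nm; rewrite /a nm.
Qed.

(* Taylor coefficients of t / (t - x) at t = 0; for [0 < k] and [x = 0] the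
   value is 0 because [0^-1 = 0]. *)
Definition qcoef (R : realType) (k : nat) (x : R[i]) : R[i] :=
  if k == 0%N then (x == 0)%:R else - (x ^- k).

Section PoleCoef.
Context {R : realType}.

(** Coefficientwise form of [(t - x) (t / (t - x)) = t]; with the chosen defaults it holds for
    [x = 0] as well. *)
Lemma qcoef_rec (x : R[i]) k :
  (if k is k'.+1 then qcoef k' x else 0) - x * qcoef k x = (k == 1%N)%:R.
Proof.
rewrite /qcoef; case: k => [|[|k]] /=.
- by rewrite sub0r; case: eqP => [->|]; rewrite ?mul0r ?mulr0 oppr0.
- rewrite expr1 mulrN opprK; have [->|x0] := eqVneq x 0.
    by rewrite mul0r addr0.
  by rewrite add0r divff.
- have [->|x0] := eqVneq x 0; first by rewrite mul0r subr0 expr0n /= invr0 oppr0.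
  by rewrite mulrN opprK [x ^+ k.+2]exprS invfM mulrA divff // mul1r addNr.
Qed.

Lemma qcoef_geom (x t : R[i]) N : (t - x) * (\sum_(k < N.+2) qcoef k x * t ^+ k) =
  t + qcoef N.+1 x * t ^+ N.+2.
Proof.
elim: N => [|N IH].
  rewrite !big_ord_recr big_ord0 /= add0r expr0 expr1.
  have := qcoef_rec x 0; have := qcoef_rec x 1 => /=; rewrite sub0r.
  move=> h1 h0; have -> : (t - x) * (qcoef 0 x * 1 + qcoef 1 x * t) =
    t * (qcoef 0 x - x * qcoef 1 x) + - (x * qcoef 0 x) + qcoef 1 x * t ^+ 2 by ring.
  by rewrite h1 h0 mulr1 addr0.
rewrite big_ord_recr /= mulrDr IH.
have := qcoef_rec x N.+2 => /= h; rewrite [t ^+ N.+3]exprS.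
have -> : t + qcoef N.+1 x * t ^+ N.+2 + (t - x) * (qcoef N.+2 x * t ^+ N.+2) =
  t + (qcoef N.+1 x - x * qcoef N.+2 x) * t ^+ N.+2
    + qcoef N.+2 x * (t * t ^+ N.+2) by ring.
by rewrite h mul0r addr0.
Qed.

Variable b : R[i].

Definition pnode (n : int) : R[i] := twopii R * (n%:~R + b).

Let W (n : int) : R := 1 + `|n|%:~R.

Let W_ge1 n : 1 <= W n. Proof. by rewrite lerDl. Qed.
Let W_gt0 n : 0 < W n. Proof. exact: lt_le_trans (W_ge1 n). Qed.

Lemma pnode_lower : exists2 c : R, 0 < c <= 1 &
  forall n, pnode n != 0 -> c * (1 + `|n|%:~R) <= cnorm (pnode n).
Proof.
have [c c0 Hc] := int_shift_lower b; have p2 := @pi_ge2 R.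
exists (Num.min c 1) => [|n]; first by rewrite lt_min c0 ltr01 ge_min lexx orbT.
rewrite mulf_eq0 negb_or => /andP[_ /Hc H]; rewrite cnormM cnorm_twopii.
apply: le_trans (_ : c * (1 + `|n|%:~R) <= _).
  by rewrite ler_wpM2r ?(ltW (W_gt0 n)) // ge_min lexx.
apply: le_trans H _; rewrite ler_peMl ?cnorm_ge0 //; lra.
Qed.

Lemma pnode_eq0 n : pnode n = 0 -> W n = 1 + cnorm b.
Proof.
move/eqP; rewrite mulf_eq0 (negbTE (twopii_neq0 (R := R))) /= addr_eq0 => /eqP h.
by rewrite /W -(cnormN b) -h cnorm_int.
Qed.

(** Only [k = 1] has decay of order 1: [k = 0] is supported on at most one integer, and differences
    of shifts always have order 2. The growth in [k], geometric and uniform in [n], yields a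
    positive radius of convergence. *)
Lemma qcoef_bound : exists K M : R, [/\ 1 <= K, 1 <= M,
  forall k n, cnorm (qcoef k (pnode n)) <= K * M ^+ k * (1 + `|n|%:~R)^-1,
  forall k n, k != 1%N -> cnorm (qcoef k (pnode n)) <= K * M ^+ k * wt 0 n &
  forall d : int, exists2 K', 0 <= K' & forall k n,
    cnorm (qcoef k (pnode n) - qcoef k (pnode (n - d))) <= K' * M ^+ k * wt 0 n].
Proof.
have [c /andP[c0 c1] Hc] := pnode_lower.
(* [K] covers an integer with [pnode n = 0], whose weight is [(1 + |b|)^-2]; [M] inverts the lower
   bound for the other nodes. *)
pose K := (1 + cnorm b) ^+ 2; pose M := c^-1.
have b0 := cnorm_ge0 b.
have K1 : 1 <= K by rewrite exprn_ege1 // lerDl.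
have K0 : 0 <= K by apply: le_trans K1.
have M1 : 1 <= M by rewrite invf_ge1.
have M0 : 0 < M by apply: lt_le_trans M1.
have wE n : wt 0 n = (W n ^+ 2)^-1 :> R by rewrite wt0E.
have Wi n : 0 <= (W n)^-1 by rewrite invr_ge0 ltW.
have wW n : wt 0 n <= (W n)^-1.
  by rewrite wE -exprVn expr2 ler_piMr // invf_le1.
have pow k n : pnode n != 0 -> cnorm (pnode n ^- k) <= M ^+ k * (W n)^-1 ^+ k.
  move=> n0; rewrite cnormV cnormX -exprMn -invfM -exprVn lerXn2r ?nnegrE //.
  - by rewrite invr_ge0 cnorm_ge0.
  - by rewrite invr_ge0 mulr_ge0 ?(ltW c0) ?(ltW (W_gt0 _)).
  by rewrite lef_pV2 ?posrE ?cnorm_gt0 ?mulr_gt0 // Hc.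
have Wexp n k l : (l <= k)%N -> (W n)^-1 ^+ k <= (W n)^-1 ^+ l.
  by move=> kl; rewrite ler_wiXn2l ?invf_le1.
have Mk k : 1 <= M ^+ k by rewrite exprn_ege1.
have Mk0 k : 0 <= M ^+ k by apply: le_trans (Mk k).
have KMw k n : 0 <= K * M ^+ k * wt 0 n.
  by rewrite mulr_ge0 ?wt_ge0 // mulr_ge0 ?Mk0.
have KMW k n : 0 <= K * M ^+ k * (W n)^-1.
  by rewrite mulr_ge0 // mulr_ge0 ?Mk0.
have B2 k n : k != 1%N -> cnorm (qcoef k (pnode n)) <= K * M ^+ k * wt 0 n.
  move=> k1; rewrite /qcoef; case: k k1 => [|[//|k]] _ /=.
    case: eqP => [n0|_]; last by rewrite cnorm0 expr0 mulr1 mulr_ge0 ?wt_ge0.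
    by rewrite cnorm1 expr0 mulr1 wE (pnode_eq0 n0) divff // expf_neq0 // gt_eqF //; lra.
  have [->|n0] := eqVneq (pnode n) 0.
    by rewrite expr0n /= invr0 oppr0 cnorm0 KMw.
  rewrite cnormN; apply: le_trans (pow _ _ n0) _.
  rewrite wE -exprVn -mulrA; apply: le_trans (_ : M ^+ k.+2 * (W n)^-1 ^+ 2 <= _).
    by rewrite ler_wpM2l // Wexp.
  by rewrite ler_peMl // mulr_ge0 ?Mk0 ?exprn_ge0.
have B1 k n : cnorm (qcoef k (pnode n)) <= K * M ^+ k * (W n)^-1.
  have [->|k1] := eqVneq k 1%N; last first.
    by apply: le_trans (B2 _ _ k1) _; rewrite ler_wpM2l ?wW // mulr_ge0 ?Mk0.
  rewrite /qcoef /=; have [->|n0] := eqVneq (pnode n) 0.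
    by rewrite expr0n /= invr0 oppr0 cnorm0 KMW.
  rewrite cnormN; apply: le_trans (pow 1%N _ n0) _.
  by rewrite !expr1 -mulrA ler_peMl // mulr_ge0 ?(ltW M0).
move: K1 K0 B1 B2 {KMw KMW}; move: K => K K1 K0 B1 B2.
exists K, M; split=> // d.
have Wd n : W n <= W d * W (n - d) by exact: shift_weight.
have wd n : wt 0 (n - d) <= W d ^+ 2 * wt 0 n.
  rewrite !wE ler_pdivlMr ?exprn_gt0 // mulrC ler_pdivrMr ?exprn_gt0 //.
  by rewrite -exprMn lerXn2r ?nnegrE ?mulr_ge0 ?(ltW (W_gt0 _)).
(* One summand for each case, in this order: [k <> 1], both nodes nonzero, [pnode n = 0],
   [pnode (n - d) = 0]. *)
pose K1' := K * (1 + W d ^+ 2) + 2 * pi * `|d|%:~R * M * W d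
  + (1 + cnorm b) ^+ 2 * K + K * W d * (1 + cnorm b).
have p0 := @pi_gt0 R; have Wd0 := ltW (W_gt0 d).
have t1 : 0 <= K * (1 + W d ^+ 2) by rewrite mulr_ge0 // addr_ge0 // exprn_ge0.
have t2 : 0 <= 2 * pi * `|d|%:~R * M * W d.
  by rewrite !mulr_ge0 ?(ltW p0) ?(ltW M0) // ler0z.
have t3 : 0 <= (1 + cnorm b) ^+ 2 * K by rewrite mulr_ge0 // exprn_ge0 // addr_ge0.
have t4 : 0 <= K * W d * (1 + cnorm b) by rewrite mulr_ge0 ?addr_ge0 // mulr_ge0.
have KK : [/\ K * (1 + W d ^+ 2) <= K1', 2 * pi * `|d|%:~R * M * W d <= K1',
  (1 + cnorm b) ^+ 2 * K <= K1' & K * W d * (1 + cnorm b) <= K1'].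
  by move: t1 t2 t3 t4; rewrite /K1'; split; lra.
case: KK => k1 k2 k3 k4.
exists K1' => [|k n]; first exact: le_trans k1.
have step X : X <= K1' -> X * M ^+ k * wt 0 n <= K1' * M ^+ k * wt 0 n.
  by move=> h; rewrite ler_wpM2r ?wt_ge0 // ler_wpM2r ?Mk0.
have [kk|kk] := eqVneq k 1%N; last first.
  apply: le_trans (cnormB _ _) _; apply: le_trans (step _ k1).
  apply: le_trans (lerD (B2 _ _ kk) (B2 _ _ kk)) _.
  have h := wd n.
  have -> : K * (1 + W d ^+ 2) * M ^+ k * wt 0 n =
     K * M ^+ k * wt 0 n + K * M ^+ k * (W d ^+ 2 * wt 0 n) by ring.
  by rewrite lerD2l ler_wpM2l // mulr_ge0 ?Mk0.
rewrite kk in step *; rewrite expr1 in step *.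
have q10 m : pnode m = 0 -> qcoef 1 (pnode m) = 0.
  by move=> ->; rewrite /qcoef /= expr1 invr0 oppr0.
have [n0|n0] := eqVneq (pnode n) 0.
  rewrite (q10 _ n0) sub0r cnormN; apply: le_trans (B1 1%N _) _.
  apply: le_trans (step _ k3); rewrite expr1 wE (pnode_eq0 n0).
  have -> : (1 + cnorm b) ^+ 2 * K * M / (1 + cnorm b) ^+ 2 = K * M.
    by field; rewrite gt_eqF //; lra.
  by rewrite ler_piMr ?mulr_ge0 ?(ltW M0) // invf_le1.
have [nd0|nd0] := eqVneq (pnode (n - d)) 0.
  rewrite (q10 _ nd0) subr0; apply: le_trans (B1 1%N _) _.
  apply: le_trans (step _ k4); rewrite expr1 wE.
  have := Wd n; rewrite (pnode_eq0 nd0) => h.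
  have -> : K * M / W n = K * M * W n * (W n ^+ 2)^-1.
    by field; rewrite gt_eqF.
  rewrite ler_wpM2r ?invr_ge0 ?exprn_ge0 ?(ltW (W_gt0 _)) //.
  have -> : K * W d * (1 + cnorm b) * M = K * M * (W d * (1 + cnorm b)) by ring.
  by rewrite ler_wpM2l ?mulr_ge0 ?(ltW M0).
rewrite /qcoef /= !expr1.
have -> : - (pnode n)^-1 - - (pnode (n - d))^-1 =
   (pnode n - pnode (n - d)) * ((pnode n)^-1 * (pnode (n - d))^-1).
  by field; rewrite n0 nd0.
have -> : pnode n - pnode (n - d) = twopii R * d%:~R.
  by rewrite /pnode intrB; ring.
rewrite cnormM [cnorm (twopii R * _)]cnormM cnorm_twopii cnorm_int.
rewrite [cnorm (_^-1 * _)]cnormM; apply: le_trans (step _ k2).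
apply: le_trans (_ : 2 * pi * `|d|%:~R * ((M * (W n)^-1) * (M * (W (n - d))^-1)) <= _).
  rewrite ler_wpM2l ?mulr_ge0 ?(ltW p0) ?ler0z // ler_pM ?cnorm_ge0 //.
    by have := pow 1%N _ n0; rewrite !expr1.
  by have := pow 1%N _ nd0; rewrite !expr1.
have -> : 2 * pi * `|d|%:~R * (M / W n * (M / W (n - d))) =
  2 * pi * `|d|%:~R * M * M * ((W n)^-1 * (W (n - d))^-1) by ring.
have -> : 2 * pi * `|d|%:~R * M * W d * M * wt 0 n =
  2 * pi * `|d|%:~R * M * M * (W d * wt 0 n) by ring.
rewrite ler_wpM2l ?mulr_ge0 ?(ltW p0) ?(ltW M0) ?ler0z //.
rewrite wE expr2 invfM mulrCA ler_wpM2l // ler_pdivlMr // mulrC.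
by rewrite ler_pdivrMr.
Qed.

End PoleCoef.

(** The remaining terms add up to at most [B (s / s1)^(e i0 + 1)], of higher order than the term of
    [i0]. The index set is arbitrary so that series in several variables, restricted to a curve, are
    covered. *)
Lemma lead_term_neq0 (R : realType) (I : choiceType) (c : I -> R[i])
    (e : I -> nat) (i0 : I) (s1 : R) : 0 < s1 ->
  bounded_sums (fun i => cnorm (c i) * s1 ^+ e i) -> c i0 != 0 ->
  (forall i, i != i0 -> c i != 0 -> (e i0 < e i)%N) ->
  exists2 s0 : R, 0 < s0 & forall s, 0 < s < s0 ->
    forall w, has_sum (fun i => c i * s%:C ^+ e i) w -> w != 0.
Proof.
move=> s10 [B HB] c0 He.
have B0 : 0 <= B by have := HB fset0; rewrite big_seq_fset0.
have cp : 0 < cnorm (c i0) by rewrite cnorm_gt0.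
pose D := B / s1 ^+ (e i0).+1 + 1.
have D0 : 0 < D by rewrite ltr_wpDl // divr_ge0 ?exprn_ge0 ?(ltW s10).
exists (Num.min s1 (cnorm (c i0) / D)); first by rewrite lt_min s10 divr_gt0.
move=> s /andP[s0]; rewrite lt_min => /andP[ss1 ssc] w hw; apply/eqP => w0.
have := @has_sum_tail _ _ _ w [fset i0]%fset ((s / s1) ^+ (e i0).+1 * B) _ hw.
rewrite big_seq_fset1 w0 sub0r cnormN cnormM cnormX cnorm_real ger0_norm ?(ltW s0) //.
have H : forall K : {fset I}, [disjoint K & [fset i0]]%fset ->
    \sum_(i <- K) cnorm (c i * s%:C ^+ e i) <= (s / s1) ^+ (e i0).+1 * B.
  move=> K dK; apply: le_trans (ler_wpM2l _ (HB K)); last first.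
    by rewrite exprn_ge0 // divr_ge0 ?ltW.
  rewrite mulr_sumr big_seq [leRHS]big_seq; apply: ler_sum => i iK.
  rewrite cnormM cnormX cnorm_real ger0_norm ?(ltW s0) //.
  have ii0 : i != i0 by have := fdisjointP dK _ iK; rewrite inE.
  have [->|ci] := eqVneq (c i) 0; first by rewrite cnorm0 !mul0r mulr0.
  have ei := He i ii0 ci.
  have -> : (s / s1) ^+ (e i0).+1 * (cnorm (c i) * s1 ^+ e i) =
     cnorm (c i) * (s ^+ (e i0).+1 * s1 ^+ (e i - (e i0).+1)).
    have -> : s1 ^+ e i = s1 ^+ (e i0).+1 * s1 ^+ (e i - (e i0).+1).
      by rewrite -exprD subnKC.
    by rewrite expr_div_n; field; rewrite expf_neq0 // gt_eqF.
  have -> : s ^+ e i = s ^+ (e i0).+1 * s ^+ (e i - (e i0).+1).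
    by rewrite -exprD subnKC.
  rewrite ler_wpM2l ?cnorm_ge0 //.
  by rewrite ler_wpM2l ?exprn_ge0 ?(ltW s0) // lerXn2r ?nnegrE ?ltW.
move=> /(_ H) h; move: ssc; rewrite ltr_pdivlMr // ltNge => /negP; apply.
have sp : 0 < s ^+ e i0 by rewrite exprn_gt0.
rewrite -(ler_pM2r sp); apply: le_trans h _.
have -> : s * D * s ^+ e i0 = (s / s1) ^+ (e i0).+1 * B + s ^+ (e i0).+1.
  rewrite /D expr_div_n; have : s1 ^+ (e i0).+1 != 0 by rewrite expf_neq0 // gt_eqF.
  by move: (s1 ^+ _) => X X0; rewrite exprS; field.
by rewrite lerDl exprn_ge0 // ltW.
Qed.

Lemma cexp_shift_neq1 (R : realType) (b : R[i]) : exists2 s0 : R, 0 < s0 &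
  forall t, 0 < cnorm t < s0 -> cexp (t - twopii R * b) != 1.
Proof.
set w := cexp (- (twopii R * b)).
have [w1|w1] := eqVneq w 1.
  exists 4^-1 => // t /andP[t0 t4]; rewrite cexpD -/w w1 mulr1 -subr_eq0 -cnorm_gt0.
  by apply: lt_le_trans (cexp_sub1_ge (ltW t4)); rewrite divr_gt0.
have w0 : 0 < cnorm w by rewrite cnorm_gt0 cexp_neq0.
have d0 : 0 < cnorm (w - 1) by rewrite cnorm_gt0 subr_eq0.
exists (Num.min 2^-1 (cnorm (w - 1) / (2 * cnorm w))).
  by rewrite lt_min invr_gt0 ltr0n /= divr_gt0 // mulr_gt0.
move=> t /andP[t0]; rewrite lt_min => /andP[t2 tw]; apply/eqP => h.
have : cnorm (w - 1) <= 2 * cnorm t * cnorm w.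
  rewrite -h cexpD -/w; have -> : w - cexp t * w = - ((cexp t - 1) * w) by ring.
  by rewrite cnormN cnormM ler_wpM2r ?cnorm_ge0 // cexp_sub1_le // ltW.
move: tw; rewrite ltr_pdivlMr ?mulr_gt0 //; move: (cnorm t) (cnorm w) => x z; lra.
Qed.

Lemma power_series_unique (R : realType) (a c : nat -> R[i]) (K M s0 : R) :
  0 < M -> 0 < s0 -> (forall k, cnorm (a k) <= K * M ^+ k) ->
  (forall k, cnorm (c k) <= K * M ^+ k) ->
  (forall s, 0 < s < s0 -> exists w, has_sum (fun k => a k * s%:C ^+ k) w
     /\ has_sum (fun k => c k * s%:C ^+ k) w) -> a =1 c.
Proof.
move=> M0 s00 aM cM H; apply: contrapT => ac.
have : exists k, a k - c k != 0.
  apply: contrapT => nk; apply: ac => k; apply/eqP; rewrite -subr_eq0.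
  by apply/negPn/negP => h; apply: nk; exists k.
move=> ex; have := ex_minnP ex => -[k0 k00 kmin].
have [||||s1 s10 Hs1] := @lead_term_neq0 R nat (fun k => a k - c k) id k0 (2 * M)^-1.
- by rewrite invr_gt0 mulr_gt0.
- have K0 : 0 <= K by have := le_trans (cnorm_ge0 _) (aM 0%N); rewrite mulr1.
  exists (2 * K * (1 - 2^-1)^-1) => J.
  have := @geometric_sum_le R 2^-1 _ J => /(_ _) H2.
  apply: le_trans (ler_wpM2l _ (H2 _)); rewrite ?mulr_ge0 //; last by apply/andP; lra.
  rewrite mulr_sumr; apply: ler_sum => k _.
  apply: le_trans (_ : (2 * K * M ^+ k) * (2 * M)^-1 ^+ k <= _).
    rewrite ler_wpM2r ?exprn_ge0 ?invr_ge0 ?mulr_ge0 ?(ltW M0) //.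
    apply: le_trans (cnormB _ _) _; have := aM k; have := cM k; lra.
  rewrite -mulrA -exprMn invfM mulrCA mulfV ?mulr1 //; exact: lt0r_neq0.
- by [].
- by move=> k kk /kmin; rewrite leq_eqVlt eq_sym (negbTE kk).
pose s := Num.min s0 s1 / 2.
have m0 : 0 < Num.min s0 s1 by rewrite lt_min s00.
have sm : s < Num.min s0 s1 by rewrite ltr_pdivrMr // ltr_pMr // ltr1n.
have sp : 0 < s by rewrite divr_gt0.
move: sm; rewrite lt_min => /andP[ss0 ss1].
have [|w [ha hc]] := H s; first by rewrite sp.
have := has_sumB ha hc; rewrite subrr => h0.
have := Hs1 s; rewrite sp ss1 => /(_ isT 0); rewrite eqxx => /(_ _)/negP; apply=> //.
by apply: eq_has_sum h0 => k; rewrite mulrBl.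
Qed.

Lemma abs_summable_geom (R : realType) (a : nat -> R[i]) (K M : R) (t : R[i]) :
  0 <= K -> 0 <= M -> (forall k, cnorm (a k) <= K * M ^+ k) ->
  cnorm t * (2 * M) <= 1 ->
  forall J : {fset nat}, \sum_(k <- J) cnorm (a k * t ^+ k) <= 2 * K.
Proof.
move=> K0 M0 aM tM J.
have h : 0 <= (2^-1 : R) < 1 by apply/andP; lra.
apply: le_trans (_ : K * \sum_(k <- J) 2^-1 ^+ k <= _).
  rewrite mulr_sumr; apply: ler_sum => k _; rewrite cnormM cnormX.
  apply: le_trans (ler_wpM2r _ (aM k)) _; first by rewrite exprn_ge0 ?cnorm_ge0.
  rewrite -mulrA -exprMn ler_wpM2l // lerXn2r ?nnegrE ?mulr_ge0 ?cnorm_ge0 //.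
  by move: tM; lra.
rewrite [leRHS]mulrC ler_wpM2l //; apply: le_trans (geometric_sum_le h J) _.
by have -> : (1 - 2^-1)^-1 = 2 :> R by field.
Qed.

(** * Taylor coefficients of the one-dimensional factor *)

Section PoleSeries.
Context {R : realType} (b : R[i]).

Definition pole_term (al : R) (d : int) (k : nat) (n : int) : R[i] :=
  echar (n%:~R * al) * (qcoef k (pnode b n) - qcoef k (pnode b (n - d))).

(** For [b = 0] this is the generating function of the Bernoulli polynomials in [al]. *)
Definition pole_fun (al : R) (t : R[i]) : R[i] :=
  t * cexp ((t - twopii R * b) * al%:C) / (cexp (t - twopii R * b) - 1).

Lemma pole_term_summable al d k : abs_summable (pole_term al d k).
Proof.
have [K [M [_ _ _ _ /(_ d)[K' K0 H]]]] := qcoef_bound b.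
have := bounded_sumsZ (_ : 0 <= `|K' * M ^+ k|) (bounded_sums_wt (R := R) 0).
move=> /(_ (normr_ge0 _)); apply: bounded_sums_le => n.
rewrite cnormM cnorm_echar mul1r; apply: le_trans (H k n) _.
by rewrite ler_wpM2r ?wt_ge0 ?ler_norm.
Qed.

(** The series of [has_sum_fourier] at [T = t - 2 pi i b], whose poles in [t] are the [pnode b n],
    is expanded in powers of [t]; the geometric bounds allow the two summations to be exchanged.
    Since [al] is not an integer, [1 - e(al)] can be divided out. *)
Lemma pole_taylor (al : R) : 0 < al < 1 -> exists s : nat -> R[i],
  (forall k, has_sum (pole_term al 1 k) ((1 - echar al) * s k)) /\
  exists K M : R, [/\ 0 <= K, 1 <= M, forall k, cnorm (s k) <= K * M ^+ k &
    forall t, cnorm t * (2 * M) <= 1 -> cexp (t - twopii R * b) != 1 ->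
      has_sum (fun k => s k * t ^+ k) (pole_fun al t)].
Proof.
move=> /andP[a0 a1].
have e1 : 1 - echar al != 0.
  rewrite subr_eq0 eq_sym; apply/eqP => /echar_eq1[n an].
  by move: a0 a1; rewrite an ltr0z -[1]/(1%:~R) ltr_int; lia.
have /choice[s' Hs'] : forall k, exists s, has_sum (pole_term al 1 k) s.
  by move=> k; apply: abs_summable_has_sum; apply: pole_term_summable.
exists (fun k => s' k / (1 - echar al)); split=> [k|].
  by rewrite mulrC divfK.
have [K0 [M [K01 M1 H1 _ /(_ 1)[K' K'0 H]]]] := qcoef_bound b.
have M0 : 0 <= M by apply: le_trans M1.
have [B HB] := bounded_sums_wt (R := R) 0.
have B0 : 0 <= B by have := HB fset0; rewrite big_seq_fset0.
have ce : 0 <= (cnorm (1 - echar al))^-1 by rewrite invr_ge0 cnorm_ge0.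
have pb k n : cnorm (pole_term al 1 k n) <= K' * M ^+ k * wt 0 n.
  by rewrite cnormM cnorm_echar mul1r H.
have sb k : cnorm (s' k / (1 - echar al)) <=
    (K' * B * (cnorm (1 - echar al))^-1) * M ^+ k.
  rewrite cnormM cnormV mulrAC ler_wpM2r //.
  apply: (has_sum_cnorm_le _ (Hs' k)) => J.
  apply: le_trans (_ : \sum_(n <- J) K' * M ^+ k * wt 0 n <= _).
    by apply: ler_sum.
  by rewrite -mulr_sumr [leRHS]mulrAC ler_wpM2l // mulr_ge0 ?exprn_ge0.
exists (K' * B * (cnorm (1 - echar al))^-1), M; split=> //.
  by rewrite !mulr_ge0.
move=> t tM ct.
set K := K' * B * _ in sb *.
have K00 : 0 <= K by rewrite !mulr_ge0.
apply: series_has_sum; first by exists (2 * K) => J; exact: (abs_summable_geom K00 M0).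
set T := t - twopii R * b in ct *.
have tx n : t - pnode b n = T - twopii R * n%:~R by rewrite /T /pnode; ring.
have tx0 n : t - pnode b n != 0 by rewrite tx; apply: T_neq.
have := has_sum_fourier (T := T) (al := al) ct; rewrite (ltW a0) a1 => /(_ isT).
move=> /(has_sumZ t) hf.
suff : ccvg \oo (fun N => \sum_(k < N) s' k * t ^+ k)
   (t * ((1 - echar al) * (cexp (T * al%:C) / (cexp T - 1)))).
  move=> /(ccvgMl (1 - echar al)^-1).
  rewrite /pole_fun -/T; set X := cexp (T * _); set Y := cexp T - 1.
  have -> : (1 - echar al)^-1 * (t * ((1 - echar al) * (X / Y))) = t * X / Y.
    by move: Y^-1 => Z; field.
  apply: eq_ccvg => N; rewrite mulr_sumr; apply: eq_bigr => k _.
  by rewrite mulrA [_ * s' k]mulrC.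
have tk k : cnorm t ^+ k * M ^+ k <= 2^-1 ^+ k.
  by rewrite -exprMn lerXn2r ?nnegrE ?mulr_ge0 ?cnorm_ge0 //; move: tM; lra.
apply: (@dominated_ccvg R int nat \oo _
  (fun N n => \sum_(k < N) pole_term al 1 k n * t ^+ k)
  (fun n => t * (echar (n%:~R * al)
     * ((T - twopii R * n%:~R)^-1 - (T - twopii R * (n - 1)%:~R)^-1)))
  (fun n => 2 * K' * wt 0 n) _ _ _ _ _ hf).
- by apply: bounded_sumsZ; [rewrite mulr_ge0|exact: bounded_sums_wt].
- apply: filterE => N; split.
    move=> n; apply: le_trans (cnorm_sum _ _ _) _.
    apply: le_trans (_ : \sum_(k < N) (K' * wt 0 n) * 2^-1 ^+ k <= _).
      apply: ler_sum => k _; rewrite cnormM cnormX.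
      apply: le_trans (ler_wpM2r _ (pb k n)) _; first by rewrite exprn_ge0 ?cnorm_ge0.
      have -> : K' * M ^+ k * wt 0 n * cnorm t ^+ k =
        K' * wt 0 n * (cnorm t ^+ k * M ^+ k) by ring.
      by rewrite ler_wpM2l ?mulr_ge0 ?wt_ge0.
    rewrite -mulr_sumr -sum_fset_iota.
    have h : 0 <= (2^-1 : R) < 1 by apply/andP; lra.
    have -> : 2 * K' * wt 0 n = K' * wt 0 n * 2 :> R by ring.
    rewrite ler_wpM2l ?mulr_ge0 ?wt_ge0 //.
    apply: le_trans (geometric_sum_le h _) _.
    by have -> : (1 - 2^-1)^-1 = 2 :> R by field.
  apply: has_sum_sum => k _; have := has_sumZ (t ^+ k) (Hs' k).
  by rewrite [s' k * _]mulrC; apply: eq_has_sum => n; rewrite mulrC.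
- move=> n.
  have P m : ccvg \oo (fun N => \sum_(k < N) qcoef k (pnode b m) * t ^+ k)
      (t * (T - twopii R * m%:~R)^-1).
    suff h : ccvg \oo (fun N => (t - pnode b m)^-1 *
         (t + qcoef N.-1 (pnode b m) * t ^+ N)) ((t - pnode b m)^-1 * (t + 0)).
      move: h; rewrite addr0 mulrC tx; apply: near_eq_ccvg.
      exists 2%N => // -[|[|N]] //= _; rewrite -qcoef_geom mulrA tx mulVf ?mul1r //.
      by rewrite -tx.
    apply: ccvgMl; apply: ccvgD; first exact: ccvg_cst.
    apply: (@ccvg_squeeze _ _ _ _ _ _ (fun N => K0 * 2^-1 ^+ N)).
      exists 1%N => // -[|N] //= _; rewrite subr0 cnormM cnormX.
      apply: le_trans (ler_wpM2r _ (H1 N m)) _; first by rewrite exprn_ge0 ?cnorm_ge0.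
      have K00' : 0 <= K0 by apply: le_trans K01.
      apply: le_trans (_ : K0 * M ^+ N.+1 * cnorm t ^+ N.+1 <= _).
        rewrite ler_wpM2r ?exprn_ge0 ?cnorm_ge0 // -mulrA ler_wpM2l //.
        apply: le_trans (_ : M ^+ N * 1 <= _).
          by rewrite ler_wpM2l ?exprn_ge0 // invf_le1 ?lerDl ?ltr_pwDl ?ler0z.
        by rewrite mulr1 exprS ler_peMl ?exprn_ge0.
      by rewrite -mulrA ler_wpM2l // mulrC.
    rewrite -[X in _ --> X](mulr0 K0); apply: cvgMr; apply: cvg_expr.
    by rewrite ger0_norm ?invr_ge0 // invf_lt1 // ltr1n.
  rewrite mulrCA [t * (_ - _)]mulrBr.
  apply: eq_ccvg (ccvgMl _ (ccvgB (P n) (P (n - 1)))) => N /=.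
  rewrite -sumrB mulr_sumr; apply: eq_bigr => k _; rewrite /pole_term; ring.
Qed.

(** The Fourier sums determine the coefficients only for [0 < al < 1], but [yfrac] also takes the
    values 0 and 1. Multiplying the series at [al = 1/2] by [exp ((t - 2 pi i b) (al - 1/2))] gives
    coefficients for all [al], polynomial in [al] up to an exponential factor and therefore
    continuous; uniqueness of power series matches them with the sums inside the interval. *)
Lemma pole_series : exists e : R -> nat -> R[i],
  [/\ forall al, exists K M : R, [/\ 0 <= K, 1 <= M,
        forall k, cnorm (e al k) <= K * M ^+ k &
        forall t, cnorm t * (2 * M) <= 1 -> cexp (t - twopii R * b) != 1 ->
          has_sum (fun k => e al k * t ^+ k) (pole_fun al t)],
    forall (T : Type) (F : set_system T) (FF : Filter F) (u : T -> R) al k,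
      u @ F --> al -> ccvg F (fun x => e (u x) k) (e al k) &
    forall al k, 0 < al < 1 -> has_sum (pole_term al 1 k) ((1 - echar al) * e al k)].
Proof.
have h2 : 0 < (2^-1 : R) < 1 by apply/andP; lra.
have [s [_ [K [M [K0 M1 sM Hs]]]]] := pole_taylor h2.
have M0 : 0 <= M by apply: le_trans M1.
pose be (al : R) : R := al - 2^-1.
pose g al := cexp (- (twopii R * b * (be al)%:C)).
pose e al k := g al * \sum_(j < k.+1) s j * ((be al)%:C ^+ (k - j) / (k - j)`!%:R).
have cfact k : cnorm ((k`!%:R : R[i])^-1) <= 1.
  rewrite cnormV -(rmorph_nat (real_complex R)) cnorm_real ger0_norm //.
  by rewrite invf_le1 ?ler1n ?ltr0n ?fact_gt0.
have P1 al : exists K M : R, [/\ 0 <= K, 1 <= M,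
        forall k, cnorm (e al k) <= K * M ^+ k &
        forall t, cnorm t * (2 * M) <= 1 -> cexp (t - twopii R * b) != 1 ->
          has_sum (fun k => e al k * t ^+ k) (pole_fun al t)].
  pose M' := M + `|be al|.
  have M'M : M <= M' by rewrite lerDl.
  have M'b : `|be al| <= M' by rewrite lerDr.
  have M'0 : 0 <= M' by apply: le_trans M'M.
  have M'1 : 1 <= M' by apply: le_trans M'M.
  (* Doubling [M'] absorbs the [k + 1 <= 2^k] terms of the Cauchy product. *)
  exists (cnorm (g al) * K), (2 * M'); split.
  - by rewrite mulr_ge0 ?cnorm_ge0.
  - by move: M'1; lra.
  - move=> k; rewrite /e cnormM -mulrA ler_wpM2l ?cnorm_ge0 //.
    apply: le_trans (cnorm_sum _ _ _) _.
    apply: le_trans (_ : \sum_(j < k.+1) K * M' ^+ k <= _).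
      apply: ler_sum => j _; have jk : (j <= k)%N by rewrite -ltnS.
      rewrite !cnormM cnormX cnorm_real.
      have -> : K * M' ^+ k = K * M' ^+ j * (M' ^+ (k - j) * 1).
        by rewrite mulr1 -mulrA -exprD subnKC.
      rewrite ler_pM ?mulr_ge0 ?cnorm_ge0 ?exprn_ge0 //.
        apply: le_trans (sM j) _; rewrite ler_wpM2l // lerXn2r ?nnegrE //.
      by rewrite ler_pM ?exprn_ge0 ?cnorm_ge0 // lerXn2r ?nnegrE ?normr_ge0.
    rewrite sumr_const card_ord -[leLHS]mulr_natr -mulrA ler_wpM2l // exprMn mulrC.
    rewrite ler_wpM2r ?exprn_ge0 // -natrX ler_nat.
    by elim: k => // k IH; rewrite expnS; lia.
  move=> t tM ct.
  have tM2 : cnorm t * (2 * M) <= 1.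
    apply: le_trans tM; rewrite ler_wpM2l ?cnorm_ge0 //.
    by move: M'M M'0; lra.
  have sa : abs_summable (fun k => s k * t ^+ k).
    by exists (2 * K) => J; apply: (abs_summable_geom K0 M0).
  have := has_sum_cauchy sa (abs_summable_cexp (t * (be al)%:C)) (Hs t tM2 ct)
    (has_sum_cexp (t * (be al)%:C)) => /(has_sumZ (g al)).
  have -> : g al * (pole_fun 2^-1 t * cexp (t * (be al)%:C)) = pole_fun al t.
    rewrite /pole_fun; set Y := (_ - 1)^-1; rewrite /g.
    have -> : al = 2^-1 + be al by rewrite /be addrC subrK.
    have -> : cexp ((t - twopii R * b) * (2^-1 + be al)%:C) =
      cexp ((t - twopii R * b) * (2^-1)%:C) * (cexp (t * (be al)%:C)
        * cexp (- (twopii R * b * (be al)%:C))).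
      by rewrite -!cexpD; congr cexp; rewrite rmorphD; ring.
    have -> : 2^-1 + be al = al by rewrite /be addrC subrK.
    by ring.
  apply: eq_has_sum => k; rewrite /e -[RHS]mulrA; congr (g al * _).
  rewrite mulr_suml; apply: eq_bigr => j _; have jk : (j <= k)%N by rewrite -ltnS.
  have -> : t ^+ k = t ^+ j * t ^+ (k - j) by rewrite -exprD subnKC.
  by rewrite exprMn; ring.
exists e; split=> //.
- move=> T F FF u al k ual; rewrite /e.
  have bu : (fun x => be (u x)) @ F --> be al by apply: cvgB => //; exact: cvg_cst.
  have cb : ccvg F (fun x => (be (u x))%:C) (be al)%:C by exact: ccvg_real.
  apply: ccvgM; first by apply: ccvg_cexp; apply: ccvgN; apply: ccvgMl.
  apply: ccvg_sum => j _; apply: ccvgMl; apply: ccvgM; last exact: ccvg_cst.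
  elim: (k - j)%N => [|n IH]; first by rewrite expr0; exact: ccvg_cst.
  apply: (@eq_ccvg _ _ _ (fun x => (be (u x))%:C * (be (u x))%:C ^+ n)).
    by move=> x; rewrite exprS.
  by rewrite exprS; apply: ccvgM.
move=> al k h.
have [s' [Hs' [K1 [M2 [K10 M21 sM' Hs2]]]]] := pole_taylor h.
suff -> : e al k = s' k by [].
have [K3 [M3 [K30 M31 eM He]]] := P1 al.
have [s0 s00 Hreg] := cexp_shift_neq1 b.
pose M4 := M2 + M3.
have M20 : 0 <= M2 by apply: le_trans M21.
have M30 : 0 <= M3 by apply: le_trans M31.
have M40 : 0 < M4 by rewrite /M4; move: M21 M30; lra.
apply: (@power_series_unique R (e al) s' (K1 + K3) M4 (Num.min s0 (2 * M4)^-1)) => //.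
- by rewrite lt_min s00 invr_gt0 mulr_gt0.
- move=> j; apply: le_trans (eM j) _; rewrite ler_pM ?exprn_ge0 //.
    by rewrite lerDr.
  by rewrite lerXn2r ?nnegrE ?(ltW M40) // lerDr.
- move=> j; apply: le_trans (sM' j) _; rewrite ler_pM ?exprn_ge0 //.
    by rewrite lerDl.
  by rewrite lerXn2r ?nnegrE ?(ltW M40) // lerDl.
move=> x /andP[x0]; rewrite lt_min => /andP[xs xM].
have nx : cnorm x%:C = x by rewrite cnorm_real gtr0_norm.
have xM4 : x * (2 * M4) <= 1.
  by move: xM; rewrite -[(2 * M4)^-1]mul1r ltr_pdivlMr ?mulr_gt0 // => /ltW.
have cx : cexp (x%:C - twopii R * b) != 1 by apply: Hreg; rewrite nx x0.
exists (pole_fun al x%:C); split.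
  apply: He => //; rewrite nx; apply: le_trans xM4.
  by rewrite ler_wpM2l ?(ltW x0) // ler_wpM2l // lerDr.
apply: Hs2 => //; rewrite nx; apply: le_trans xM4.
by rewrite ler_wpM2l ?(ltW x0) // ler_wpM2l // lerDl.
Qed.

End PoleSeries.

(** * Bases of the arrangement *)

Section Dot.
Context {R : realType} {r : nat}.
Implicit Types (u v w : 'rV[R]_r).

Lemma dotC u v : dot u v = dot v u.
Proof. by apply: eq_bigr => j _; rewrite mulrC. Qed.

Lemma dotDl u v w : dot (u + v) w = dot u w + dot v w.
Proof. by rewrite -big_split; apply: eq_bigr => j _; rewrite mxE mulrDl. Qed.

Lemma dotZl (a : R) u v : dot (a *: u) v = a * dot u v.
Proof. by rewrite /dot mulr_sumr; apply: eq_bigr => j _; rewrite mxE mulrA. Qed.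

Lemma dotDr u v w : dot u (v + w) = dot u v + dot u w.
Proof. by rewrite dotC dotDl !(dotC _ u). Qed.

Lemma dotZr (a : R) u v : dot u (a *: v) = a * dot u v.
Proof. by rewrite dotC dotZl dotC. Qed.

Lemma dot0l v : dot 0 v = 0.
Proof. by rewrite -(scale0r 0) dotZl mul0r. Qed.

Lemma dotNl u v : dot (- u) v = - dot u v.
Proof. by rewrite -scaleN1r dotZl mulN1r. Qed.

Lemma dotBl u v w : dot (u - v) w = dot u w - dot v w.
Proof. by rewrite dotDl dotNl. Qed.

Lemma dot_suml (I : Type) (s : seq I) (P : pred I) (F : I -> 'rV[R]_r) v :
  dot (\sum_(i <- s | P i) F i) v = \sum_(i <- s | P i) dot (F i) v.
Proof.
by elim/big_rec2: _ => [|i x y _ IH]; rewrite ?dot0l // dotDl IH.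
Qed.

Lemma dot_sumr (I : Type) (s : seq I) (P : pred I) (F : I -> 'rV[R]_r) v :
  dot v (\sum_(i <- s | P i) F i) = \sum_(i <- s | P i) dot v (F i).
Proof. by rewrite dotC dot_suml; apply: eq_bigr => i _; rewrite dotC. Qed.

Lemma dot_delta v j : dot v (delta_mx 0 j) = v 0 j.
Proof.
rewrite /dot (bigD1 j) //= big1 ?addr0 => [|i ij]; first by rewrite mxE !eqxx mulr1.
by rewrite mxE (negbTE ij) andbF mulr0.
Qed.

Lemma realvecD (v w : 'rV[int]_r) : realvec R (v + w) = realvec R v + realvec R w.
Proof. exact: raddfD. Qed.

Lemma realvec_inj : injective (@realvec R r).
Proof.
by move=> v w /matrixP vw; apply/matrixP => i j; have := vw i j; rewrite !mxE => /intr_inj.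
Qed.

Definition idot (v w : 'rV[int]_r) : int := \sum_(j < r) v 0 j * w 0 j.

Lemma dot_realvec (v w : 'rV[int]_r) :
  dot (realvec R v) (realvec R w) = (idot v w)%:~R.
Proof. by rewrite /idot rmorph_sum; apply: eq_bigr => j _; rewrite !mxE rmorphM. Qed.

Lemma idotBr (u v w : 'rV[int]_r) : idot u (v - w) = idot u v - idot u w.
Proof.
by rewrite /idot -sumrB; apply: eq_bigr => j _; rewrite !mxE mulrBr.
Qed.

End Dot.

Lemma span_map_coef (K : fieldType) (vT : vectType K) (T : eqType)
    (F : T -> vT) (s : seq T) (x : vT) : uniq s -> x \in <<map F s>>%VS ->
  exists a : T -> K, x = \sum_(i <- s) a i *: F i.
Proof.
elim: s x => [|t s IH] x /=.
  by rewrite span_nil memv0 => _ /eqP ->; exists (fun=> 0); rewrite big_nil.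
move=> /andP[ts us]; rewrite span_cons => /memv_addP[_ /vlineP[k ->] [v vs ->]].
have [a ->] := IH v us vs; exists (fun i => if i == t then k else a i).
rewrite big_cons eqxx; congr (_ + _).
rewrite [LHS]big_seq [RHS]big_seq.
by apply: eq_bigr => i is_; case: eqP => // it; rewrite -it is_ in ts.
Qed.

Section Bases.
Context {R : realType} {r : nat} {L : {fset 'rV[int]_r * R[i]}}.
Implicit Types (f g h : L) (B S : {set L}) (x : 'rV[R]_r).

Definition spanning S : Prop :=
  forall x, exists a : L -> R, x = \sum_(f in S) a f *: vec f.

Lemma span_vecP S x : reflect (exists a : L -> R, x = \sum_(f in S) a f *: vec f)
  (x \in <<[seq vec f | f <- enum S]>>%VS).
Proof.
apply: (iffP idP) => [/(span_map_coef (enum_uniq _))[a ->]|[a ->]].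
  by exists a; rewrite big_enum.
apply: memv_suml => f fS; apply: memvZ; apply: memv_span.
by apply: map_f; rewrite mem_enum.
Qed.

Lemma basesP B : B \in bases L <-> #|B| = r /\ spanning B.
Proof.
have dimr : \dim (fullv : {vspace 'rV[R]_r}) = r by rewrite dimvf dim_matrix; lia.
rewrite inE; split=> [/andP[/eqP Br Bb]|[Br sB]].
  by split=> // x; apply/span_vecP; rewrite (span_basis Bb) memvf.
rewrite Br eqxx basisEdim size_map -cardE Br dimr leqnn andbT.
by apply/subvP => x _; apply/span_vecP; apply: sB.
Qed.

Lemma subset_bases S : spanning S -> exists2 B, B \in bases L & B \subset S.
Proof.
move=> sS; pose A := \matrix_(i < #|S|) vec (enum_val i) : 'M[R]_(#|S|, r).
have rA : row_full A.
  rewrite -sub1mx; apply/row_subP => j.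
  have [a ->] := sS (row j 1%:M); apply: summx_sub => f fS.
  apply: scalemx_sub; have -> : vec f = row (enum_rank_in fS f) A.
    by rewrite rowK enum_rankK_in.
  exact: row_sub.
pose b i : L := enum_val (fullrankfun rA i).
have b_inj : injective b by move=> i j /enum_val_inj/fullrankfun_inj.
exists [set b i | i : 'I_r]%SET.
  apply/basesP; split; first by rewrite card_imset ?card_ord.
  move=> x; have := fullrowsub_full rA; rewrite -sub1mx => s1.
  have /submxP[D xD] : (x <= rowsub (fullrankfun rA) A)%MS.
    by apply: submx_trans s1; apply: submx1.
  exists (fun f => \sum_(i | b i == f) D 0 i).
  rewrite big_imset /=; last by move=> i j _ _; apply: b_inj.
  rewrite {1}xD mulmx_sum_row; apply: eq_bigr => i _.
  rewrite (big_pred1 i) => [|j]; last by rewrite /= (inj_eq b_inj).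
  by congr (_ *: _); apply/rowP => j; rewrite !mxE.
by apply/fintype.subsetP => f /imsetP[i _ ->]; apply: enum_valP.
Qed.

(* The adjugate of the integer matrix of B supplies integral multiples of the
   dual basis. *)
Lemma int_dual B : B \in bases L -> exists D : nat, exists u : L -> 'rV[int]_r,
  (0 < D)%N /\ forall f g, f \in B -> g \in B ->
    idot (ivec g) (u f) = (Posz D * (g == f)%:R)%R.
Proof.
move=> /basesP[Br sB].
pose b (i : 'I_r) : L := enum_val (cast_ord (esym Br) i).
pose A : 'M[int]_r := \matrix_(i < r) ivec (b i).
have bB i : b i \in B by apply: enum_valP.
have b_inj : injective b by move=> i j /enum_val_inj/cast_ord_inj.
have b_surj f : f \in B -> exists i, b i = f.
  move=> fB; exists (cast_ord Br (enum_rank_in fB f)).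
  by rewrite /b cast_ordK enum_rankK_in.
have detA : \det A != 0.
  suff : \det (map_mx (intr : int -> R) A) != 0 by rewrite det_map_mx intr_eq0.
  rewrite -unitfE -unitmxE -row_full_unit -sub1mx; apply/row_subP => j.
  have [a ->] := sB (row j 1%:M); apply: summx_sub => f fB; apply: scalemx_sub.
  have [i <-] := b_surj f fB; have -> : vec (b i) = row i (map_mx intr A).
    by apply/rowP => l; rewrite !mxE.
  exact: row_sub.
exists (absz (\det A)), (fun f => \row_l (Num.sg (\det A)
    * \sum_(i | b i == f) \adj A l i)); split; first by rewrite absz_gt0.
move=> f g /b_surj[i <-] /b_surj[i' <-]; rewrite (inj_eq b_inj).
transitivity (Num.sg (\det A) * (A *m \adj A) i' i).
  rewrite mxE /idot mulr_sumr; apply: eq_bigr => l _; rewrite !mxE.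
  rewrite (big_pred1 i) => [|j]; last by rewrite /= (inj_eq b_inj).
  by rewrite mulrCA [in LHS]mxE.
rewrite mul_mx_adj mxE; case: (i' == i); rewrite ?mulr0n ?mulr0 //.
by rewrite !mulr1n mulr1 abszE normrEsg.
Qed.

Section Dual.
Context {B : {set L}} (HB : B \in bases L).

Lemma dualE f g : f \in B -> g \in B -> dot (vec g) (dual B f) = (g == f)%:R.
Proof.
move=> fB; apply: (@xgetPex _ 0 [set u | forall g, g \in B -> dot (vec g) u = (g == f)%:R]).
have [D [u [D0 Hu]]] := int_dual HB; exists (D%:R^-1 *: realvec R (u f)) => h hB.
rewrite dotZr dot_realvec Hu // rmorphM /= mulrA -pmulrn mulVf ?mul1r ?pnatr_eq0 -?lt0n //.
by rewrite rmorph_nat.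
Qed.

Lemma dual_expand x : x = \sum_(f in B) dot x (dual B f) *: vec f.
Proof.
have [_ /(_ x)[a xa]] := (basesP B).1 HB; rewrite {1}xa; apply: eq_bigr => f fB.
congr (_ *: _); rewrite xa dot_suml (bigD1 f) //= big1 => [|g /andP[gB gf]].
  by rewrite addr0 dotZl dualE // eqxx mulr1.
by rewrite dotZl dualE // (negbTE gf) mulr0.
Qed.

Lemma dot_dual x v : dot x v = \sum_(f in B) dot x (dual B f) * dot (vec f) v.
Proof.
by rewrite {1}(dual_expand x) dot_suml; apply: eq_bigr => f _; rewrite dotZl.
Qed.

Lemma dual_unique u v : (forall f, f \in B -> dot (vec f) u = dot (vec f) v) ->
  u = v.
Proof.
move=> uv; apply/rowP => j; rewrite -!dot_delta ![dot _ (delta_mx _ _)]dotC.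
by rewrite (dot_dual _ u) (dot_dual _ v); apply: eq_bigr => f /uv ->.
Qed.

Lemma dual_int : exists D : nat, exists u : L -> 'rV[int]_r, (0 < D)%N /\
  forall f, f \in B -> realvec R (u f) = D%:R *: dual B f.
Proof.
have [D [u [D0 Hu]]] := int_dual HB; exists D, u; split=> // f fB.
apply: dual_unique => g gB; rewrite dot_realvec Hu // dotZr dualE // rmorphM /=.
by rewrite -pmulrn rmorph_nat.
Qed.

Lemma exchange f g : f \in B -> dot (vec g) (dual B f) != 0 ->
  g |: (B :\ f) \in bases L.
Proof.
move=> fB gf0; have [Br sB] := (basesP B).1 HB.
have gBf : g \notin B :\ f.
  apply/negP; rewrite !inE => /andP[gf gB].
  by move: gf0; rewrite dualE // (negbTE gf) eqxx.
apply/basesP; split; first by apply: etrans Br; rewrite cardsU1 gBf /= (cardsD1 f B) fB.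
move=> x; set c := dot (vec g) (dual B f) in gf0.
pose a h := if h == g then dot x (dual B f) / c else
  dot x (dual B h) - dot x (dual B f) / c * dot (vec g) (dual B h).
exists a; rewrite big_setU1 //= /a eqxx.
have gE : vec g = c *: vec f
    + \sum_(h in B | h != f) dot (vec g) (dual B h) *: vec h.
  by rewrite {1}(dual_expand (vec g)) (bigD1 f fB).
have xE : x = dot x (dual B f) *: vec f
    + \sum_(h in B | h != f) dot x (dual B h) *: vec h.
  by rewrite {1}(dual_expand x) (bigD1 f fB).
have sE (F : L -> 'rV[R]_r) :
    \sum_(h in B :\ f) F h = \sum_(h in B | h != f) F h.
  by apply: eq_bigl => h; rewrite !inE andbC.
rewrite {1}xE [X in _ = _ *: X + _]gE sE.
rewrite scalerDr scalerA divfK // -addrA.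
congr (_ + _); rewrite scaler_sumr.
rewrite -big_split /=; apply: eq_bigr => h /andP[hB hf].
case: eqP => [hg|_]; first by move: gBf; rewrite -hg !inE hf hB.
by rewrite scalerA -scalerDl addrC subrK.
Qed.

End Dual.

(** Ranks are taken over the rationals, bases over the reals: the unit vectors have rational
    expansions, whose coefficients embed into [R]. *)
Lemma zspan_spanning (s : seq L) : uniq s ->
  zrank [seq ivec g | g <- s] = r -> spanning [set g in s]%SET.
Proof.
rewrite /zrank -map_comp => us dr x.
have fs : <<map (map_mx (intr : int -> rat) \o ivec) s>>%VS = fullv.
  apply/eqP; rewrite eqEdim subvf /= dr dimvf dim_matrix; lia.
have /choice[a Ha] : forall j : 'I_r, exists a : L -> rat,
    delta_mx 0 j = \sum_(g <- s) a g *: map_mx (intr : int -> rat) (ivec g) :> 'rV[rat]_r.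
  by move=> j; apply: span_map_coef us _; rewrite fs memvf.
exists (fun g => \sum_j x 0 j * ratr (a j g)).
rewrite (eq_bigl (mem s)) => [|g]; last by rewrite !inE.
rewrite -big_uniq //= {1}(row_sum_delta x).
under [RHS]eq_bigr do rewrite scaler_suml.
rewrite exchange_big /=; apply: eq_bigr => j _.
have /(congr1 (map_mx (ratr : rat -> R))) := Ha j.
rewrite map_delta_mx => ->; rewrite raddf_sum scaler_sumr; apply: eq_bigr => g _.
by apply/rowP => l /=; rewrite !mxE rmorphM /= ratr_int mulrA.
Qed.

Lemma free_rat (s : seq L) : free [seq vec g | g <- s] ->
  zrank [seq ivec g | g <- s] = size s.
Proof.
move=> fs; suff : free [seq map_mx (intr : int -> rat) v | v <- [seq ivec g | g <- s]].
  by rewrite /free !size_map => /eqP.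
rewrite -map_comp; set X := map _ s.
have sX : size X == size s by rewrite size_map.
have sY : size [seq vec g | g <- s] == size s by rewrite size_map.
apply/(@freeP _ _ _ (Tuple sX)) => k k0 i.
have /freeP/(_ (fun i => ratr (k i))) := (fs : free (Tuple sY)).
have H : \sum_(j < size s) ratr (k j) *: (Tuple sY)`_j = 0 :> 'rV[R]_r.
  have /(congr1 (map_mx (ratr : rat -> R))) := k0.
  rewrite map_mx0 raddf_sum => H; rewrite -[RHS]H; apply: eq_bigr => j _.
  have x0 := tnth (in_tuple s) j.
  rewrite /= !(nth_map x0) //; apply/rowP => l.
  by rewrite !mxE rmorphM /= ratr_int.
by move=> /(_ H i) /eqP; rewrite fmorph_eq0 => /eqP.
Qed.

End Bases.

(** * Summability and summation by parts *)

Section Boxes.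
Context {R : realType} {r : nat}.

Definition row_of (k : {ffun 'I_r -> int}) : 'rV[int]_r := \row_j k j.

Definition vbox (N : nat) : {fset 'rV[int]_r} :=
  [fset row_of k | k in fset_ffun (T := 'I_r) (intbox N)]%fset.

Lemma mem_vbox N (v : 'rV[int]_r) : (v \in vbox N) = [forall j, (absz (v 0%R j) <= N)%N].
Proof.
apply/imfsetP/forallP => [[k /= kN ->] j|vN].
  by rewrite mxE; move: kN; rewrite mem_fset_ffun => /forallP/(_ j); rewrite mem_intbox.
exists [ffun j => v 0 j]; last by apply/rowP => j; rewrite mxE ffunE.
by rewrite /= mem_fset_ffun; apply/forallP => j; rewrite ffunE mem_intbox.
Qed.

End Boxes.

Section Summability.
Context {R : realType} {r : nat} {L : {fset 'rV[int]_r * R[i]}}.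
Implicit Types (f g : L) (A B : {set L}) (v w : 'rV[int]_r).

Definition lval f v : int := idot (ivec f) v.

Definition lwt f v : R := 1 + `|lval f v|%:~R.

Lemma lwt_ge1 f v : 1 <= lwt f v.
Proof. by rewrite lerDl ler0z. Qed.

Lemma lwt_gt0 f v : 0 < lwt f v.
Proof. exact: lt_le_trans (lwt_ge1 f v). Qed.

Lemma dot_vec f v : dot (vec f) (realvec R v) = (lval f v)%:~R.
Proof. exact: dot_realvec. Qed.

Lemma lvalB f v w : lval f (v - w) = lval f v - lval f w.
Proof. exact: idotBr. Qed.

Lemma lval_inj B v w : B \in bases L ->
  (forall f, f \in B -> lval f v = lval f w) -> v = w.
Proof.
move=> HB vw; apply: (@realvec_inj R); apply: (dual_unique HB) => f fB.
by rewrite !dot_vec vw.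
Qed.

(** [M] depends neither on the centres [m] nor on the forms, provided these separate points: [v] is
    then determined by an integer tuple, and the sum over all tuples factorizes. Moving centres are
    needed for shells that recede with [N]. *)
Lemma bounded_sums_forms (q : nat) (B : {set L}) : exists M : R,
  forall (la : L -> 'rV[int]_r -> int) (m : L -> int),
  (forall v w, (forall f, f \in B -> la f v = la f w) -> v = w) ->
  forall J : {fset 'rV[int]_r},
  \sum_(v <- J) \prod_(f in B) wt q (la f v - m f) <= M.
Proof.
pose b f (n : int) : R := if f \in B then wt q n else (n == 0)%:R.
have b0 f n : 0 <= b f n by rewrite /b; case: ifP => _; rewrite ?wt_ge0.
have sb f : bounded_sums (b f).
  case: (boolP (f \in B)) => fB.
    have -> : b f = wt q by apply/funext => n; rewrite /b fB.
    exact: bounded_sums_wt.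
  have -> : b f = fun n => (n == 0)%:R by apply/funext => n; rewrite /b (negbTE fB).
  exact: bounded_sums_delta.
have [M HM] := bounded_sums_prod b0 sb; exists M => la m la_inj J.
pose h v : {ffun L -> int} := [ffun f => if f \in B then la f v - m f else 0].
have h_inj : injective h.
  move=> v w /ffunP vw; apply: la_inj => f fB; have := vw f; rewrite !ffunE fB.
  exact: addIr.
apply: le_trans (HM (h @` J)%fset); rewrite [leRHS]big_imfset /=; last first.
  by move=> v w _ _; apply: h_inj.
apply: ler_sum => v _; rewrite [leRHS](bigID (mem B)) /= [X in _ * X]big1.
  rewrite mulr1 le_eqVlt; apply/orP; left; apply/eqP; apply: eq_bigr => f fB.
  by rewrite /b ffunE fB.
by move=> f /negbTE fB; rewrite /b ffunE fB eqxx.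
Qed.

Lemma prod_gt0 A (m : L -> nat) v : 0 < \prod_(f in A) lwt f v ^+ m f.
Proof. by apply: prodr_gt0 => f _; rewrite exprn_gt0 ?lwt_gt0. Qed.

(* Averaging over all n bases contained in A: an element that some basis avoids
   lies in at most n - 1 of them, so the smallest product over a basis is at
   most (prod_A x^m)^((2n-1)/2n). *)
Lemma basis_power_le A (m : L -> nat) (BB : {set {set L}}) v :
  (forall B, B \in BB -> B \subset A) -> (0 < #|BB|)%N ->
  (forall f, f \in A -> (0 < m f)%N) ->
  (forall f, f \in A -> m f = 1%N -> exists2 B, B \in BB & f \notin B) ->
  exists2 B, B \in BB &
    (\prod_(f in B) lwt f v) ^+ (2 * #|BB|) <=
    (\prod_(f in A) lwt f v ^+ m f) ^+ (2 * #|BB|).-1.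
Proof.
move=> BA n0 m0 m1; set n := #|BB|.
pose P (B : {set L}) := \prod_(f in B) lwt f v.
have P0 B : 0 < P B by apply: prodr_gt0 => f _; apply: lwt_gt0.
have [B1 B1B] := card_gt0P n0.
case: (@arg_minP _ _ _ B1 (mem BB) P B1B) => B BBB Bmin.
exists B => //; rewrite -/(P B).
have prodP : \prod_(B' in BB) P B' =
    \prod_(f in A) lwt f v ^+ #|[set B' in BB | f \in B']|.
  rewrite (eq_bigr (fun B' : {set L} => \prod_(f in A) (if f \in B' then lwt f v else 1))).
    rewrite exchange_big /=; apply: eq_bigr => f fA.
    rewrite -big_mkcondr /= prodr_const; congr (_ ^+ _); apply: eq_card => B'.
    by rewrite !inE.
  move=> B' B'B; rewrite -big_mkcondr /=; apply: eq_bigl => f.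
  by case: (boolP (f \in B')) => fB; rewrite ?andbT ?andbF // (fintype.subsetP (BA _ B'B)).
have nf f : f \in A -> (2 * #|[set B' in BB | f \in B']| <= m f * (2 * n).-1)%N.
  move=> fA; have n1 : (#|[set B' in BB | f \in B']| <= n)%N.
    by apply: subset_leq_card; apply/fintype.subsetP => B'; rewrite inE => /andP[].
  have [mf|mf] := eqVneq (m f) 1%N.
    have [B' B'B fB'] := m1 f fA mf.
    have : (#|[set B' in BB | f \in B']| < n)%N.
      apply: proper_card; apply/properP; split.
        by apply/fintype.subsetP => B2; rewrite inE => /andP[].
      by exists B' => //; rewrite inE B'B.
    by rewrite mf; lia.
  have := m0 f fA; move: n1 n0 mf; rewrite -/n; nia.
have P1 : P B ^+ n <= \prod_(B' in BB) P B'.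
  rewrite /n -prodr_const; apply: ler_prod => B' B'B.
  by rewrite (ltW (P0 _)) Bmin.
rewrite mulnC exprM; apply: le_trans (_ : (\prod_(B' in BB) P B') ^+ 2 <= _).
  rewrite lerXn2r // ?nnegrE; first exact: exprn_ge0 (ltW (P0 _)).
  by apply: prodr_ge0 => *; exact: ltW.
rewrite prodP -!prodrXl; apply: ler_prod => f fA.
rewrite exprn_ge0 ?exprn_ge0 ?(ltW (lwt_gt0 _ _)) //= -!exprM.
rewrite ler_weXn2l ?lwt_ge1 //.
by rewrite [(n * 2)%N]mulnC [X in (X <= _)%N]mulnC; exact: nf.
Qed.

Lemma powR_prod (I : Type) (s : seq I) (Q : pred I) (F : I -> R) (p : R) :
  (forall i, 0 <= F i) ->
  (\prod_(i <- s | Q i) F i) `^ p = \prod_(i <- s | Q i) F i `^ p.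
Proof.
move=> F0; elim: s => [|i s IH]; first by rewrite !big_nil powR1.
by rewrite !big_cons; case: ifP => _ //; rewrite powRM ?prodr_ge0 // IH.
Qed.

(** For each [v] one basis provides the bound of [basis_power_le], but which one depends on [v]; the
    sum over all bases contained in [A] is a majorant for every [v]. *)
Lemma bounded_sums_arrangement A (m : L -> nat) :
  (exists2 B, B \in bases L & B \subset A) ->
  (forall f, f \in A -> (0 < m f)%N) ->
  (forall f, f \in A -> m f = 1%N ->
     exists B, [/\ B \in bases L, B \subset A & f \notin B]) ->
  bounded_sums (fun v => (\prod_(f in A) lwt f v ^+ m f)^-1).
Proof.
move=> [B0 B0b B0A] m0 m1.
pose BB : {set {set L}} := [set B in bases L | B \subset A].
have n0 : (0 < #|BB|)%N by apply/card_gt0P; exists B0; rewrite inE B0b.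
(* With [q + 2 = 2n], where [n] counts the bases, the exponent [1 + 1/(q+1)] of [wt q] is the
   reciprocal of [(2n-1)/(2n)]. *)
pose q := (2 * #|BB|).-2.
have q1 : q.+1 = (2 * #|BB|).-1 by rewrite /q; lia.
have q2 : q.+2 = (2 * #|BB|)%N by rewrite /q; lia.
have : bounded_sums (fun v => \sum_(B in BB) \prod_(f in B) wt (R := R) q (lval f v)).
  rewrite (_ : (fun v => _) = fun v => \sum_(B <- enum BB) if B \in BB then
     \prod_(f in B) wt (R := R) q (lval f v) else 0).
    apply: bounded_sums_sum => B; case: (boolP (B \in BB)) => [|_].
      rewrite inE => /andP[Bb _]; have [M HM] := bounded_sums_forms q B.
      exists M => J; apply: le_trans (HM lval (fun=> 0) _ J).
        by apply: ler_sum => v _; under [leRHS]eq_bigr do rewrite subr0.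
      by move=> v w; apply: lval_inj.
    by exists 0 => J; rewrite big1.
  apply/funext => v; rewrite big_enum /=; apply: eq_bigr => B -> //.
apply: bounded_sums_le => v.
have [|||| B BBB HB] := @basis_power_le A m BB v.
- by move=> B; rewrite inE => /andP[].
- by [].
- by [].
- by move=> f fA /(m1 f fA)[B [Bb BA fB]]; exists B => //; rewrite inE Bb.
apply: le_trans (_ : \prod_(f in B) wt q (lval f v) <= _); last first.
  rewrite (bigD1 B) //= lerDl sumr_ge0 // => B' _.
  by apply: prodr_ge0 => f _; apply: wt_ge0.
set X := \prod_(f in A) _ in HB *.
have X0 : 0 < X by apply: prod_gt0.
have P0 : 0 < \prod_(f in B) lwt f v by apply: prodr_gt0 => f _; apply: lwt_gt0.
have -> : \prod_(f in B) wt q (lval f v) =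
   ((\prod_(f in B) lwt f v) `^ (1 + q.+1%:R^-1))^-1.
  rewrite powR_prod => [|f]; last exact: ltW (lwt_gt0 _ _).
  by rewrite prodfV.
have s0 : 0 <= (q.+1%:R^-1 : R) by rewrite invr_ge0.
rewrite lef_pV2 ?posrE ?powR_gt0 //.
have -> : 1 + q.+1%:R^-1 = q.+2%:R * q.+1%:R^-1 :> R.
  by rewrite -[q.+2%:R]natr1 mulrDl mul1r divff // pnatr_eq0.
rewrite powRrM powR_mulrn ?(ltW P0) //.
have -> : X = (X ^+ q.+1) `^ q.+1%:R^-1.
  by rewrite -powR_mulrn ?(ltW X0) // -powRrM mulfV ?pnatr_eq0 // powRr1 ?(ltW X0).
have HB' : (\prod_(f in B) lwt f v) ^+ q.+2 <= X ^+ q.+1 by rewrite q2 q1.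
by rewrite ge0_ler_powR // ?nnegrE ?exprn_ge0 ?(ltW P0) ?(ltW X0).
Qed.

Lemma coord_dual B v j : B \in bases L ->
  (v 0 j)%:~R = \sum_(f in B) dot (delta_mx 0 j) (dual B f) * (lval f v)%:~R :> R.
Proof.
move=> HB; have -> : (v 0 j)%:~R = dot (delta_mx 0 j) (realvec R v).
  by rewrite dotC dot_delta mxE.
by rewrite (dot_dual HB); apply: eq_bigr => f _; rewrite dot_vec.
Qed.

Lemma lval_bound f : exists2 C : R, 1 <= C & forall v (M : R), 0 <= M ->
  (forall j, `|v 0 j|%:~R <= M) -> `|lval f v|%:~R <= C * M.
Proof.
exists (1 + \sum_j `|ivec f 0 j|%:~R) => [|v M M0 vM].
  by rewrite lerDl sumr_ge0 // => j _; rewrite ler0z.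
apply: le_trans (_ : (\sum_j `|ivec f 0 j|%:~R) * M <= _).
  rewrite intr_norm /lval /idot rmorph_sum /= mulr_suml.
  apply: le_trans (ler_norm_sum _ _ _) _; apply: ler_sum => j _.
  by rewrite rmorphM /= normrM -!intr_norm ler_wpM2l ?ler0z.
by rewrite mulrDl mul1r lerDr.
Qed.

Definition shell (N c : nat) (J : {fset 'rV[int]_r}) : Prop :=
  forall v, v \in J -> (forall j, (absz (v 0%R j) <= N + c)%N) /\
    exists j, (N <= absz (v 0%R j) + c)%N.

(* On a face |v_j| ~ N some f in B with e_j in the direction of f has
   |f(v)| >> N; this factor 1/N outweighs the loss N^(1/2) caused by making the
   other factors summable over the face. *)
Lemma shell_sum B c : B \in bases L -> exists K C : R, [/\ 0 <= K, 0 < C &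
  forall N J, (2 * c + 2 <= N)%N -> shell N c J ->
  \sum_(v <- J) (\prod_(f in B) lwt f v)^-1 <= K * ((C * N%:R) `^ 2^-1 / N%:R)].
Proof.
move=> HB; have [Br _] := (basesP B).1 HB.
pose cj (j : 'I_r) f : R := dot (delta_mx 0 j) (dual B f).
pose C0 : R := 1 + \sum_j \sum_(f : L) `|cj j f|.
have C01 : 1 <= C0 by rewrite lerDl sumr_ge0 // => j _; rewrite sumr_ge0.
have cjC j f : `|cj j f| <= C0.
  rewrite /C0 (bigD1 j) //= (bigD1 f) //= addrCA -addrA lerDl.
  rewrite addr_ge0 ?sumr_ge0 // addr_ge0 // sumr_ge0 // => i _.
  by rewrite sumr_ge0.
have /choice[Cg HCg] : forall f, exists C : R, 1 <= C /\ forall v (M : R), 0 <= M ->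
    (forall j, `|v 0 j|%:~R <= M) -> `|lval f v|%:~R <= C * M.
  by move=> f; have [C C1 H] := lval_bound f; exists C.
pose C2 : R := 1 + \sum_(f : L) (2 * Cg f + 1).
have Cg0 f : 0 <= 2 * Cg f + 1 by have [h _] := HCg f; lra.
have C2f f : 2 * Cg f + 1 <= C2.
  by rewrite /C2 (bigD1 f) //= addrCA lerDl addr_ge0 ?sumr_ge0.
have C21 : 1 <= C2 by rewrite lerDl sumr_ge0.
(* With [de = 1/(2r+1)], at most [r] factors of size [(C N)^de] cost no more than [(C N)^(1/2)]. *)
pose q := (2 * r)%N; pose de : R := q.+1%:R^-1.
have de0 : 0 <= de by rewrite invr_ge0.
have [M HM] := bounded_sums_forms q B.
have M0 : 0 <= M.
  have := HM lval (fun=> 0) _ fset0; rewrite big_seq_fset0; apply=> v w.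
  exact: lval_inj.
pose C1 : R := 2 * (r.+1)%:R * C0.
have C10 : 0 < C1 by rewrite !mulr_gt0 ?ltr0n //; lra.
pose idx := ('I_r * L * bool * 'I_(2 * c).+1)%type.
pose ctr (N : nat) (p : idx) : int := (if p.1.2 then Posz N else - Posz N) + (Posz p.2 - Posz c).
(* An index fixes the coordinate near a face, the element [f] traded for it, the sign and the
   distance from the face. Replacing the form of [f] by that coordinate keeps the forms separating,
   and centring at [ctr] turns its weight into 1. *)
pose la (p : idx) g v : int := if g == p.1.1.2 then v 0 p.1.1.1 else lval g v.
pose ms N (p : idx) g : int := if g == p.1.1.2 then ctr N p else 0.
pose ok (p : idx) := (p.1.1.2 \in B) && (cj p.1.1.1 p.1.1.2 != 0).
pose G N v : R := \sum_(p : idx | ok p) \prod_(g in B) wt q (la p g v - ms N p g).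
have la_inj p : ok p -> forall v w, (forall g, g \in B -> la p g v = la p g w) -> v = w.
  case: p => [[[j f] b] i] /andP[/= fB cf] v w vw.
  have H g : g \in B -> g != f -> lval g v = lval g w.
    by move=> gB gf; have := vw g gB; rewrite /la /= (negbTE gf).
  apply: (lval_inj HB) => g gB; have [->|gf] := eqVneq g f; last exact: H.
  have := vw f fB; rewrite /la /= eqxx => vwj.
  have := coord_dual v j HB; rewrite vwj (coord_dual w j HB).
  rewrite (bigD1 f fB) [RHS](bigD1 f fB) /=.
  rewrite (eq_bigr (fun i => dot (delta_mx 0 j) (dual B i) * (lval i v)%:~R)).
    by move=> /addIr /(mulfI cf) /intr_inj ->.
  by move=> h /andP[hB hf]; rewrite H.
have GM N (J : {fset 'rV[int]_r}) : \sum_(v <- J) G N v <= #|{: idx}|%:R * M.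
  rewrite exchange_big /= -sum1_card natr_sum mulr_suml.
  rewrite [leRHS](bigID ok) /= -[leLHS]addr0 lerD ?sumr_ge0 // => [|p _]; last by rewrite mulr_ge0.
  apply: ler_sum => p okp; rewrite mul1r; exact: HM (la_inj p okp) J.
exists (C1 * (#|{: idx}|%:R * M)), C2; split.
- by rewrite mulr_ge0 ?(ltW C10) // mulr_ge0.
- by apply: lt_le_trans C21.
move=> N J cN shJ.
have N0 : 0 < N%:R :> R by rewrite ltr0n; lia.
have CN1 : 1 <= C2 * N%:R.
  by rewrite mulr_ege1 // ler1n; lia.
have key v : v \in J -> (\prod_(f in B) lwt f v)^-1 <=
    C1 * ((C2 * N%:R) `^ 2^-1 / N%:R) * G N v.
  move=> vJ; have [vN [j vj]] := shJ v vJ.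
  have vjN : N%:R / 2 <= `|v 0 j|%:~R :> R.
    rewrite ler_pdivrMr // -abszE -[X in _ <= X * _]pmulrn -natrM ler_nat.
    by clear -cN vj; lia.
  have vj0 : 0 < `|v 0 j|%:~R :> R by apply: lt_le_trans vjN; rewrite divr_gt0.
  (* Pigeonhole over the [r] terms of the expansion of [v_j]; dividing by [r + 1] makes the
     contradiction strict. *)
  have [f fB Hf] : exists2 f, f \in B &
      `|v 0 j|%:~R / r.+1%:R <= `|cj j f| * `|lval f v|%:~R.
    apply: contrapT => nf.
    have : `|v 0 j|%:~R <= \sum_(f in B) `|v 0 j|%:~R / r.+1%:R :> R.
      rewrite {1}intr_norm (coord_dual v j HB); apply: le_trans (ler_norm_sum _ _ _) _.
      apply: ler_sum => f fB; rewrite normrM -intr_norm leNgt; apply/negP => h.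
      by apply: nf; exists f => //; apply: ltW.
    rewrite sumr_const Br -[leRHS]mulr_natr mulrAC ler_pdivlMr ?ltr0n //.
    by rewrite ler_pM2l // ler_nat ltnn.
  have cf : cj j f != 0.
    apply/eqP => c0; move: Hf; rewrite c0 normr0 mul0r leNgt => /negP; apply.
    by rewrite divr_gt0.
  have lf : N%:R / C1 <= lwt f v.
    apply: le_trans (_ : `|lval f v|%:~R <= _); last by rewrite lerDr.
    have l0 : 0 <= `|lval f v|%:~R :> R by rewrite ler0z.
    have := le_trans Hf (ler_wpM2r l0 (cjC j f)).
    rewrite !ler_pdivrMr // ?ltr0n // /C1 => h.
    have -> : `|lval f v|%:~R * (2 * r.+1%:R * C0) =
      (C0 * `|lval f v|%:~R * r.+1%:R) * 2 by ring.
    by move: vjN; rewrite ler_pdivrMr // => /le_trans; apply; rewrite ler_pM2r.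
  have up g : lwt g v <= C2 * N%:R.
    have [Cg1 H] := HCg g.
    have h : `|lval g v|%:~R <= Cg g * (2 * N%:R).
      apply: H => [|l]; first by rewrite mulr_ge0 // ltW.
      rewrite -abszE -[2 * _](natrM R 2 N) -[leLHS]pmulrn ler_nat.
      by apply: leq_trans (vN l) _; clear -cN; lia.
    have N1 : 1 <= N%:R :> R by rewrite ler1n; clear -cN; lia.
    apply: le_trans (_ : (2 * Cg g + 1) * N%:R <= _); last first.
      by rewrite ler_wpM2r // ltW.
    rewrite /lwt; apply: le_trans (lerD N1 h) _; rewrite mulrDl; lra.
  pose b := 0 <= v 0 j.
  pose s0 : int := if b then Posz N else - Posz N.
  have ib : (absz (v 0 j - s0 + Posz c)%R < (2 * c).+1)%N.
    by move: (vN j) vj; rewrite /s0 /b; clear; case: ifP; lia.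
  pose p : idx := (j, f, b, Ordinal ib).
  have ctrp : ctr N p = v 0 j.
    by rewrite /ctr /= -/s0; move: (vN j) vj; rewrite /s0 /b; clear; case: ifP; lia.
  have okp : ok p by rewrite /ok /= fB cf.
  have Gp : \prod_(g in B | g != f) wt q (lval g v) <= G N v.
    apply: le_trans (_ : \prod_(g in B) wt q (la p g v - ms N p g) <= _).
      rewrite (bigD1 f fB) /= {1}/la {1}/ms /= eqxx ctrp subrr.
      have -> : wt q 0 = 1 :> R by rewrite /wt normr0 addr0 powR1 invr1.
      rewrite mul1r le_eqVlt; apply/orP; left; apply/eqP; apply: eq_bigr.
      by move=> g /andP[_ gf]; rewrite /la /ms /= (negbTE gf) subr0.
    rewrite /G (bigD1 p okp) /= lerDl sumr_ge0 // => p' _.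
    by apply: prodr_ge0 => g _; apply: wt_ge0.
  have CN0 : 0 < C2 * N%:R by apply: lt_le_trans CN1.
  have dn n : (n <= r)%N -> ((C2 * N%:R) `^ de) ^+ n <= (C2 * N%:R) `^ 2^-1.
    move=> nr; rewrite -powR_mulrn ?powR_ge0 // -powRrM ler_powR //.
    rewrite mulrC ler_pdivrMr ?ltr0n // mulrC ler_pdivlMr //.
    by rewrite -natrM ler_nat /q; move: nr; clear; lia.
  have Pr : (\prod_(g in B | g != f) lwt g v)^-1 <=
      (C2 * N%:R) `^ 2^-1 * \prod_(g in B | g != f) wt q (lval g v).
    rewrite -prodfV.
    apply: le_trans (_ : \prod_(g in B | g != f) (((C2 * N%:R) `^ de) * wt q (lval g v)) <= _).
      apply: ler_prod => g _; rewrite invr_ge0 (ltW (lwt_gt0 _ _)) /=.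
      have -> : (lwt g v)^-1 = lwt g v `^ de * wt q (lval g v).
        rewrite /wt -/(lwt g v) -/de powRD; last by rewrite (gt_eqF (lwt_gt0 _ _)) implybT.
        rewrite powRr1 ?(ltW (lwt_gt0 _ _)) //.
        by field; rewrite !gt_eqF ?powR_gt0 ?lwt_gt0.
      rewrite ler_wpM2r ?wt_ge0 // ge0_ler_powR ?nnegrE ?(ltW (lwt_gt0 _ _)) ?(ltW CN0) //.
    rewrite big_split /= prodr_const ler_wpM2r ?prodr_ge0 // => [g _|]; first exact: wt_ge0.
    apply: dn; apply: leq_trans (_ : _ <= #|B|)%N _; last by rewrite Br.
    by apply: subset_leq_card; apply/fintype.subsetP => g /andP[].
  rewrite (bigD1 f fB) /= invfM.
  apply: le_trans (_ : (C1 / N%:R) * ((C2 * N%:R) `^ 2^-1 *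
     \prod_(g in B | g != f) wt q (lval g v)) <= _).
    apply: ler_pM => //; rewrite ?invr_ge0 ?(ltW (lwt_gt0 _ _)) //.
      by apply: prodr_ge0 => g _; apply: ltW (lwt_gt0 _ _).
    rewrite -[leRHS]invrK invf_div lef_pV2 ?posrE ?lwt_gt0 ?divr_gt0 //.
  have -> : C1 * ((C2 * N%:R) `^ 2^-1 / N%:R) * G N v =
     C1 / N%:R * ((C2 * N%:R) `^ 2^-1 * G N v) by ring.
  rewrite ler_wpM2l ?divr_ge0 ?(ltW C10) // ler_wpM2l ?powR_ge0 //.
apply: le_trans (_ : \sum_(v <- J) C1 * ((C2 * N%:R) `^ 2^-1 / N%:R) * G N v <= _).
  by rewrite big_seq [leRHS]big_seq; apply: ler_sum => v; apply: key.
rewrite -mulr_sumr.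
have -> : C1 * (#|{: idx}|%:R * M) * ((C2 * N%:R) `^ 2^-1 / N%:R) =
  C1 * ((C2 * N%:R) `^ 2^-1 / N%:R) * (#|{: idx}|%:R * M) by ring.
by rewrite ler_wpM2l // mulr_ge0 ?(ltW C10) // divr_ge0 ?powR_ge0.
Qed.

Lemma shell_cvg (K C : R) : 0 <= K -> 0 < C ->
  (fun N => K * ((C * N%:R) `^ 2^-1 / N%:R)) @ \oo --> (0 : R).
Proof.
move=> K0 C0; apply/cvgrPdist_lt => e e0.
have e1 : 0 < e / (K + 1) by rewrite divr_gt0 // ltr_wpDl.
exists (Num.trunc (C / (e / (K + 1)) ^+ 2)).+1 => // N /= HN.
rewrite sub0r normrN ger0_norm; last by rewrite mulr_ge0 // divr_ge0 // powR_ge0.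
have N0 : 0 < N%:R :> R by rewrite ltr0n; apply: leq_trans HN.
have h : C / (e / (K + 1)) ^+ 2 < N%:R.
  have /andP[_ h] := truncn_itv (divr_ge0 (ltW C0) (exprn_ge0 2 (ltW e1))).
  by apply: lt_le_trans h _; rewrite ler_nat.
have CN : 0 < C * N%:R by rewrite mulr_gt0.
have h2 : (C * N%:R) `^ 2^-1 / N%:R < e / (K + 1).
  rewrite powR12_sqrt ?(ltW CN) // ltr_pdivrMr //.
  have eN : 0 <= e / (K + 1) * N%:R by rewrite mulr_ge0 // ltW.
  rewrite -(@ltr_pXn2r _ 2) ?nnegrE ?sqrtr_ge0 //.
  rewrite sqr_sqrtr ?(ltW CN) // exprMn [N%:R ^+ 2]expr2 mulrA ltr_pM2r //.
  by rewrite mulrC -ltr_pdivrMr // exprn_gt0.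
apply: le_lt_trans (ler_wpM2l K0 (ltW h2)) _.
by rewrite mulrCA gtr_pMr // ltr_pdivrMr ?ltr_wpDl // mul1r ltrDl.
Qed.

Lemma shell_ccvg B c (D : R) (Js : nat -> {fset 'rV[int]_r}) (F : 'rV[int]_r -> R[i]) :
  B \in bases L -> (forall N, shell N c (Js N)) -> 0 <= D ->
  (forall v, cnorm (F v) <= D * (\prod_(f in B) lwt f v)^-1) ->
  ccvg \oo (fun N => \sum_(v <- Js N) F v) 0.
Proof.
move=> HB sh D0 FD; have [K [C [K0 C0 H]]] := shell_sum c HB.
apply: (@ccvg_squeeze _ _ _ _ _ _ (fun N => D * K * ((C * N%:R) `^ 2^-1 / N%:R))).
  exists (2 * c + 2)%N => // N /= cN; rewrite subr0.
  apply: le_trans (cnorm_sum _ _ _) _.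
  apply: le_trans (_ : \sum_(v <- Js N) D * (\prod_(f in B) lwt f v)^-1 <= _).
    by apply: ler_sum.
  by rewrite -mulr_sumr -mulrA ler_wpM2l // H.
by apply: shell_cvg => //; rewrite mulr_ge0.
Qed.

Lemma sum_fset_diff (F : 'rV[int]_r -> R[i]) (X Y : {fset 'rV[int]_r}) :
  \sum_(v <- X) F v - \sum_(v <- Y) F v =
  \sum_(v <- (X `\` Y)%fset) F v - \sum_(v <- (Y `\` X)%fset) F v.
Proof.
rewrite (sum_fset_sub F (fsubsetIl X Y)) (sum_fset_sub F (fsubsetIr X Y)).
have -> : (X `\` (X `&` Y) = X `\` Y)%fset.
  by apply/fsetP => v; rewrite !inE; case: (v \in X); case: (v \in Y).
have -> : (Y `\` (X `&` Y) = Y `\` X)%fset.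
  by apply/fsetP => v; rewrite !inE; case: (v \in X); case: (v \in Y).
by ring.
Qed.

Section ByParts.
Context (A B0 K : {set L}) (q : L -> int -> R[i]) (Cq : R) (u : L -> 'rV[int]_r).
Hypotheses (HB0 : B0 \in bases L) (B0A : B0 \subset A) (KA : K \subset A).
Hypotheses (Cq0 : 0 <= Cq)
  (qC : forall f n, cnorm (q f n) <= Cq * (1 + `|n|%:~R)^-1).
Hypothesis hu : forall f g, f \in K -> g \in A -> g != f -> lval g (u f) = 0.

(** For [f] in [J] the factor is differenced along [u f], a vector on which every other form of [A]
    vanishes, so that differences in distinct directions act on distinct factors. *)
Definition diff_fac (J : {set L}) f v : R[i] :=
  if f \in J then q f (lval f v) - q f (lval f v - lval f (u f))
  else q f (lval f v).

Definition diff_term (J : {set L}) v : R[i] := \prod_(f in A) diff_fac J f v.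

Lemma diff_fac_le (J : {set L}) f v : cnorm (diff_fac J f v) <=
  Cq * (2 + `|lval f (u f)|%:~R) * (lwt f v)^-1.
Proof.
have d0 : 0 <= `|lval f (u f)|%:~R :> R by rewrite ler0z.
have l0 := lwt_gt0 f v.
have h0 := qC f (lval f v).
rewrite /diff_fac; case: ifP => _; last first.
  apply: le_trans h0 _; rewrite ler_wpM2r ?invr_ge0 ?(ltW l0) //.
  by rewrite ler_peMr //; lra.
apply: le_trans (cnormB _ _) _.
have -> : Cq * (2 + `|lval f (u f)|%:~R) / lwt f v =
   Cq / lwt f v + Cq * ((1 + `|lval f (u f)|%:~R) / lwt f v) by ring.
apply: lerD => //; apply: le_trans (qC _ _) _; rewrite ler_wpM2l //.
have w0 : 0 < 1 + `|lval f v - lval f (u f)|%:~R :> R by rewrite ltr_pwDl ?ler0z.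
rewrite ler_pdivlMr // mulrC ler_pdivrMr //; exact: shift_weight.
Qed.

Lemma diff_term_le (J : {set L}) : exists2 D : R, 0 <= D &
  forall v, cnorm (diff_term J v) <= D * (\prod_(f in B0) lwt f v)^-1.
Proof.
have d0 f : 0 <= Cq * (2 + `|lval f (u f)|%:~R) :> R by rewrite mulr_ge0 // addr_ge0 // ler0z.
exists (\prod_(f in A) (Cq * (2 + `|lval f (u f)|%:~R))) => [|v].
  by apply: prodr_ge0.
rewrite cnorm_prod.
apply: le_trans (_ : \prod_(f in A) (Cq * (2 + `|lval f (u f)|%:~R) * (lwt f v)^-1) <= _).
  by apply: ler_prod => f _; rewrite cnorm_ge0 diff_fac_le.
rewrite big_split /= ler_wpM2l ?prodr_ge0 // -prodfV.
rewrite (bigID (mem B0)) /= -[leRHS]mulr1.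
have i0 f : 0 <= (lwt f v)^-1 by rewrite invr_ge0 ltW ?lwt_gt0.
rewrite ler_pM ?prodr_ge0 //.
  rewrite le_eqVlt; apply/orP; left; apply/eqP; apply: eq_bigl => f.
  by case: (boolP (f \in B0)) => fB; rewrite ?andbF ?andbT // (fintype.subsetP B0A).
suff /andP[] : 0 <= \prod_(f in A | f \notin B0) (lwt f v)^-1 <= 1 by [].
elim/big_rec: _ => [|f x _ /andP[x0 x1]]; first by rewrite ler01 lexx.
by rewrite mulr_ge0 ?i0 //= mulr_ile1 ?i0 // invf_le1 ?lwt_ge1 ?lwt_gt0.
Qed.

Variable y : 'rV[R]_r.

Let ev v : R[i] := echar (dot y (realvec R v)).
Let zt f : R[i] := echar (dot y (realvec R (u f))).

Lemma diff_termU (J : {set L}) f v : f \in K -> f \notin J ->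
  diff_term (f |: J) v = diff_term J v - diff_term J (v - u f).
Proof.
move=> fK fJ; have fA := fintype.subsetP KA f fK.
rewrite /diff_term (bigD1 f fA) [in RHS](bigD1 f fA) /=.
rewrite [X in _ = _ - X](bigD1 f fA) /=.
have -> : \prod_(g in A | g != f) diff_fac (f |: J) g v =
          \prod_(g in A | g != f) diff_fac J g v.
  by apply: eq_bigr => g /andP[_ gf]; rewrite /diff_fac !inE (negbTE gf).
have -> : \prod_(g in A | g != f) diff_fac J g (v - u f) =
          \prod_(g in A | g != f) diff_fac J g v.
  apply: eq_bigr => g /andP[gA gf]; rewrite /diff_fac lvalB.
  by rewrite (hu fK gA gf) subr0.
rewrite -mulrBl /diff_fac !inE eqxx (negbTE fJ) /=; congr (_ * _).
by rewrite lvalB.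
Qed.

(** Abel summation: the two sums differ by the terms between the cube and its translate along [u f].
    These lie in a shell, where [shell_ccvg] controls them although the sums over the cubes need not
    converge absolutely. *)
Lemma diff_step (J : {set L}) f : f \in K -> f \notin J ->
  ccvg \oo (fun N => (1 - zt f) * (\sum_(v <- vbox N) ev v * diff_term J v)
    - \sum_(v <- vbox N) ev v * diff_term (f |: J) v) 0.
Proof.
move=> fK fJ; pose F v := ev v * zt f * diff_term J v.
pose bx N : {fset 'rV[int]_r} := [fset v - u f | v in vbox N]%fset.
have evD v w : ev (v + w) = ev v * echar (dot y (realvec R w)).
  by rewrite /ev realvecD dotDr echarD.
have E N : (1 - zt f) * (\sum_(v <- vbox N) ev v * diff_term J v)
    - \sum_(v <- vbox N) ev v * diff_term (f |: J) v =
    \sum_(v <- (bx N `\` vbox N)%fset) F v - \sum_(v <- (vbox N `\` bx N)%fset) F v.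
  rewrite -sum_fset_diff [X in _ = X - _]big_imfset /=; last first.
    by move=> v w _ _ /addIr.
  rewrite mulr_sumr -!sumrB; apply: eq_bigr => v _.
  rewrite diff_termU // /F -evD subrK; ring.
have [D D0 HD] := diff_term_le J.
have FD v : cnorm (F v) <= D * (\prod_(f in B0) lwt f v)^-1.
  by rewrite /F cnormM cnormM /ev /zt !cnorm_echar !mul1r.
pose c := \max_(j < r) absz (u f 0%R j).
have cu j : (absz (u f 0%R j) <= c)%N by exact: (leq_bigmax j).
apply: (eq_ccvg (fun N => esym (E N))).
rewrite [X in ccvg _ _ X](_ : 0 = 0 - 0); last by rewrite subr0.
apply: ccvgB.
  apply: (shell_ccvg (c := c) HB0 _ D0 FD) => N v; rewrite !inE => /andP[vN].
  move=> /imfsetP[w /= wN vw].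
  have H j : w 0 j = v 0 j + u f 0 j by rewrite vw !mxE subrK.
  move: wN; rewrite mem_vbox => /forallP wN; split=> [j|].
    by have := wN j; rewrite H; have := cu j; clear; lia.
  move: vN; rewrite mem_vbox negb_forall => /existsP[j vj]; exists j.
  by move: vj; clear; lia.
apply: (shell_ccvg (c := c) HB0 _ D0 FD) => N v; rewrite !inE => /andP[vN].
rewrite mem_vbox => /forallP wN; split=> [j|]; first by have := wN j; lia.
have : v + u f \notin vbox N.
  apply: contra vN => h; apply/imfsetP; exists (v + u f) => //.
  by rewrite addrK.
have vuE j : (v + u f) 0 j = v 0 j + u f 0 j by rewrite mxE.
rewrite mem_vbox negb_forall => /existsP[j]; rewrite vuE => vj; exists j.
by have := cu j; move: vj; clear; lia.
Qed.

Lemma diff_by_parts (J : {set L}) : J \subset K ->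
  ccvg \oo (fun N => (\prod_(f in J) (1 - zt f))
      * (\sum_(v <- vbox N) ev v * diff_term finset.set0 v)
    - \sum_(v <- vbox N) ev v * diff_term J v) 0.
Proof.
elim: {J}#|J| {-2}J (erefl #|J|) => [|n IH] J nJ JK.
  move/eqP: nJ; rewrite cards_eq0 => /eqP ->.
  apply: eq_ccvg (ccvg_cst 0) => N.
  by rewrite big_set0 mul1r subrr.
have : (0 < #|J|)%N by rewrite nJ.
move=> /card_gt0P[f fJ]; have fK := fintype.subsetP JK f fJ.
have nJf : #|J :\ f| = n by move: nJ; rewrite (cardsD1 f) fJ => -[].
have JfK : J :\ f \subset K by apply: fintype.subset_trans JK; apply: subD1set.
have fJf : f \notin J :\ f by rewrite !inE eqxx.
rewrite [X in ccvg _ _ X](_ : 0 = (1 - zt f) * 0 + 0); last by rewrite mulr0 addr0.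
apply: eq_ccvg (ccvgD (ccvgMl (1 - zt f) (IH _ nJf JfK)) (diff_step fK fJf)) => N /=.
rewrite (finset.setD1K fJ) (big_setD1 f fJ) /=; ring.
Qed.

End ByParts.

End Summability.

(** * Truncated sums and the quotient by a lattice *)

Section Smooth.
Context {R : realType} {r : nat} {L : {fset 'rV[int]_r * R[i]}}.
Implicit Types (f g : L) (A B : {set L}) (v w : 'rV[int]_r) (k : {ffun L -> nat}).
Implicit Types (y : 'rV[R]_r).

Definition qfac k f (n : int) : R[i] := qcoef (k f) (pnode (off f) n).

(** The coefficient of [t^k] in the truncated sum of [e(<y, v>)] times the product over [A] of
    [t_f / (t_f - 2 pi i f(v))]. No [t_f] with [f] outside [A] occurs there, whence the first
    product. *)
Definition Zpart A k y (N : nat) : R[i] :=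
  (\prod_(f : L | f \notin A) (k f == 0%N)%:R) *
  \sum_(v <- vbox N) echar (dot y (realvec R v)) *
    \prod_(f in A) qfac k f (lval f v).

Lemma qfac_le k : exists2 C : R, 0 <= C &
  forall f n, cnorm (qfac k f n) <= C * (1 + `|n|%:~R)^-1.
Proof.
have /choice[C HC] f : exists C : R, 0 <= C /\
    forall n, cnorm (qfac k f n) <= C * (1 + `|n|%:~R)^-1.
  have [K [M [K1 M1 h _ _]]] := qcoef_bound (off f).
  exists (K * M ^+ k f); split=> [|n]; last exact: h.
  by rewrite mulr_ge0 ?exprn_ge0 //; lra.
exists (\sum_f C f) => [|f n]; first by apply: sumr_ge0 => f _; case: (HC f).
apply: le_trans ((HC f).2 n) _; rewrite ler_wpM2r ?invr_ge0 ?addr_ge0 ?ler0z //.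
by rewrite (bigD1 f) //= lerDl sumr_ge0 // => g _; case: (HC g).
Qed.

Section Parts.
Context (A B0 K : {set L}) (k : {ffun L -> nat}) (u : L -> 'rV[int]_r).
Hypotheses (HB0 : B0 \in bases L) (B0A : B0 \subset A) (KA : K \subset A).
Hypothesis hu : forall f g, f \in K -> g \in A -> g != f -> lval g (u f) = 0.
Hypothesis hm : forall f, f \in A -> f \notin K -> k f = 1%N ->
  exists B, [/\ B \in bases L, B \subset A & f \notin B].

(** The factors left with decay of order 1 are those outside [K] with [k f = 1], and each of them is
    avoided by a basis contained in [A]. *)
Lemma smooth_bound : abs_summable (diff_term A (qfac k) u K).
Proof.
pose m f : nat := if (f \in K) || (k f != 1%N) then 2%N else 1%N.
have /choice[C HC] f : exists C : R, 0 <= C /\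
    forall v, cnorm (diff_fac (qfac k) u K f v) <= C * (lwt f v ^+ m f)^-1.
  have [K1 [M [K11 M1 h1 h2 h3]]] := qcoef_bound (off f).
  have KM0 : 0 <= K1 * M ^+ k f.
    exact: mulr_ge0 (le_trans ler01 K11) (exprn_ge0 _ (le_trans ler01 M1)).
  rewrite /m /diff_fac; case: (boolP (f \in K)) => fK /=.
    have [K' K'0 h] := h3 (lval f (u f)); exists (K' * M ^+ k f); split=> [|v].
      exact: mulr_ge0 K'0 (exprn_ge0 _ (le_trans ler01 M1)).
    by have := h (k f) (lval f v); rewrite wt0E.
  case: (boolP (k f == 1%N)) => k1 /=; exists (K1 * M ^+ k f); split=> // v.
    by rewrite expr1; apply: h1.
  by have := h2 (k f) (lval f v) k1; rewrite wt0E.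
have sm : bounded_sums (fun v => (\prod_(f in A) lwt f v ^+ m f)^-1).
  apply: bounded_sums_arrangement; first by exists B0.
    by move=> f _; rewrite /m; case: ifP.
  move=> f fA; rewrite /m; case: (boolP (f \in K)) => //= fK.
  by case: eqP => //= k1 _; apply: hm.
have C0 : 0 <= \prod_(f in A) C f by apply: prodr_ge0 => f _; case: (HC f).
apply: bounded_sums_le (bounded_sumsZ C0 sm) => v.
rewrite /diff_term cnorm_prod -prodfV -big_split /=.
by apply: ler_prod => f _; rewrite cnorm_ge0 (HC f).2.
Qed.

(** Absolute convergence of the differenced sum gives its limit over cubes, and [diff_by_parts]
    transfers it to the original sum times the product. *)
Lemma smooth_ccvg y s :
  has_sum (fun v => echar (dot y (realvec R v)) * diff_term A (qfac k) u K v) s ->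
  ccvg \oo (fun N => (\prod_(f in K) (1 - echar (dot y (realvec R (u f)))))
    * \sum_(v <- vbox N) echar (dot y (realvec R v)) * \prod_(f in A) qfac k f (lval f v)) s.
Proof.
move=> hs; have [Cq Cq0 qC] := qfac_le k.
have sm : abs_summable (fun v => echar (dot y (realvec R v)) * diff_term A (qfac k) u K v).
  apply: bounded_sums_le smooth_bound => v.
  by rewrite cnormM cnorm_echar mul1r.
have ex v : \oo [set N : nat | v \in vbox N].
  exists (\max_(j < r) absz (v 0%R j)) => // N /= vN.
  rewrite mem_vbox; apply/forallP => j; apply: leq_trans vN.
  exact: (leq_bigmax j).
have h1 := exhaust_ccvg eventually_filter sm hs ex.
have h2 := diff_by_parts HB0 B0A KA Cq0 qC hu y (fintype.subxx K).
rewrite -[s]add0r.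
apply: eq_ccvg (ccvgD h2 h1) => N /=; rewrite subrK; congr (_ * _).
apply: eq_bigr => v _; congr (_ * _); apply: eq_bigr => f _.
by rewrite /diff_fac finset.in_set0.
Qed.

Lemma smooth_has_sum y : exists s,
  has_sum (fun v => echar (dot y (realvec R v)) * diff_term A (qfac k) u K v) s.
Proof.
apply: abs_summable_has_sum_le smooth_bound _ => v.
by rewrite cnormM cnorm_echar mul1r.
Qed.

Lemma smooth_continuous (T : Type) (F : set_system T) (FF : ProperFilter F)
    (yy : T -> 'rV[R]_r) y (s : T -> R[i]) s0 :
  (forall v, (fun x => dot (yy x) (realvec R v)) @ F --> dot y (realvec R v)) ->
  (forall x, has_sum (fun v => echar (dot (yy x) (realvec R v))
     * diff_term A (qfac k) u K v) (s x)) ->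
  has_sum (fun v => echar (dot y (realvec R v)) * diff_term A (qfac k) u K v) s0 ->
  ccvg F s s0.
Proof.
move=> yc hs hs0; apply: (dominated_ccvg _ smooth_bound _ _ hs0).
- apply: filterE => x; split; last exact: hs.
  by move=> v; rewrite cnormM cnorm_echar mul1r.
- move=> v; apply: ccvgM; last exact: ccvg_cst.
  exact: ccvg_echar.
Qed.

End Parts.

End Smooth.

Section Quotient.
Context {R : realType} {r : nat} {L : {fset 'rV[int]_r * R[i]}}.
Context (B : {set L}) (HB : B \in bases L).
Implicit Types (v w l : 'rV[int]_r).

Definition coset_of v : set 'rV[int]_r := [set v + l | l in lattice B].

Lemma lattice0 : lattice B 0.
Proof. by exists (fun=> 0); rewrite big1 // => f _; rewrite mulr0z. Qed.

Lemma latticeD v w : lattice B v -> lattice B w -> lattice B (v + w).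
Proof.
move=> [a ->] [b ->]; exists (fun f => a f + b f).
by rewrite -big_split; apply: eq_bigr => f _; rewrite mulrzDr.
Qed.

Lemma latticeN v : lattice B v -> lattice B (- v).
Proof.
move=> [a ->]; exists (fun f => - a f).
by rewrite -sumrN; apply: eq_bigr => f _; rewrite mulrNz.
Qed.

Lemma coset_eq v w : lattice B (v - w) -> coset_of v = coset_of w.
Proof.
move=> vw; apply/seteqP; split=> z [l ll <-].
  by exists (v - w + l); [exact: latticeD | rewrite addrA addrCA subrr addr0].
exists (w - v + l); last by rewrite addrA addrCA subrr addr0.
by apply: latticeD => //; rewrite -opprB; exact: latticeN.
Qed.

Lemma coset_repr v : exists2 l, lattice B l & xget 0 (coset_of v) = v + l.
Proof.
have : coset_of v (xget 0 (coset_of v)).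
  by apply: (@xgetI _ _ _ v); exists 0; [exact: lattice0 | rewrite addr0].
by move=> [l ll <-]; exists l.
Qed.

Lemma realvec_lattice (a : L -> int) :
  realvec R (\sum_(f in B) ivec f *~ a f) = \sum_(f in B) (a f)%:~R *: vec f.
Proof.
apply/rowP => j; rewrite mxE !summxE rmorph_sum /=; apply: eq_bigr => f _.
rewrite !mxE; case: (a f) => n.
  by rewrite -pmulrn mulmxnE rmorphMn /= mulr_natl.
rewrite NegzE !mulrNz mxE rmorphN /= mulNr; congr (- _).
by rewrite -pmulrn mulmxnE rmorphMn /= mulr_natl.
Qed.

(** [D] times any integer vector lies in the lattice, so every coset has a representative with
    coordinates between 0 and [D - 1]. *)
Lemma finite_quot : finite_set (quot B).
Proof.
have [D [u [D0 uD]]] := dual_int HB.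
have latD v : lattice B (v *~ Posz D).
  exists (fun f => idot v (u f)); apply: (@realvec_inj R).
  rewrite realvec_lattice [LHS](dual_expand HB); apply: eq_bigr => f fB.
  congr (_ *: _); rewrite -(dot_realvec (R := R)) uD // dotZr.
  have -> : realvec R (v *~ D) = D%:R *: realvec R v.
    by apply/rowP => j; rewrite !mxE -!pmulrn mulmxnE rmorphMn /= mulr_natl.
  by rewrite dotZl.
apply: sub_finite_set (finite_image coset_of (finite_fset (vbox D))) => c [v _ <-].
exists (\row_j modz (v 0%R j) D).
  rewrite /= mem_vbox; apply/forallP => j; rewrite mxE.
  have := ltz_pmod (v 0 j) (_ : 0 < Posz D).
  by have := modz_ge0 (v 0 j) (_ : Posz D != 0); move: D0; clear; lia.
apply: coset_eq.
have -> : \row_j modz (v 0%R j) D - v = (- \row_j divz (v 0%R j) D) *~ Posz D.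
  apply/rowP => j; rewrite -pmulrn mulmxnE !mxE [in X in _ - X](divz_eq (v 0 j) D).
  by rewrite -mulr_natr natz; ring.
exact: latD.
Qed.

Lemma card_quot_neq0 : (#|` fset_set (quot B)|%:R : R[i]) != 0.
Proof.
rewrite pnatr_eq0 cardfs_eq0; apply/eqP => h.
have : coset_of 0 \in fset_set (quot B).
  by rewrite in_fset_set; [rewrite inE; exists 0 | exact: finite_quot].
by rewrite h.
Qed.

Lemma sum_quotE (V : nmodType) (F : set 'rV[int]_r -> V) :
  \sum_(c \in quot B) F c = \sum_(c <- fset_set (quot B)) F c.
Proof. by rewrite fsbig_finite //; exact: finite_quot. Qed.

(** Orthogonality of characters: [x] defines a character of [Z^r / <B>], trivial exactly when [x] is
    integral. Otherwise translation by a unit vector with nontrivial value permutes the cosets and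
    multiplies the sum by that value. *)
Lemma sum_quot_char (x : 'rV[R]_r) :
  (forall f, f \in B -> exists n : int, dot (vec f) x = n%:~R) ->
  \sum_(c <- fset_set (quot B)) echar (dot (realvec R (xget 0 c)) x) =
  if `[< range (@realvec R r) x >] then #|` fset_set (quot B)|%:R else 0.
Proof.
move=> xB; pose chi v := echar (dot (realvec R v) x).
have chiD v w : chi (v + w) = chi v * chi w by rewrite /chi realvecD dotDl echarD.
have chil l : lattice B l -> chi l = 1.
  move=> [a ->]; rewrite /chi realvec_lattice dot_suml.
  have [n Hn] : exists n : int, \sum_(f in B) dot ((a f)%:~R *: vec f) x = n%:~R.
    elim/big_rec: _ => [|f z fB [n ->]]; first by exists 0.
    have [m Hm] := xB f fB; exists (a f * m + n).
    by rewrite dotZl Hm intrD intrM.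
  by rewrite Hn echar_int.
have chic v : chi (xget 0 (coset_of v)) = chi v.
  by have [l ll ->] := coset_repr v; rewrite chiD (chil _ ll) mulr1.
case: asboolP => [[v _ vx]|nx].
  rewrite (eq_big_seq (fun=> 1)) => [|c _]; last by rewrite -vx dot_realvec echar_int.
  by rewrite big_const_seq count_predT cardfE -Monoid.iteropE.
have [j Hj] : exists j, echar (x 0 j) != 1.
  apply: contrapT => h; apply: nx.
  have h' j : exists n : int, x 0 j = n%:~R.
    apply: echar_eq1; apply: contrapT => /eqP h'; apply: h; by exists j.
  have [n Hn] := choice h'; exists (\row_j n j) => //.
  by apply/rowP => j; rewrite !mxE Hn.
pose e : 'rV[int]_r := delta_mx 0 j.
have chie : chi e = echar (x 0 j).
  rewrite /chi dotC; have -> : realvec R e = delta_mx 0 j; last by rewrite dot_delta.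
  by apply/rowP => i; rewrite !mxE; case: (_ && _).
pose tau (c : set 'rV[int]_r) : set 'rV[int]_r := [set z | c (z - e)].
have tau_inj : injective tau.
  move=> c c' cc; apply/funext => z.
  have := congr1 (fun s : set _ => s (z + e)) cc.
  by rewrite /tau /= addrK.
have tauE v : tau (coset_of v) = coset_of (v + e).
  apply/seteqP; split=> z; rewrite /tau /=.
    by move=> [l ll zl]; exists l => //; rewrite addrAC zl subrK.
  by move=> [l ll <-]; exists l => //; rewrite addrAC addrK.
have fq := finite_quot.
have tauQ : (tau @` fset_set (quot B))%fset = fset_set (quot B).
  apply/eqP; rewrite eqEfcard card_imfset //= leqnn andbT.
  apply/fsubsetP => c /imfsetP[c' /= + ->]; rewrite !in_fset_set // !inE.
  by move=> [v _ <-]; exists (v + e) => //; exact: esym (tauE v).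
set S := LHS; have : S = echar (x 0 j) * S.
  rewrite {1}/S -tauQ big_imfset /=; last by move=> c c' _ _; apply: tau_inj.
  rewrite /S mulr_sumr; apply: eq_big_seq => c; rewrite in_fset_set // inE => -[v _ <-].
  by rewrite -/(coset_of v) tauE -/(chi _) -/(chi _) !chic chiD chie mulrC.
move=> /eqP; rewrite -subr_eq0 -{1}[S]mul1r -mulrBl mulf_eq0 subr_eq0.
by rewrite eq_sym (negbTE Hj) /= => /eqP.
Qed.

End Quotient.

(** * A single basis *)

Section Coefficients.
Context {R : realType}.

Definition ecoef (b : R[i]) : R -> nat -> R[i] := sval (cid (pole_series b)).

Lemma ecoef_taylor (b : R[i]) al : exists K M : R, [/\ 0 <= K, 1 <= M,
  forall k, cnorm (ecoef b al k) <= K * M ^+ k &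
  forall t, cnorm t * (2 * M) <= 1 -> cexp (t - twopii R * b) != 1 ->
    has_sum (fun k => ecoef b al k * t ^+ k) (pole_fun b al t)].
Proof. by rewrite /ecoef; case: cid => e [/= h _ _]; apply: h. Qed.

Lemma ccvg_ecoef (b : R[i]) (T : Type) (F : set_system T) (FF : Filter F)
    (u : T -> R) al k :
  u @ F --> al -> ccvg F (fun x => ecoef b (u x) k) (ecoef b al k).
Proof. by rewrite /ecoef; case: cid => e [/= _ h _]; apply: h. Qed.

(** A difference of step [D] telescopes into [D] shifted differences of step 1. Larger steps occur
    because the dual vectors become integral only after multiplication by [D]. *)
Lemma has_sum_pole_term (b : R[i]) al k (D : nat) : 0 < al < 1 ->
  has_sum (pole_term b al (Posz D) k) ((1 - echar (D%:R * al)) * ecoef b al k).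
Proof.
move=> al01; have h1 : has_sum (pole_term b al 1 k) ((1 - echar al) * ecoef b al k).
  by rewrite /ecoef; case: cid => e [/= _ _ h]; apply: h.
elim: D => [|D IH].
  rewrite mul0r echar0 subrr mul0r; apply: eq_has_sum has_sum_cst0 => n.
  by rewrite /pole_term subr0 subrr mulr0.
have s1 : has_sum (fun n : int => pole_term b al 1 k (n - Posz D)) ((1 - echar al) * ecoef b al k).
  apply: (@has_sum_comp _ _ _ (fun n : int => n - Posz D) _ (pole_term b al 1 k)) h1.
  - exact: addIr.
  - exact: pole_term_summable.
  - by move=> n []; exists (n + Posz D) => //=; rewrite addrK.
have -> : (1 - echar (D.+1%:R * al)) * ecoef b al k =
    (1 - echar (D%:R * al)) * ecoef b al k +
    echar (D%:R * al) * ((1 - echar al) * ecoef b al k).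
  by have -> : D.+1%:R * al = D%:R * al + al; [rewrite -natr1 mulrDl mul1r | rewrite echarD; ring].
apply: eq_has_sum (has_sumD IH (has_sumZ (echar (D%:R * al)) s1)) => n.
rewrite /pole_term mulrA -echarD.
have -> : D%:R * al + (n - Posz D)%:~R * al = n%:~R * al.
  by rewrite intrD rmorphN /= mulrDl -pmulrn mulNr addrCA subrr addr0.
have -> : n - Posz D - 1 = n - Posz D.+1 by clear; lia.
by ring.
Qed.

End Coefficients.

Section Base.
Context {R : realType} {r : nat} {L : {fset 'rV[int]_r * R[i]}} (phi : 'rV[R]_r).
Implicit Types (f g : L) (A B : {set L}) (v w : 'rV[int]_r) (k : {ffun L -> nat}).
Implicit Types (y : 'rV[R]_r).

Lemma yfrac_shift y B f : exists n : int, yfrac phi y B f = dot y (dual B f) + n%:~R.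
Proof.
rewrite /yfrac /frac; case: ifP => _.
  by exists (- Num.floor (dot y (dual B f))); rewrite rmorphN.
exists (1 + Num.floor (- dot y (dual B f))); rewrite intrD.
by rewrite opprB opprK [in LHS]addrCA [_%:~R + _]addrC; ring.
Qed.

Lemma yfrac_itv y B f : 0 <= yfrac phi y B f <= 1.
Proof.
rewrite /yfrac; have := frac_ge0 (dot y (dual B f)); have := frac_lt1 (dot y (dual B f)).
have := frac_ge0 (- dot y (dual B f)); have := frac_lt1 (- dot y (dual B f)).
by case: ifP => _; lra.
Qed.

Lemma echar_yfrac (n : int) y B f :
  echar (n%:~R * yfrac phi y B f) = echar (n%:~R * dot y (dual B f)).
Proof. by have [m ->] := yfrac_shift y B f; rewrite mulrDr -intrM echarDint. Qed.

Definition base_coef B y k : R[i] :=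
  (\prod_(f : L | f \notin B) (k f == 0%N)%:R) *
  ((#|` fset_set (quot B)|%:R)^-1 * \sum_(c <- fset_set (quot B))
     \prod_(f in B) ecoef (off f) (yfrac phi (y + realvec R (xget 0 c)) B f) (k f)).

Context (D : nat) (u : {set L} -> L -> 'rV[int]_r).
Hypothesis (uD : forall B f, B \in bases L -> f \in B ->
  realvec R (u B f) = D%:R *: dual B f).

(** As [u B f] is [D f^B], this asks that [D <y, f^B>] be non-integral, a condition unaffected by
    integral translations of [y], so that it holds for all cosets simultaneously. *)
Definition nonintegral y : Prop := forall B f, B \in bases L -> f \in B ->
  echar (dot y (realvec R (u B f))) != 1.

Lemma echar_dual y v B f : B \in bases L -> f \in B ->
  echar (D%:R * dot (y + realvec R v) (dual B f)) = echar (dot y (realvec R (u B f))).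
Proof.
move=> HB fB; rewrite -dotZr -uD // dotDl dot_realvec.
exact: echarDint.
Qed.

Lemma nonintegral_yfrac y v B f : nonintegral y -> B \in bases L -> f \in B ->
  0 < yfrac phi (y + realvec R v) B f < 1.
Proof.
move=> yn HB fB; have := yn B f HB fB; rewrite -(echar_dual y v HB fB) => h.
have nint (m : int) : yfrac phi (y + realvec R v) B f != m%:~R.
  apply: contra h => /eqP h; apply/eqP.
  by rewrite [D%:R]pmulrn -echar_yfrac h -intrM echar_int.
have := yfrac_itv (y + realvec R v) B f; rewrite !le_eqVlt => /andP[].
by rewrite eq_sym (negbTE (nint 0)) (negbTE (nint 1)) /= => -> ->.
Qed.

Section OneBasis.
Context (B : {set L}) (HB : B \in bases L) (k : {ffun L -> nat}) (y : 'rV[R]_r).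
Hypothesis yn : nonintegral y.

Let Q := fset_set (quot B).
Let coords v : {ffun L -> int} := [ffun f => if f \in B then lval f v else 0].
Let al c f : R := yfrac phi (y + realvec R (xget 0 c)) B f.
Let a c f (n : int) : R[i] :=
  if f \in B then pole_term (off f) (al c f) (Posz D) (k f) n else (n == 0)%:R.
(** The one-dimensional series of the [f] in [B] are multiplied over independent integers [n f];
    averaging over the cosets retains exactly the tuples of values of a vector of [Z^r]. *)
Let G (n : {ffun L -> int}) : R[i] :=
  (#|` Q|%:R)^-1 * \sum_(c <- Q) \prod_f a c f (n f).

Lemma factor_summable c f : abs_summable (a c f).
Proof.
rewrite /a; case: (f \in B); first exact: pole_term_summable.
apply: bounded_sums_le (bounded_sums_delta 0) => n.
by case: eqP => _; rewrite ?cnorm1 ?cnorm0.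
Qed.

Lemma factor_has_sum c f : has_sum (a c f) (if f \in B then
  (1 - echar (dot y (realvec R (u B f)))) * ecoef (off f) (al c f) (k f) else 1).
Proof.
rewrite /a; case: (boolP (f \in B)) => fB.
  have := has_sum_pole_term (off f) (k f) D (nonintegral_yfrac (xget 0 c) yn HB fB).
  by rewrite [D%:R]pmulrn echar_yfrac -pmulrn echar_dual.
rewrite [X in has_sum _ X]
  (_ : 1 = \sum_(n <- [fset (0 : int)]%fset) ((n == 0)%:R : R[i])); last first.
  by rewrite big_seq_fset1 eqxx.
by apply: has_sum_fin => n; rewrite inE => /negbTE ->.
Qed.

Lemma coset_average_summable : abs_summable G.
Proof.
have c0 : 0 <= cnorm ((#|` Q|%:R : R[i])^-1) by apply: cnorm_ge0.
have h c : bounded_sums (fun n : {ffun L -> int} => cnorm (\prod_f a c f (n f))).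
  by apply: abs_summable_prod; apply: factor_summable.
apply: bounded_sums_le (bounded_sumsZ c0 (bounded_sums_sum Q h)) => n.
by rewrite /G cnormM ler_wpM2l // cnorm_sum.
Qed.

Lemma coset_average_has_sum : has_sum G ((\prod_(f in B) (1 - echar (dot y (realvec R (u B f))))) *
  ((#|` Q|%:R)^-1 * \sum_(c <- Q) \prod_(f in B) ecoef (off f) (al c f) (k f))).
Proof.
have h c := has_sum_prod (factor_summable c) (factor_has_sum c).
rewrite mulrCA mulr_sumr; apply: has_sumZ.
apply: has_sum_sum => c _.
have -> : \prod_(f in B) (1 - echar (dot y (realvec R (u B f)))) *
    \prod_(f in B) ecoef (off f) (al c f) (k f) = \prod_f (if f \in B then
  (1 - echar (dot y (realvec R (u B f)))) * ecoef (off f) (al c f) (k f) else 1).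
  by rewrite -big_split /= big_mkcond.
exact: h.
Qed.

Lemma coset_averageE (n : {ffun L -> int}) : G n =
  (\prod_(f : L | f \notin B) (n f == 0)%:R) *
  (\prod_(f in B) (echar ((n f)%:~R * dot y (dual B f)) *
     (qfac k f (n f) - qfac k f (n f - Posz D)))) *
  ((#|` Q|%:R)^-1 * \sum_(c <- Q)
     echar (dot (realvec R (xget 0 c)) (\sum_(f in B) (n f)%:~R *: dual B f))).
Proof.
rewrite /G [RHS]mulrCA; congr (_ * _); rewrite mulr_sumr; apply: eq_bigr => c _.
rewrite (bigID (mem B)) /= mulrC [RHS]mulrAC -mulrA; congr (_ * _).
  by apply: eq_bigr => f /negbTE fB; rewrite /a fB.
rewrite dot_sumr.
have -> : echar (\sum_(f in B) dot (realvec R (xget 0 c)) ((n f)%:~R *: dual B f)) =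
   \prod_(f in B) echar ((n f)%:~R * dot (realvec R (xget 0 c)) (dual B f)).
  by elim/big_rec2: _ => [|f x z _ <-]; [exact: echar0 | rewrite echarD dotZr].
rewrite -big_split /=; apply: eq_bigr => f fB; rewrite /a fB /pole_term /al.
by rewrite echar_yfrac dotDl [_%:~R * (_ + _)]mulrDr echarD /qfac; ring.
Qed.

Lemma coords_inj : injective coords.
Proof.
move=> v w /ffunP vw; apply: (lval_inj HB) => f fB.
by have := vw f; rewrite !ffunE fB.
Qed.

Lemma dot_vec_dual_sum (n : {ffun L -> int}) f : f \in B ->
  dot (vec f) (\sum_(g in B) (n g)%:~R *: dual B g) = (n f)%:~R.
Proof.
move=> fB; rewrite dot_sumr (bigD1 f fB) /= dotZr (dualE HB) // eqxx mulr1.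
rewrite big1 ?addr0 // => g /andP[gB gf].
by rewrite dotZr (dualE HB) // eq_sym (negbTE gf) mulr0.
Qed.

Lemma coset_average_coords v : G (coords v) = echar (dot y (realvec R v)) *
  diff_term B (qfac k) (u B) B v.
Proof.
have lD f : f \in B -> lval f (u B f) = Posz D.
  move=> fB; apply/eqP; rewrite -(eqr_int R) -dot_vec uD // dotZr (dualE HB) //.
  by rewrite eqxx mulr1.
rewrite coset_averageE big1 => [|f fB]; last by rewrite ffunE (negbTE fB).
rewrite mul1r sum_quot_char //; last first.
  by move=> f fB; exists (coords v f); apply: dot_vec_dual_sum.
case: asboolP => [_|]; last first.
  case; exists v => //; apply: (dual_unique HB) => f fB.
  by rewrite dot_vec dot_vec_dual_sum // ffunE fB.
rewrite mulVf ?card_quot_neq0 // mulr1 big_split /=; congr (_ * _).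
  rewrite (dot_dual HB); elim/big_rec2: _ => [|f x z fB ->]; first by rewrite echar0.
  by rewrite echarD dot_vec ffunE fB mulrC [_ * (dot y _)]mulrC mulrC.
by apply: eq_bigr => f fB; rewrite ffunE fB /diff_fac fB lD.
Qed.

Lemma coset_average_out n : ~ range coords n -> G n = 0.
Proof.
move=> nr; rewrite coset_averageE.
have [/existsP[f /andP[fB nf]]|] := boolP [exists f : L, (f \notin B) && (n f != 0)].
  by rewrite (bigD1 f fB) /= (negbTE nf) !mul0r.
rewrite negb_exists => /forallP h.
rewrite sum_quot_char //; last by move=> f fB; exists (n f); apply: dot_vec_dual_sum.
case: asboolP => [[v _ vn]|_]; last by rewrite !mulr0.
case: nr; exists v => //; apply/ffunP => f; rewrite ffunE.
case: (boolP (f \in B)) => fB.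
  by apply/eqP; rewrite -(eqr_int R) -dot_vec vn dot_vec_dual_sum.
by have := h f; rewrite fB /= negbK => /eqP ->.
Qed.

(** The sum of [G] is known from one-dimensional sums; read on [Z^r] it is the sum differenced along
    all of [B], and the factors [1 - e(<y, u f>)] can be divided out because [y] is
    [nonintegral]. *)
Lemma base_ccvg : ccvg \oo (Zpart B k y) (base_coef B y k).
Proof.
have lval0 f g : f \in B -> g \in B -> g != f -> lval g (u B f) = 0.
  move=> fB gB gf; apply/eqP; rewrite -(eqr_int R) -dot_vec uD // dotZr (dualE HB) //.
  by rewrite (negbTE gf) mulr0.
have hs := has_sum_comp coords_inj coset_average_summable coset_average_out coset_average_has_sum.
have {}hs := eq_has_sum coset_average_coords hs.
have hm f : f \in B -> f \notin B -> k f = 1%N ->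
    exists B', [/\ B' \in bases L, B' \subset B & f \notin B'] by move=> ->.
have := smooth_ccvg HB (fintype.subxx B) (fintype.subxx B) lval0 hm hs.
set p := \prod_(f in B) _ => h; have p0 : p != 0.
  by apply/prodf_neq0 => f fB; rewrite subr_eq0 eq_sym; apply: yn.
rewrite /base_coef; apply: ccvgMl.
rewrite -/Q -[X in ccvg _ _ X](mulKf p0).
by apply: eq_ccvg (ccvgMl p^-1 h) => N /=; rewrite mulKf.
Qed.

End OneBasis.

End Base.

(** * One-sided limits in a generic direction *)

Section RightLimits.
Context {R : realType}.

Lemma near_right (e0 : R) (P : R -> Prop) : 0 < e0 ->
  (forall e, 0 < e < e0 -> P e) -> \forall e \near 0^'+, P e.
Proof.
move=> e00 H; near=> e; apply: H; apply/andP; split; near: e.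
  exact: nbhs_right_gt.
exact: nbhs_right_lt.
Unshelve. all: by end_near. Qed.

Lemma frac_right_near (a p : R) : 0 <= p ->
  \forall e \near 0^'+, frac (a + e * p) = frac a + e * p.
Proof.
move=> p0; have f1 := frac_lt1 a; have p1 : 0 < p + 1 by lra.
apply: (@near_right ((1 - frac a) / (p + 1))).
  by rewrite divr_gt0 // subr_gt0.
move=> e /andP[e0]; rewrite ltr_pdivlMr // => ep.
have ep0 : 0 <= e * p by rewrite mulr_ge0 // ltW.
have h : Num.floor (a + e * p) = Num.floor a.
  apply: floor_def; rewrite intrD; move: ep f1 (frac_ge0 a); rewrite /frac mulrDr mulr1.
  by set x := (Num.floor a)%:~R => *; apply/andP; split; lra.
by rewrite /frac h addrAC.
Qed.

Lemma cvg_right_lin (a p : R) : a + e * p @[e --> 0^'+] --> a.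
Proof.
apply/cvgrPdist_lt => d d0; have p1 : 0 < `|p| + 1 by rewrite ltr_wpDl.
apply: (@near_right (d / (`|p| + 1))); first by rewrite divr_gt0.
move=> e /andP[e0]; rewrite ltr_pdivlMr // mulrDr mulr1 => ed.
by rewrite opprD addNKr normrN normrM gtr0_norm //; lra.
Qed.

Lemma frac_right_cvg (a p : R) : 0 <= p ->
  frac (a + e * p) @[e --> 0^'+] --> frac a.
Proof.
move=> p0; apply/cvgrPdist_lt => d d0.
have /cvgrPdist_lt/(_ d d0) h := @cvg_right_lin (frac a) p.
by apply: filterS2 (frac_right_near a p0) h => e ->.
Qed.

Lemma echar_right_neq1 (a p : R) : p != 0 ->
  \forall e \near 0^'+, echar (a + e * p) != 1.
Proof.
have key (a' p' : R) : 0 < p' -> \forall e \near 0^'+, echar (a' + e * p') != 1.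
  move=> p0; have p0' := ltW p0; near=> e.
  have e0 : 0 < e by near: e; exact: nbhs_right_gt.
  have h : frac (a' + e * p') = frac a' + e * p' by near: e; exact: frac_right_near.
  apply/eqP => /echar_eq1[n hn].
  have : 0 < frac (a' + e * p') by rewrite h ltr_wpDl ?frac_ge0 // mulr_gt0.
  by rewrite hn /frac intrKfloor subrr ltxx.
case: (ltgtP p 0) => // p0 _; last exact: key.
apply: filterS (key (- a) (- p) _) => [e|]; last by rewrite oppr_gt0.
by rewrite mulrN -opprD echarN invr_eq1.
Unshelve. all: by end_near. Qed.

End RightLimits.

Section Generic.
Context {R : realType} {r : nat} {L : {fset 'rV[int]_r * R[i]}} (phi : 'rV[R]_r).
Implicit Types (f g : L) (A B : {set L}) (v w : 'rV[int]_r) (k : {ffun L -> nat}).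
Implicit Types (y : 'rV[R]_r).

(** The case distinction in [yfrac] serves this purpose: when [<phi, f^B>] is not positive, the
    coordinate [a] does not increase along [phi], and [1 - {-a}] is the version of the fractional
    part that is continuous from the left. *)
Lemma ccvg_yfrac y B f :
  yfrac phi (y + e *: phi) B f @[e --> 0^'+] --> yfrac phi y B f.
Proof.
rewrite /yfrac; case: ltP => p0.
  under eq_fun do rewrite dotDl dotZl.
  by apply: frac_right_cvg; apply: ltW.
under eq_fun do rewrite dotDl dotZl [- (dot _ _ + _)]opprD -mulrN.
by apply: cvgB; [exact: cvg_cst | apply: frac_right_cvg; rewrite oppr_ge0].
Qed.

Lemma base_coef_right B y k :
  ccvg 0^'+ (fun e => base_coef phi B (y + e *: phi) k) (base_coef phi B y k).
Proof.
rewrite /base_coef; apply: ccvgMl; apply: ccvgMl; apply: ccvg_sum => c _.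
apply: ccvg_prod => f fB; apply: ccvg_ecoef.
by under eq_fun do rewrite addrAC; apply: ccvg_yfrac.
Qed.

Lemma free_setD1 B f : B \in bases L -> f \in B ->
  free [seq vec g | g <- enum (B :\ f)].
Proof.
rewrite inE => /andP[_ /basis_free + fB].
rewrite (perm_free (Y := [seq vec g | g <- f :: enum (B :\ f)])).
  by rewrite /= free_cons => /andP[].
apply: perm_map; apply: uniq_perm; rewrite /= ?enum_uniq ?mem_enum ?andbT //.
  by rewrite !inE eqxx.
by move=> g; rewrite in_cons !mem_enum !inE; case: eqVneq => //= ->.
Qed.

(** If this product vanished, the expansion of [phi] in [B] would omit [f] and put [phi] in the
    hyperplane of [B :\ f]. *)
Lemma generic_dual B f : generic L phi -> B \in bases L -> f \in B ->
  dot phi (dual B f) != 0.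
Proof.
move=> gp HB fB; have [Br Bs] := (basesP B).1 HB.
have card1 : #|B :\ f|.+1 = r by apply: etrans Br; rewrite (cardsD1 f B) fB.
have fr := free_setD1 HB fB.
apply/eqP => h; apply: (gp (B :\ f)).
  by rewrite inE card1 eqxx fr.
split.
  by rewrite /gen_rank free_rat // -cardE.
apply/span_vecP; exists (fun g => dot phi (dual B g)).
by rewrite {1}[phi](dual_expand HB) (big_setD1 f fB) /= h scale0r add0r.
Qed.

Context (D : nat) (u : {set L} -> L -> 'rV[int]_r).
Hypotheses (D0 : (0 < D)%N) (uD : forall B f, B \in bases L -> f \in B ->
  realvec R (u B f) = D%:R *: dual B f).
Hypothesis gp : generic L phi.

Lemma nonintegral_right y : \forall e \near 0^'+, nonintegral u (y + e *: phi).
Proof.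
pose P (p : {set L} * L) (e : R) : Prop := p.1 \in bases L -> p.2 \in p.1 ->
  echar (dot (y + e *: phi) (realvec R (u p.1 p.2))) != 1.
have H p : \forall e \near 0^'+, P p e.
  case: (boolP (p.1 \in bases L)) => [HB|nB]; last first.
    by apply: filterE => e; rewrite /P (negbTE nB).
  case: (boolP (p.2 \in p.1)) => [fB|nB]; last first.
    by apply: filterE => e; rewrite /P (negbTE nB).
  apply: filterS (echar_right_neq1 (dot y (realvec R (u p.1 p.2)))
     (p := dot phi (realvec R (u p.1 p.2))) _) => [e h _ _|].
    by rewrite dotDl dotZl.
  by rewrite uD // dotZr mulf_neq0 ?generic_dual // pnatr_eq0 -lt0n.
have h := @filter_forall R _ P 0^'+ _ H.
apply: filterS (h _) => e {}h B f HB fB.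
exact: (h (B, f)).
Qed.

End Generic.

(** One [D] for all bases, the product of the individual ones, lets the same condition [nonintegral]
    serve every basis. *)
Lemma common_dual (R : realType) (r : nat) (L : {fset 'rV[int]_r * R[i]}) :
  exists (D : nat) (u : {set L} -> L -> 'rV[int]_r), (0 < D)%N /\
  forall B f, B \in bases L -> f \in B -> realvec R (u B f) = D%:R *: dual B f.
Proof.
have /choice[d Hd] (B : {set L}) : exists D : nat, (0 < D)%N /\ (B \in bases L ->
    exists u : L -> 'rV[int]_r,
    forall f, f \in B -> realvec R (u f) = D%:R *: dual B f).
  case: (boolP (B \in bases L)) => HB; last by exists 1%N.
  by have [D [u [D0 uD]]] := dual_int HB; exists D; split=> // _; exists u.
exists (\prod_B d B)%N.
have /choice[u Hu] (B : {set L}) : exists u : L -> 'rV[int]_r, forall f,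
    B \in bases L -> f \in B -> realvec R (u f) = (\prod_B d B)%N%:R *: dual B f.
  case: (boolP (B \in bases L)) => HB; last by exists (fun=> 0).
  have [u Hu] := (Hd B).2 HB.
  exists (fun f => u f *+ (\prod_(B' | B' != B) d B')%N) => f _ fB.
  have -> : (\prod_B d B = (\prod_(B' | B' != B) d B') * d B)%N by rewrite (bigD1 B) //= mulnC.
  rewrite natrM -scalerA -Hu //.
  by apply/rowP => j; rewrite !mxE mulmxnE rmorphMn /= mulr_natl.
exists u; split; first by apply: prodn_gt0 => B; case: (Hd B).
by move=> B f; apply: Hu.
Qed.

(** * Power series in several variables *)

Section PowerSeries.
Context {R : realType} {T : finType}.
Implicit Types (k : {ffun T -> nat}) (t : {ffun T -> R[i]}) (h : T).

Definition deg k : nat := \sum_f k f.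

Definition mono t k : R[i] := \prod_f t f ^+ k f.

Definition kup k h : {ffun T -> nat} := [ffun f => k f + (f == h)]%N.
Definition kdown k h : {ffun T -> nat} := [ffun f => k f - (f == h)]%N.

Lemma kupK h : cancel (kup^~ h) (kdown^~ h).
Proof. by move=> k; apply/ffunP => f; rewrite !ffunE addnK. Qed.

Lemma kdownK k h : (0 < k h)%N -> kup (kdown k h) h = k.
Proof.
move=> kh; apply/ffunP => f; rewrite !ffunE.
by case: eqVneq => [->|_]; rewrite ?addn0 ?subn0 // subnK.
Qed.

Lemma mono_kup t k h : mono t (kup k h) = t h * mono t k.
Proof.
rewrite /mono (bigD1 h) //= [in RHS](bigD1 h) //= !ffunE eqxx addn1 exprS -mulrA.
congr (_ * (_ * _)); apply: eq_bigr => f fh.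
by rewrite ffunE (negbTE fh) addn0.
Qed.

Lemma deg_kup k h : deg (kup k h) = (deg k).+1.
Proof.
rewrite /deg (bigD1 h) //= [in RHS](bigD1 h) //= !ffunE eqxx addn1 addSn; congr (_ + _).+1.
by apply: eq_bigr => f fh; rewrite ffunE (negbTE fh) addn0.
Qed.

Lemma deg_kdown k h : (0 < k h)%N -> (deg (kdown k h)).+1 = deg k.
Proof. by move=> kh; rewrite -(deg_kup _ h) kdownK. Qed.

Lemma prod_expr_deg (M : R) k : \prod_f M ^+ k f = M ^+ deg k.
Proof. by rewrite /deg; elim/big_rec2: _ => [|f x z _ ->]; rewrite ?expr0 // exprD. Qed.

Lemma deg_summable (c : {ffun T -> nat} -> R[i]) (K M : R) t :
  0 <= K -> 0 <= M -> (forall k, cnorm (c k) <= K * M ^+ deg k) ->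
  (forall f, cnorm (t f) * (2 * M) <= 1) -> abs_summable (fun k => c k * mono t k).
Proof.
move=> K0 M0 cK tM.
have g0 f : 0 <= M * cnorm (t f) by rewrite mulr_ge0 // cnorm_ge0.
have hb f : bounded_sums (fun i => (M * cnorm (t f)) ^+ i).
  exists (1 - M * cnorm (t f))^-1 => J; apply: geometric_sum_le.
  by rewrite g0 /=; have := tM f; lra.
have hp := bounded_sums_prod (fun f i => exprn_ge0 i (g0 f)) hb.
apply: bounded_sums_le (bounded_sumsZ K0 hp) => k.
rewrite cnormM /mono cnorm_prod.
have -> : \prod_f (M * cnorm (t f)) ^+ k f = M ^+ deg k * \prod_f cnorm (t f ^+ k f).
  rewrite -prod_expr_deg -big_split /=; apply: eq_bigr => f _.
  by rewrite exprMn cnormX.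
by rewrite mulrA ler_wpM2r // prodr_ge0 // => f _; exact: cnorm_ge0.
Qed.

Lemma has_sum_kdown (X : {ffun T -> nat} -> R[i]) t h s :
  has_sum (fun k => X k * mono t k) s ->
  has_sum (fun k => (if (0 < k h)%N then X (kdown k h) else 0) * mono t k) (t h * s).
Proof.
move=> hs; apply: (has_sum_inj (h := kup^~ h)); first exact: can_inj (kupK h).
  move=> k nk; case: ifP => kh; last by rewrite mul0r.
  by case: nk; exists (kdown k h) => //; rewrite kdownK.
apply: eq_has_sum (has_sumZ (t h) hs) => k /=.
by rewrite ffunE eqxx addn1 /= kupK mono_kup mulrCA.
Qed.

End PowerSeries.

Section BaseTaylor.
Context {R : realType} {r : nat} {L : {fset 'rV[int]_r * R[i]}} (phi : 'rV[R]_r).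
Implicit Types (f g h : L) (A B : {set L}) (v w : 'rV[int]_r) (k : {ffun L -> nat}).
Implicit Types (y : 'rV[R]_r) (t : {ffun L -> R[i]}).

Definition base_fun B y t : R[i] :=
  (#|` fset_set (quot B)|%:R)^-1 * \sum_(c <- fset_set (quot B))
    \prod_(f in B) pole_fun (off f) (yfrac phi (y + realvec R (xget 0 c)) B f) (t f).

Lemma base_taylor B y : exists K M : R, [/\ 0 <= K, 1 <= M,
  forall k, cnorm (base_coef phi B y k) <= K * M ^+ deg k &
  forall t, (forall f, cnorm (t f) * (2 * M) <= 1) ->
    (forall f, f \in B -> cexp (tshift t f) != 1) ->
    has_sum (fun k => base_coef phi B y k * mono t k) (base_fun B y t)].
Proof.
pose Q := fset_set (quot B).
pose al c f : R := yfrac phi (y + realvec R (xget 0 c)) B f.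
pose a c f (n : nat) : R[i] := if f \in B then ecoef (off f) (al c f) n else (n == 0%N)%:R.
pose s c f (z : R[i]) : R[i] := if f \in B then pole_fun (off f) (al c f) z else 1.
have H c f : exists p : R * R, [/\ 0 <= p.1, 1 <= p.2,
    forall n, cnorm (a c f n) <= p.1 * p.2 ^+ n &
    forall z, cnorm z * (2 * p.2) <= 1 ->
      (f \in B -> cexp (z - twopii R * off f) != 1) ->
      has_sum (fun n => a c f n * z ^+ n) (s c f z)].
  rewrite /a /s; case: (boolP (f \in B)) => fB.
    have [K [M [K0 M1 hK hs]]] := ecoef_taylor (off f) (al c f).
    by exists (K, M); split=> // z zM zB; apply: hs => //; apply: zB.
  exists (1, 1); split=> //= [n|z _ _].
    by rewrite expr1n mulr1; case: eqP => _; rewrite ?cnorm1 ?cnorm0.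
  rewrite [X in has_sum _ X]
    (_ : 1 = \sum_(n <- [fset 0%N]%fset) ((n == 0%N)%:R * z ^+ n)); last first.
    by rewrite big_seq_fset1 eqxx mul1r.
  by apply: has_sum_fin => n; rewrite inE => /negbTE ->; rewrite mul0r.
have {}H c := choice (H c).
pose p c := projT1 (H c).
have Hp c f : [/\ 0 <= (p c f).1, 1 <= (p c f).2,
    forall n, cnorm (a c f n) <= (p c f).1 * (p c f).2 ^+ n &
    forall z, cnorm z * (2 * (p c f).2) <= 1 ->
      (f \in B -> cexp (z - twopii R * off f) != 1) ->
      has_sum (fun n => a c f n * z ^+ n) (s c f z)] by exact: projT2 (H c) f.
have p10 c f : 0 <= (p c f).1 by case: (Hp c f).
have p21 c f : 1 <= (p c f).2 by case: (Hp c f).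
have p20 c f : 0 <= (p c f).2 by apply: le_trans (p21 c f).
pose M : R := 1 + \sum_(c <- Q) \sum_f (p c f).2.
have Mp c f : c \in Q -> (p c f).2 <= M.
  move=> cQ; apply: le_trans (_ : \sum_(c <- Q) \sum_f (p c f).2 <= _); last by rewrite lerDr.
  apply: le_trans (_ : \sum_f (p c f).2 <= _).
    by rewrite (bigD1 f) //= lerDl sumr_ge0.
  have cQ' : ([fset c] `<=` Q)%fset by rewrite fsub1set.
  have := ler_sum_fset (b := fun c => \sum_f (p c f).2)
    (fun c => sumr_ge0 _ (fun f _ => p20 c f)) cQ'.
  by rewrite big_seq_fset1.
have M1 : 1 <= M by rewrite lerDl sumr_ge0 // => c _; apply: sumr_ge0.
have eqc k : base_coef phi B y k =
    (#|` Q|%:R)^-1 * \sum_(c <- Q) \prod_f a c f (k f).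
  rewrite /base_coef mulrCA mulr_sumr; congr (_ * _); apply: eq_bigr => c _.
  rewrite [RHS](bigID (mem B)) /= mulrC; congr (_ * _).
    by apply: eq_bigr => f fB; rewrite /a fB.
  by apply: eq_bigr => f /negbTE fB; rewrite /a fB.
exists (cnorm (#|` Q|%:R : R[i])^-1 * \sum_(c <- Q) \prod_f (p c f).1), M; split=> //.
- rewrite mulr_ge0 ?cnorm_ge0 // sumr_ge0 // => c _; exact: prodr_ge0.
- move=> k; rewrite eqc cnormM -mulrA ler_wpM2l ?cnorm_ge0 //.
  apply: le_trans (cnorm_sum _ _ _) _; rewrite mulr_suml big_seq [leRHS]big_seq.
  apply: ler_sum => c cQ; rewrite cnorm_prod -prod_expr_deg -big_split /=.
  apply: ler_prod => f _; rewrite cnorm_ge0 /=.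
  have [_ _ h _] := Hp c f; apply: le_trans (h _) _.
  rewrite ler_wpM2l //; apply: lerXn2r; rewrite ?nnegrE //; last exact: Mp.
  exact: le_trans M1.
- move=> t tM tB.
  have -> : base_fun B y t = (#|` Q|%:R)^-1 * \sum_(c <- Q) \prod_f s c f (t f).
    rewrite /base_fun; congr (_ * _); apply: eq_bigr => c _.
    by rewrite big_mkcond.
  have hc c : c \in Q -> has_sum (fun k => (\prod_f a c f (k f)) * mono t k)
      (\prod_f s c f (t f)).
    move=> cQ.
    have tp f : cnorm (t f) * (2 * (p c f).2) <= 1.
      apply: le_trans (tM f); rewrite ler_wpM2l ?cnorm_ge0 // ler_wpM2l //.
      exact: Mp.
    have h1 f : abs_summable (fun n => a c f n * t f ^+ n).
      have [q0 q1 h _] := Hp c f.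
      exists (2 * (p c f).1); exact: abs_summable_geom q0 (le_trans ler01 q1) h (tp f).
    have h2 f : has_sum (fun n => a c f n * t f ^+ n) (s c f (t f)).
      by have [q0 q1 _ h] := Hp c f; apply: h => // fB; apply: tB.
    apply: eq_has_sum (has_sum_prod h1 h2) => k.
    by rewrite /mono -big_split.
  rewrite [X in has_sum _ (_ * X)]big_seq.
  apply: eq_has_sum (has_sumZ _ (has_sum_sum Q hc)) => k.
  by rewrite eqc -mulrA mulr_suml [in RHS]big_seq.
Qed.

End BaseTaylor.

(** * Relations and division of power series *)

Section Circuit.
Context {R : realType} {r : nat} {L : {fset 'rV[int]_r * R[i]}}.
Implicit Types (f g h : L) (A B : {set L}) (v w : 'rV[int]_r) (k : {ffun L -> nat}).
Implicit Types (y : 'rV[R]_r) (t : {ffun L -> R[i]}).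

(** The fundamental circuit of [g] with respect to [B]. Exchanging [h] for [g] gives a basis
    whenever the coefficient of [h] is nonzero, so the induction stays among sets that contain a
    basis; the same coefficients express the denominator of [g] in the term of [B]. *)
Lemma circuit A B g : B \in bases L -> B \subset A -> g \in A -> g \notin B ->
  exists gam : L -> R, [/\ gam g = 1, \sum_h gam h *: vec h = 0,
    forall h, gam h != 0 -> h \in A /\ exists2 B', B' \in bases L & B' \subset A :\ h &
    forall t, den t B g = \sum_h (gam h)%:C * tshift t h].
Proof.
move=> HB BA gA gB.
pose gam h : R := if h == g then 1 else if h \in B then - dot (vec g) (dual B h) else 0.
have gamg : gam g = 1 by rewrite /gam eqxx.
have gamB h : h \in B -> gam h = - dot (vec g) (dual B h).
  by move=> hB; rewrite /gam hB; case: eqP hB gB => // -> ->.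
have sumgam (V : nmodType) (F : L -> V) : (forall h, h != g -> h \notin B -> F h = 0) ->
    \sum_h F h = F g + \sum_(h in B) F h.
  move=> F0; rewrite (bigD1 g) //=; congr (_ + _).
  rewrite [LHS](bigID (mem B)) /= [X in _ + X]big1 ?addr0; last first.
    by move=> h /andP[hg hB]; apply: F0.
  by apply: eq_bigl => h; case: eqP => // ->; rewrite (negbTE gB).
have gam0 h : h != g -> h \notin B -> gam h = 0.
  by move=> hg hB; rewrite /gam (negbTE hg) (negbTE hB).
exists gam; split=> //.
- rewrite sumgam => [|h hg hB]; last by rewrite gam0 // scale0r.
  rewrite gamg scale1r {1}[vec g](dual_expand HB) -big_split /= big1 // => h hB.
  by rewrite gamB // scaleNr subrr.
- move=> h; have [->|hg] := eqVneq h g.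
    move=> _; split=> //; exists B => //; apply/fintype.subsetP => f fB.
    by rewrite !inE (fintype.subsetP BA) // andbT; apply: contraNneq gB => <-.
  case: (boolP (h \in B)) => hB; last by rewrite gam0 // eqxx.
  rewrite gamB // oppr_eq0 => hd; split; first exact: (fintype.subsetP BA).
  exists (g |: (B :\ h)); first exact: exchange.
  apply/fintype.subsetP => f; rewrite !inE => /orP[/eqP ->|/andP[-> fB]].
    by rewrite gA andbT eq_sym.
  by rewrite (fintype.subsetP BA).
- move=> t; rewrite sumgam => [|h hg hB]; last by rewrite gam0 // mul0r.
  rewrite gamg mul1r /den -sumrN; congr (_ + _); apply: eq_bigr => h hB.
  by rewrite gamB // rmorphN /= mulNr mulrC.
Qed.

(** The subtracted part of [den] is linear in the vector of [h], hence annihilated by the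
    relation. *)
Lemma sum_den (gam : L -> R) B t : \sum_h gam h *: vec h = 0 ->
  \sum_h (gam h)%:C * den t B h = \sum_h (gam h)%:C * tshift t h.
Proof.
move=> g0; rewrite /den; under eq_bigr do rewrite mulrBr.
rewrite sumrB; apply/eqP; rewrite subr_eq addrC -subr_eq subrr eq_sym; apply/eqP.
under eq_bigr do rewrite mulr_sumr; rewrite exchange_big /= big1 // => f _.
under eq_bigr do rewrite mulrCA -rmorphM -dotZl.
by rewrite -mulr_sumr -rmorph_sum -dot_suml g0 dot0l mulr0.
Qed.

Lemma den_basis B t f : B \in bases L -> f \in B -> den t B f = 0.
Proof.
move=> HB fB; rewrite /den (bigD1 f fB) /= (dualE HB) // eqxx mulr1 big1 ?addr0 ?subrr //.
by move=> g /andP[gB gf]; rewrite (dualE HB) // eq_sym (negbTE gf) mulr0.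
Qed.

(** By [qcoef_rec], lowering the exponent of [h] multiplies the summand by the node of [h], up to a
    term in which the factor of [h] is removed; that term belongs to the sum for [A :\ h]. *)
Lemma Zpart_down A k y N h : h \in A ->
  (if (0 < k h)%N then Zpart A (kdown k h) y N - Zpart (A :\ h) (kdown k h) y N else 0) =
  (\prod_(f : L | f \notin A) (k f == 0%N)%:R) *
  \sum_(v <- vbox N) echar (dot y (realvec R v)) *
    (pnode (off h) (lval h v) * \prod_(f in A) qfac k f (lval f v)).
Proof.
move=> hA; case: posnP => k0.
  rewrite [X in _ * X]big1 ?mulr0 // => v _; rewrite (bigD1 h hA) /=.
  have := qcoef_rec (pnode (off h) (lval h v)) 0; rewrite /qfac k0 sub0r => /eqP.
  by rewrite oppr_eq0 => /eqP h0; rewrite [pnode _ _ * (_ * _)]mulrA h0 mul0r mulr0.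
have prodA (F : L -> R[i]) : \prod_(f in A :\ h) F f = \prod_(f in A | f != h) F f.
  by apply: eq_bigl => f; rewrite !inE andbC.
have prodN (F : L -> R[i]) : \prod_(f | f \notin A :\ h) F f = F h * \prod_(f | f \notin A) F f.
  rewrite (bigD1 h) /= ?inE ?eqxx //; congr (_ * _); apply: eq_bigl => f.
  by rewrite !inE; case: eqVneq => [->|]; rewrite ?hA //= andbT.
have down f : f != h -> kdown k h f = k f by move=> fh; rewrite ffunE (negbTE fh) subn0.
have downh : kdown k h h = (k h).-1 by rewrite ffunE eqxx subn1.
rewrite /Zpart prodN downh.
have -> : \prod_(f | f \notin A) (kdown k h f == 0%N)%:R =
          \prod_(f : L | f \notin A) (k f == 0%N)%:R :> R[i].
  by apply: eq_bigr => f fA; rewrite down //; apply: contraNneq fA => ->.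
set P := \prod_(f | _) _.
rewrite [_ * P]mulrC -mulrA -mulrBr mulr_sumr -sumrB; congr (_ * _).
apply: eq_bigr => v _; rewrite mulrCA -mulrBr; congr (_ * _).
rewrite (bigD1 h hA) /= [in RHS](bigD1 h hA) /= prodA.
have -> : \prod_(f in A | f != h) qfac (kdown k h) f (lval f v) =
          \prod_(f in A | f != h) qfac k f (lval f v).
  by apply: eq_bigr => f /andP[_ fh]; rewrite /qfac down.
rewrite -mulrBl mulrA; congr (_ * _).
have := qcoef_rec (pnode (off h) (lval h v)) (k h); rewrite /qfac downh.
case: (k h) k0 => // n _ /=; rewrite eqSS => /eqP; rewrite subr_eq => /eqP ->.
by rewrite addrC addKr.
Qed.

(** The linear parts of the nodes cancel in the combination, which leaves a constant independent of
    [v]; thus the relation is exact for every [N]. *)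
Lemma Zpart_rel A (gam : L -> R) k y N : \sum_h gam h *: vec h = 0 ->
  (forall h, gam h != 0 -> h \in A) ->
  \sum_h (gam h)%:C * (if (0 < k h)%N then Zpart A (kdown k h) y N
      - Zpart (A :\ h) (kdown k h) y N else 0) =
  twopii R * (\sum_h (gam h)%:C * off h) * Zpart A k y N.
Proof.
move=> g0 gA; rewrite /Zpart mulrCA.
transitivity (\sum_h (gam h)%:C * ((\prod_(f : L | f \notin A) (k f == 0%N)%:R) *
  \sum_(v <- vbox N) echar (dot y (realvec R v)) *
    (pnode (off h) (lval h v) * \prod_(f in A) qfac k f (lval f v)))).
  apply: eq_bigr => h _; have [->|h0] := eqVneq (gam h) 0; first by rewrite !mul0r.
  by rewrite -Zpart_down // gA.
under eq_bigr do rewrite mulrCA.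
rewrite -mulr_sumr; congr (_ * _); under eq_bigr do rewrite mulr_sumr.
rewrite exchange_big [RHS]mulr_sumr /=; apply: eq_bigr => v _.
under eq_bigr do rewrite mulrCA.
rewrite -mulr_sumr [RHS]mulrCA; congr (_ * _).
set P := \prod_(f in A) _.
rewrite (eq_bigr (fun h => (gam h)%:C * pnode (off h) (lval h v) * P)); last first.
  by move=> h _; rewrite mulrA.
rewrite -mulr_suml; congr (_ * _).
rewrite [RHS]mulr_sumr.
have hl : twopii R * \sum_h (gam h)%:C * (lval h v)%:~R = 0.
  have h0 : (dot (\sum_h gam h *: vec h) (realvec R v))%:C = 0 by rewrite g0 dot0l.
  rewrite -[RHS](mulr0 (twopii R)) -[in RHS]h0 dot_suml rmorph_sum /=; congr (_ * _).
  by apply: eq_bigr => h _; rewrite dotZl dot_vec rmorphM /= rmorph_int.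
rewrite -[RHS]add0r -[X in _ = X + _]hl mulr_sumr -big_split; apply: eq_bigr => h _ /=.
by rewrite /pnode; ring.
Qed.

End Circuit.

Section Division.
Context {R : realType} {L : finType}.
Implicit Types (f h : L) (k : {ffun L -> nat}).
Implicit Types (X : {ffun L -> nat} -> R[i]) (Y : L -> {ffun L -> nat} -> R[i]).

Definition lin_rel (gam : L -> R[i]) (d : R[i]) X Y : Prop := forall k,
  \sum_h gam h * (if (0 < k h)%N then X (kdown k h) - Y h (kdown k h) else 0) = d * X k.

Context (gam : L -> R[i]) (g : L) (d : R[i]).
Hypothesis gamg : gam g = 1.

(* [lin_rel] says that (sum_h gam_h t_h - d) X = sum_h gam_h t_h Y_h as power
   series. For d != 0 it determines X by induction on the degree; for d = 0 one
   divides by a linear form that is monic in t_g. *)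
Let y0 : R[i] := if d == 0 then 1 else 0.
Let a h : R[i] := if d == 0 then (if h == g then 0 else - gam h) else gam h / d.
Let sg h k : {ffun L -> nat} := if d == 0 then kdown (kup k g) h else kdown k h.
Let mu k : nat := if d == 0 then (\sum_(h | h != g) k h)%N else deg k.

Lemma division_step X Y : lin_rel gam d X Y -> forall k, X k = y0 * Y g k +
  \sum_h a h * (if (0 < k h)%N then X (sg h k) - Y h (sg h k) else 0).
Proof.
rewrite /y0 /a /sg => rel k; case: (eqVneq d 0) => d0; last first.
  rewrite mul0r add0r; apply: (mulfI d0); rewrite -rel mulr_sumr; apply: eq_bigr => h _.
  by rewrite mulrA mulrCA mulfV // mulr1.
(* For [d = 0] the relation is read one degree higher in [t_g]; its term of index [g] is then
   [X k - Y g k], since [gam g = 1]. *)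
have := rel (kup k g); rewrite d0 mul0r (bigD1 g) //= gamg mul1r ffunE eqxx addn1 /= kupK.
rewrite mul1r [X in _ = _ + X](bigD1 g) //= eqxx mul0r add0r.
have -> : \sum_(h | h != g) (if h == g then 0 else - gam h) * (if (0 < k h)%N then
    X (kdown (kup k g) h) - Y h (kdown (kup k g) h) else 0) =
  - \sum_(h | h != g) gam h * (if (0 < kup k g h)%N then X (kdown (kup k g) h) -
       Y h (kdown (kup k g) h) else 0).
  rewrite -sumrN; apply: eq_bigr => h hg.
  by rewrite (negbTE hg) mulNr ffunE (negbTE hg) addn0.
by set S := \sum_(h | _) _ => /eqP; rewrite addr_eq0 => /eqP <-; rewrite addrC subrK.
Qed.

(** For [d = 0] a step moves one unit of exponent from [h] to [g]: the degree stays, but the part of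
    it outside [g] drops. *)
Lemma measure_shift_lt h k : a h != 0 -> (0 < k h)%N -> (mu (sg h k) < mu k)%N.
Proof.
rewrite /a /mu /sg; case: (eqVneq d 0) => d0 => [|_ kh]; last first.
  by rewrite -(deg_kdown kh).
case: (eqVneq h g) => [|hg _ kh]; first by rewrite eqxx.
rewrite [in X in (_ < X)%N](bigD1 h) //= (bigD1 h) //= !ffunE eqxx (negbTE hg) addn0.
rewrite -[in X in (_ < X)%N](subnK kh) addn1 addSn ltnS leq_add2l.
apply/eq_leq/eq_bigr => f /andP[fg fh].
by rewrite !ffunE (negbTE fg) (negbTE fh) addn0 subn0.
Qed.

Lemma deg_shift_le h k : (0 < k h)%N -> (deg (sg h k) <= deg k)%N.
Proof.
rewrite /sg => kh; case: (eqVneq d 0) => d0; last by rewrite -(deg_kdown kh).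
by rewrite -ltnS deg_kdown ?deg_kup // ffunE ltn_addr.
Qed.

Lemma measure_le_deg k : (mu k <= deg k)%N.
Proof.
rewrite /mu; case: ifP => // _; rewrite /deg [X in (_ <= X)%N](bigD1 g) //=.
exact: leq_addl.
Qed.

Lemma step_coef_neq0 h : a h != 0 -> gam h != 0.
Proof.
rewrite /a; case: ifP => _; first by case: ifP => _; rewrite ?eqxx ?oppr_eq0.
by apply: contraNneq => ->; rewrite mul0r.
Qed.

Fixpoint division_rec (n : nat) Y k : R[i] :=
  if n is n'.+1 then y0 * Y g k +
    \sum_h a h * (if (0 < k h)%N then division_rec n' Y (sg h k) - Y h (sg h k) else 0)
  else 0.

Definition division Y k : R[i] := division_rec (deg k).+1 Y k.

Lemma division_unique X Y : lin_rel gam d X Y -> forall k, X k = division Y k.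
Proof.
move=> rel; have H n : forall k, (mu k < n)%N -> X k = division_rec n Y k.
  elim: n => // n IH k; rewrite ltnS => kn /=.
  rewrite (division_step rel); congr (_ + _); apply: eq_bigr => h _.
  have [->|ah] := eqVneq (a h) 0; first by rewrite !mul0r.
  by case: ifP => // kh; rewrite IH // (leq_trans (measure_shift_lt ah kh)).
by move=> k; apply: H; rewrite ltnS measure_le_deg.
Qed.

(** Each coefficient is a finite expression in the data, so division is continuous for
    coefficientwise limits. The filter is arbitrary because this serves both the limit in [N] and
    the right limit along [phi]. *)
Lemma division_ccvg (T : Type) (F : set_system T) (FF : Filter F)
    (Y : T -> L -> {ffun L -> nat} -> R[i]) Y0 :
  (forall h k, gam h != 0 -> ccvg F (fun x => Y x h k) (Y0 h k)) ->
  forall k, ccvg F (fun x => division (Y x) k) (division Y0 k).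
Proof.
move=> Yc; suff H n k : ccvg F (fun x => division_rec n (Y x) k) (division_rec n Y0 k).
  by move=> k; apply: H.
elim: n k => [|n IH] k /=; first exact: ccvg_cst.
apply: ccvgD; first by apply: ccvgMl; apply: Yc; rewrite gamg oner_neq0.
apply: ccvg_sum => h _; have [a0|ah] := eqVneq (a h) 0.
  rewrite a0 mul0r; apply: eq_ccvg (ccvg_cst 0) => x.
  by rewrite mul0r.
apply: ccvgMl; case: ifP => _; last exact: ccvg_cst.
by apply: ccvgB; [exact: IH | apply: Yc; exact: step_coef_neq0].
Qed.

(** Every level of the recursion multiplies the bound by at most [P], and there are [deg k + 1]
    levels; this only enlarges the ratio of the geometric bound. *)
Lemma division_bound Y (K M : R) : 0 <= K -> 1 <= M ->
  (forall h k, gam h != 0 -> cnorm (Y h k) <= K * M ^+ deg k) ->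
  exists K' M' : R, [/\ 0 <= K', 1 <= M' &
    forall k, cnorm (division Y k) <= K' * M' ^+ deg k].
Proof.
move=> K0 M1 YK; pose S := \sum_h cnorm (a h); pose P := 1 + cnorm y0 + 2 * S.
have S0 : 0 <= S by apply: sumr_ge0 => h _; apply: cnorm_ge0.
have P1 : 1 <= P by rewrite /P; have := cnorm_ge0 y0; lra.
have P0 : 0 <= P by apply: le_trans P1.
have M0 : 0 <= M by apply: le_trans M1.
have H n : forall k, cnorm (division_rec n Y k) <= K * P ^+ n * M ^+ deg k.
  elim: n => [|n IH] k /=; first by rewrite cnorm0 !mulr_ge0 // exprn_ge0.
  set Z := K * P ^+ n * M ^+ deg k.
  have Pn : 1 <= P ^+ n by apply: exprn_ege1.
  have Mk : 0 <= M ^+ deg k by apply: exprn_ge0.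
  have KZ : K * M ^+ deg k <= Z.
    by rewrite /Z mulrAC ler_peMr // mulr_ge0.
  have Z0 : 0 <= Z by apply: le_trans KZ; rewrite mulr_ge0.
  apply: le_trans (cnormD _ _) _; rewrite cnormM.
  have h1 : cnorm y0 * cnorm (Y g k) <= cnorm y0 * Z.
    rewrite ler_wpM2l ?cnorm_ge0 //; apply: le_trans KZ; apply: YK.
    by rewrite gamg oner_neq0.
  have h2 : cnorm (\sum_h a h * (if (0 < k h)%N then
      division_rec n Y (sg h k) - Y h (sg h k) else 0)) <= S * (2 * Z).
    apply: le_trans (cnorm_sum _ _ _) _; rewrite mulr_suml; apply: ler_sum => h _.
    rewrite cnormM; have [->|ah] := eqVneq (a h) 0; first by rewrite cnorm0 !mul0r.
    rewrite ler_wpM2l ?cnorm_ge0 //; case: ifP => kh; last first.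
      by rewrite cnorm0 mulr_ge0.
    apply: le_trans (cnormB _ _) _; rewrite mulrDl mul1r.
    have Ms : M ^+ deg (sg h k) <= M ^+ deg k by rewrite ler_weXn2l // deg_shift_le.
    apply: lerD.
      apply: le_trans (IH _) _; rewrite ler_wpM2l // mulr_ge0 // exprn_ge0 //.
    apply: le_trans (YK _ _ (step_coef_neq0 ah)) _; apply: le_trans KZ.
    by rewrite ler_wpM2l.
  apply: le_trans (lerD h1 h2) _.
  have -> : K * P ^+ n.+1 * M ^+ deg k = P * Z by rewrite exprS /Z; ring.
  have -> : cnorm y0 * Z + S * (2 * Z) = (cnorm y0 + 2 * S) * Z by ring.
  by rewrite ler_wpM2r // /P; lra.
exists (K * P), (P * M); split; first by rewrite mulr_ge0.
  by rewrite -[1]mulr1 ler_pM.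
move=> k; apply: le_trans (H _ _) _.
by rewrite exprMn exprS !mulrA.
Qed.

End Division.

(** * Induction over subarrangements *)

Section Induction.
Context {R : realType} {r : nat} {L : {fset 'rV[int]_r * R[i]}} (phi : 'rV[R]_r).
Implicit Types (f g h : L) (A B : {set L}) (v w : 'rV[int]_r) (k : {ffun L -> nat}).
Implicit Types (y : 'rV[R]_r) (t : {ffun L -> R[i]}).

Definition sub_gen A y t : R[i] :=
  \sum_(B in bases L | B \subset A)
    (\prod_(g in A | g \notin B) (t g / den t B g)) * base_fun phi B y t.

(** Compared basis by basis: for [h] outside [B], [t h] times the product without [h] is [den t B h]
    times the full product, and for [h] in [B] both contributions vanish. [sum_den] then replaces
    the denominators by a factor independent of [B]. *)
Lemma sub_gen_rel A (gam : L -> R) y t : regular L t ->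
  \sum_h gam h *: vec h = 0 -> (forall h, gam h != 0 -> h \in A) ->
  \sum_h (gam h)%:C * (t h * sub_gen (A :\ h) y t) =
  (\sum_h (gam h)%:C * tshift t h) * sub_gen A y t.
Proof.
move=> rt g0 gA; rewrite /sub_gen mulr_sumr.
transitivity (\sum_(B in bases L | B \subset A) \sum_h
   (gam h)%:C * (t h * (if B \subset A :\ h then
      (\prod_(g in A :\ h | g \notin B) (t g / den t B g)) * base_fun phi B y t else 0))).
  rewrite exchange_big /=; apply: eq_bigr => h _; rewrite -!mulr_sumr; congr (_ * (_ * _)).
  rewrite -big_mkcondr /=; apply: eq_bigl => B; rewrite -andbA; congr (_ && _).
  case: (boolP (B \subset A :\ h)) => BA; rewrite ?andbF ?andbT //.
  by rewrite (fintype.subset_trans BA) // subD1set.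
apply: eq_bigr => B /andP[HB BA]; rewrite mulrA -(sum_den B t g0) mulr_suml mulr_suml.
apply: eq_bigr => h _; have [->|h0] := eqVneq (gam h) 0; first by rewrite !mul0r.
have hA := gA h h0; case: (boolP (h \in B)) => hB.
  rewrite (den_basis t HB hB) mulr0 !mul0r ifF ?mulr0 //.
  by apply/negP => /fintype.subsetP/(_ h hB); rewrite !inE eqxx.
have -> : B \subset A :\ h.
  apply/fintype.subsetP => f fB; rewrite !inE (fintype.subsetP BA) // andbT.
  by apply: contraNneq hB => <-.
have d0 : den t B h != 0 by apply: (rt B HB).1.
rewrite [in RHS](bigD1 h) /= ?hA //.
have -> : \prod_(g in A :\ h | g \notin B) (t g / den t B g) =
    \prod_(g in A | (g \notin B) && (g != h)) (t g / den t B g).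
  by apply: eq_bigl => g; rewrite !inE; case: (g != h); rewrite ?andbF ?andbT.
have -> : \prod_(i | (i \in A) && (i \notin B) && (i != h)) (t i / den t B i) =
    \prod_(g in A | (g \notin B) && (g != h)) (t g / den t B g).
  by apply: eq_bigl => g; rewrite andbA.
by set P := \prod_(_ in A | _) _; field.
Qed.

Context (D : nat) (u : {set L} -> L -> 'rV[int]_r).
Hypotheses (D0 : (0 < D)%N) (uD : forall B f, B \in bases L -> f \in B ->
  realvec R (u B f) = D%:R *: dual B f).
Hypothesis gp : generic L phi.

(** The invariant of the induction. Convergence is asked only at [nonintegral] points, right
    continuity carries relations from there to every [y], and the geometric bound makes the series
    converge near the origin, where regular [t] identify its sum with the formula. *)
Definition expansion A (c : 'rV[R]_r -> {ffun L -> nat} -> R[i]) : Prop :=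
  [/\ forall y k, nonintegral u y -> ccvg \oo (Zpart A k y) (c y k),
      forall y k, ccvg 0^'+ (fun e => c (y + e *: phi) k) (c y k),
      forall y, exists K M : R, [/\ 0 <= K, 1 <= M &
        forall k, cnorm (c y k) <= K * M ^+ deg k] &
      forall y, exists2 rho : R, 0 < rho & forall t, (forall f, cnorm (t f) < rho) ->
        regular L t -> has_sum (fun k => c y k * mono t k) (sub_gen A y t)].

Lemma base_expansion B : B \in bases L -> expansion B (base_coef phi B).
Proof.
move=> HB; split.
- by move=> y k yn; apply: (base_ccvg phi uD HB k yn).
- by move=> y k; apply: base_coef_right.
- by move=> y; have [K [M [K0 M1 h _]]] := base_taylor phi B y; exists K, M.
move=> y; have [K [M [K0 M1 _ h]]] := base_taylor phi B y.
have M0 : 0 < M by apply: lt_le_trans M1.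
exists (2 * M)^-1; first by rewrite invr_gt0 mulr_gt0.
move=> t tM rt; have -> : sub_gen B y t = base_fun phi B y t.
  rewrite /sub_gen (bigD1 B) /= ?HB ?fintype.subxx // big_pred0 => [|g]; last first.
    by case: (g \in B).
  rewrite mul1r big1 ?addr0 // => B' /andP[/andP[HB' B'B] nB].
  case/eqP: nB; apply/eqP; rewrite eqEcard B'B /=.
  by rewrite ((basesP B).1 HB).1 ((basesP B').1 HB').1.
apply: h => [f|f fB]; last exact: (rt B HB).2.
by have := tM f; rewrite -[_^-1]mul1r ltr_pdivlMr ?mulr_gt0 // => /ltW.
Qed.

Section Step.
Context (A : {set L}) (gam : L -> R) (g : L) (c : L -> 'rV[R]_r -> {ffun L -> nat} -> R[i]).
Hypotheses (gamg : gam g = 1) (gam0 : \sum_h gam h *: vec h = 0).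
Hypothesis gamA : forall h, gam h != 0 -> h \in A.
Hypothesis gamd : exists2 B, B \in bases L & g \notin B /\
  forall t, den t B g = \sum_h (gam h)%:C * tshift t h.
Hypothesis cA : forall h, gam h != 0 -> expansion (A :\ h) (c h).

Let gamC h : R[i] := (gam h)%:C.
Let d : R[i] := twopii R * \sum_h gamC h * off h.
Let X y k : R[i] := division gamC g d (fun h => c h y) k.

Let gamCg : gamC g = 1. Proof. by rewrite /gamC gamg. Qed.

Let gamC0 h : gamC h != 0 -> gam h != 0.
Proof. by apply: contraNneq => h0; rewrite /gamC h0. Qed.

Lemma step_cvg y k : nonintegral u y -> ccvg \oo (Zpart A k y) (X y k).
Proof.
move=> yn.
have rel N : lin_rel gamC d (fun k => Zpart A k y N) (fun h k => Zpart (A :\ h) k y N).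
  by move=> k'; apply: Zpart_rel.
apply: eq_ccvg (_ : ccvg \oo (fun N => division gamC g d
   (fun h k => Zpart (A :\ h) k y N) k) _) => [N|].
  by rewrite (division_unique gamCg (rel N)).
apply: division_ccvg => // h k' h0.
by have [h1 _ _ _] := cA (gamC0 h0); apply: h1.
Qed.

Lemma step_right y k : ccvg 0^'+ (fun e => X (y + e *: phi) k) (X y k).
Proof.
apply: division_ccvg => // h k' h0.
by have [_ h1 _ _] := cA (gamC0 h0); apply: h1.
Qed.

Lemma step_bound y : exists K M : R, [/\ 0 <= K, 1 <= M &
  forall k, cnorm (X y k) <= K * M ^+ deg k].
Proof.
have /choice[p Hp] h : exists p : R * R, [/\ 0 <= p.1, 1 <= p.2 &
    gam h != 0 -> forall k, cnorm (c h y k) <= p.1 * p.2 ^+ deg k].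
  have [h0|h0] := eqVneq (gam h) 0; first by exists (0, 1).
  have [_ _ h1 _] := cA h0; have [K [M [K0 M1 h2]]] := h1 y.
  by exists (K, M).
pose K := \sum_h (p h).1; pose M := 1 + \sum_h (p h).2.
have p10 h : 0 <= (p h).1 by case: (Hp h).
have p20 h : 0 <= (p h).2 by case: (Hp h) => _ h1 _; apply: le_trans h1.
apply: (@division_bound _ _ _ _ _ gamCg _ K M).
- exact: sumr_ge0.
- by rewrite lerDl sumr_ge0.
move=> h k /gamC0 h0; have [_ _ /(_ h0 k) hk] := Hp h; apply: le_trans hk _.
apply: ler_pM => //; first exact: exprn_ge0.
  by rewrite /K (bigD1 h) //= lerDl sumr_ge0.
apply: lerXn2r; rewrite ?nnegrE // /M.
  by rewrite addr_ge0 // sumr_ge0.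
by rewrite (bigD1 h) //= addrCA lerDl addr_ge0 // sumr_ge0.
Qed.

Lemma lin_rel_ccvg (T : Type) (F : set_system T) (FF : ProperFilter F)
    (X' : T -> {ffun L -> nat} -> R[i]) (Y' : T -> L -> {ffun L -> nat} -> R[i]) X0 Y0 :
  F [set x | lin_rel gamC d (X' x) (Y' x)] ->
  (forall k, ccvg F (fun x => X' x k) (X0 k)) ->
  (forall h k, gam h != 0 -> ccvg F (fun x => Y' x h k) (Y0 h k)) ->
  lin_rel gamC d X0 Y0.
Proof.
move=> rel Xc Yc k; apply: (@ccvg_unique _ _ F _ (fun x => d * X' x k)); last first.
  exact: ccvgMl.
apply: near_eq_ccvg (_ : ccvg F (fun x => \sum_h gamC h * (if (0 < k h)%N then
   X' x (kdown k h) - Y' x h (kdown k h) else 0)) _); last first.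
  apply: ccvg_sum => h _; have [h0|h0] := eqVneq (gam h) 0.
    rewrite /gamC h0 mul0r; apply: eq_ccvg (ccvg_cst 0) => x.
    by rewrite mul0r.
  apply: ccvgMl; case: ifP => _; last exact: ccvg_cst.
  by apply: ccvgB; [exact: Xc | exact: Yc].
by apply: filterS rel => x; apply.
Qed.

(** At [nonintegral] points the relation is the limit of those of the truncated sums; any [y] is a
    right limit of such points along [phi], and [lin_rel] is closed under limits. *)
Lemma step_rel y : lin_rel gamC d (X y) (fun h => c h y).
Proof.
have nonint y' : nonintegral u y' -> lin_rel gamC d (X y') (fun h => c h y').
  move=> yn; apply: (@lin_rel_ccvg nat \oo _ (fun N k => Zpart A k y' N)
     (fun N h k => Zpart (A :\ h) k y' N)).
  - by apply: filterE => N k; apply: Zpart_rel.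
  - by move=> k; apply: step_cvg.
  - by move=> h k h0; have [h1 _ _ _] := cA h0; apply: h1.
apply: (@lin_rel_ccvg R 0^'+ _ (fun e => X (y + e *: phi))
   (fun e h => c h (y + e *: phi))).
- by apply: filterS (nonintegral_right D0 uD gp y) => e; apply: nonint.
- by move=> k; apply: step_right.
- by move=> h k h0; have [_ h1 _ _] := cA h0; apply: h1.
Qed.

(** The sum of the series of [X] and the formula satisfy the same linear equation; its leading
    factor equals [den t B g], which is nonzero at regular [t] and can be cancelled. *)
Lemma step_taylor y : exists2 rho : R, 0 < rho & forall t, (forall f, cnorm (t f) < rho) ->
  regular L t -> has_sum (fun k => X y k * mono t k) (sub_gen A y t).
Proof.
have [K [M [K0 M1 XK]]] := step_bound y.
have M0 : 0 < M by apply: lt_le_trans M1.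
have /choice[p Hp] h : exists p : R, 0 < p /\ (gam h != 0 -> forall t,
    (forall f, cnorm (t f) < p) -> regular L t ->
    has_sum (fun k => c h y k * mono t k) (sub_gen (A :\ h) y t)).
  have [h0|h0] := eqVneq (gam h) 0; first by exists 1.
  by have [_ _ _ h1] := cA h0; have [p p0 h2] := h1 y; exists p.
exists (\big[Order.min/(2 * M)^-1]_h p h).
  elim/big_rec: _ => [|h x _ x0]; first by rewrite invr_gt0 mulr_gt0.
  by rewrite lt_min x0 andbT; case: (Hp h).
move=> t tr rt.
have tM f : cnorm (t f) * (2 * M) <= 1.
  have : cnorm (t f) < (2 * M)^-1 by apply: lt_le_trans (tr f) _; apply: bigmin_le_id.
  by rewrite -[_^-1]mul1r ltr_pdivlMr ?mulr_gt0 // => /ltW.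
have tp h : gam h != 0 -> has_sum (fun k => c h y k * mono t k) (sub_gen (A :\ h) y t).
  move=> h0; apply: (Hp h).2 => // f; apply: lt_le_trans (tr f) _.
  exact: bigmin_le_cond.
have [S hS] := abs_summable_has_sum (deg_summable K0 (ltW M0) XK tM).
suff <- : S = sub_gen A y t by [].
have [B HB [gB dB]] := gamd.
have dn0 : \sum_h (gam h)%:C * tshift t h != 0 by rewrite -dB; apply: (rt B HB).1.
apply: (mulfI dn0); rewrite -(sub_gen_rel y rt gam0 gamA).
have h1 : has_sum (fun k => (d * X y k) * mono t k)
   (\sum_h gamC h * (t h * (S - sub_gen (A :\ h) y t))).
  have h2 : has_sum (fun k => \sum_h gamC h * ((if (0 < k h)%N then
      X y (kdown k h) - c h y (kdown k h) else 0) * mono t k))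
     (\sum_h gamC h * (t h * (S - sub_gen (A :\ h) y t))).
    apply: has_sum_sum => h _; have [h0|h0] := eqVneq (gam h) 0.
      rewrite /gamC h0 mul0r; apply: eq_has_sum has_sum_cst0 => k.
      by rewrite mul0r.
    apply: has_sumZ.
    apply: (@has_sum_kdown _ _ (fun k => X y k - c h y k)).
    by apply: eq_has_sum (has_sumB hS (tp h h0)) => k; rewrite mulrBl.
  apply: eq_has_sum h2 => k; rewrite -(step_rel y k) mulr_suml.
  by apply: eq_bigr => h _; rewrite mulrA.
have h3 : has_sum (fun k => (d * X y k) * mono t k) (d * S).
  by apply: eq_has_sum (has_sumZ d hS) => k; rewrite mulrA.
have := has_sum_unique h1 h3; rewrite /tshift.
under eq_bigr do rewrite mulrBr mulrBr.
rewrite sumrB => /eqP; rewrite subr_eq addrC -subr_eq => /eqP <-.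
have -> : \sum_h (gam h)%:C * (t h - twopii R * off h) = \sum_h gamC h * t h - d.
  by rewrite /d mulr_sumr -sumrB; apply: eq_bigr => h _; rewrite mulrBr mulrCA.
by rewrite mulrBl mulr_suml; congr (_ - _); apply: eq_bigr => h _; rewrite mulrA.
Qed.

Lemma step_expansion : expansion A X.
Proof.
split; [exact: step_cvg | exact: step_right | exact: step_bound | exact: step_taylor].
Qed.

End Step.

Lemma expansion_exists A B : B \in bases L -> B \subset A -> exists c, expansion A c.
Proof.
elim: {A}#|A| {-2}A (leqnn #|A|) B => [|n IH] A An B HB BA.
  have A0 : A = B.
    apply/eqP; rewrite finset.eqEsubset BA andbT; apply/fintype.subsetP => f fA.
    by move: An; rewrite leqn0 => /eqP/card0_eq/(_ f); rewrite fA.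
  by exists (base_coef phi B); rewrite A0; apply: base_expansion.
have [AB|] := boolP (A \subset B).
  have -> : A = B by apply/eqP; rewrite finset.eqEsubset BA AB.
  by exists (base_coef phi B); apply: base_expansion.
move=> /subsetPn[g gA gB].
have [gam [gamg gam0 gamA gamd]] := circuit HB BA gA gB.
have /choice[c Hc] h : exists c, gam h != 0 -> expansion (A :\ h) c.
  have [h0|h0] := eqVneq (gam h) 0; first by exists (fun _ _ => 0).
  have [hA [B' HB' B'A]] := gamA h h0.
  have [|c hc] := IH (A :\ h) _ B' HB' B'A; last by exists c.
  by move: An; rewrite (cardsD1 h A) hA.
eexists; apply: (step_expansion (c := c) gamg gam0 _ _ Hc).
  by move=> h h0; case: (gamA h h0).
by exists B.
Qed.

End Induction.

(** * The limit at points that are not excluded *)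

Section Primitive.
Context {r : nat}.
Implicit Types (x p w : 'rV[int]_r).

Lemma idot_comb x w (j : 'I_r) (q : int) :
  idot x (\row_i ((i == j)%:R - q * w 0 i)) = x 0 j - q * idot x w.
Proof.
rewrite /idot mulr_sumr -[X in X - _](_ : \sum_i x 0 i * (i == j)%:R = _); last first.
  by rewrite (bigD1 j) //= eqxx mulr1 big1 ?addr0 // => i /negbTE ->; rewrite mulr0.
by rewrite -sumrB; apply: eq_bigr => i _; rewrite mxE mulrBr [x 0 i * (q * _)]mulrCA.
Qed.

(** [n] is the smallest positive value of [x] on integer vectors, that is the gcd of its
    coordinates: a nonzero remainder of a coordinate modulo [n] would be a smaller value. *)
Lemma primitive_vec x : x != 0 -> exists (n : nat) p w, [/\ (0 < n)%N,
  forall j, x 0 j = p 0 j * Posz n & idot p w = 1].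
Proof.
move=> x0; pose P (n : nat) := (0 < n)%N && `[< exists w, idot x w = Posz n >].
have exP : exists n, P n.
  have [j xj] : exists j, x 0 j != 0.
    apply: contrapT => h; case/eqP: x0; apply/rowP => j; rewrite mxE.
    by apply: contrapT => /eqP xj; apply: h; exists j.
  exists `|x 0%R j|%N; rewrite /P absz_gt0 xj /=; apply/asboolP.
  have := idot_comb x (\row_i 0) j 0; rewrite mul0r subr0 => h.
  have [xp|xn] := leP 0 (x 0 j); first by eexists; exact: etrans h (esym (gez0_abs xp)).
  exists (0 - \row_i ((i == j)%:R - 0 * (\row_i 0) 0 i)).
  have x00 : idot x 0 = 0 by rewrite /idot big1 // => i _; rewrite mxE mulr0.
  by rewrite idotBr h ltz0_abs // x00 sub0r.
case: (ex_minnP exP) => n /andP[n0 /asboolP[w xw]] nmin.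
have dv j : modz (x 0%R j) n = 0.
  have h : idot x (\row_i ((i == j)%:R - divz (x 0%R j) n * w 0 i)) = modz (x 0%R j) n.
    by rewrite idot_comb xw /modz.
  have m0 : (0 <= modz (x 0%R j) n)%R by apply: modz_ge0; move: n0; clear; lia.
  have mn : (modz (x 0%R j) n < Posz n)%R by apply: ltz_pmod; move: n0; clear; lia.
  apply/eqP; apply: contraTT m0 => mj.
  have := nmin `|modz (x 0%R j) n|%N.
  move: h mn mj; move: (modz (x 0%R j) n) => z h mn mj; rewrite -ltNge.
  have [zp|//] := leP 0 z; rewrite /P absz_gt0 mj /= => /(_ _).
  have -> : `[< exists w, idot x w = Posz `|z|%N >].
    by apply/asboolP; eexists; rewrite gez0_abs; first exact: h.
  by move=> /(_ isT); move: mn zp; clear; lia.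
have xE j : x 0 j = divz (x 0%R j) n * Posz n.
  by rewrite {1}(divz_eq (x 0 j) n) dv addr0.
exists n, (\row_j divz (x 0%R j) n), w; split=> // [j|].
  by rewrite mxE.
have n0' : Posz n != 0 by move: n0; clear; lia.
apply: (mulIf n0'); rewrite mul1r -[RHS]xw /idot mulr_suml; apply: eq_bigr => j _.
by rewrite mxE [in RHS]xE mulrAC.
Qed.

End Primitive.

Section Coloop.
Context {R : realType} {r : nat} {L : {fset 'rV[int]_r * R[i]}}.
Implicit Types (f g h : L) (A B : {set L}) (v w : 'rV[int]_r) (k : {ffun L -> nat}).
Implicit Types (y : 'rV[R]_r).

Lemma span_without f (S : {set L}) : (forall B, B \in bases L -> f \in B) ->
  f \notin S -> ~ spanning S.
Proof.
move=> fco fS Ss; have [B HB BS] := subset_bases Ss.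
by move: fS; rewrite (fintype.subsetP BS _ (fco B HB)).
Qed.

Lemma coloop_tildeL f : (forall B, B \in bases L -> f \in B) -> f \in tildeL L.
Proof.
move=> fco; rewrite inE /image_mem filter_map; apply/eqP => h.
have /(span_without fco) := zspan_spanning (filter_uniq _ (enum_uniq _)) h.
by apply; rewrite inE mem_filter /= eqxx.
Qed.

Lemma coloop_rank f B : (forall B, B \in bases L -> f \in B) -> B \in bases L ->
  (gen_rank [set~ f]%SET).+1 = r.
Proof.
move=> fco HB; have fB := fco B HB; have [Br _] := (basesP B).1 HB.
have card1 : #|B :\ f|.+1 = r by apply: etrans Br; rewrite (cardsD1 f B) fB.
have fr := free_setD1 HB fB.
have h1 : (#|B :\ f| <= gen_rank [set~ f]%SET)%N.
  rewrite cardE -(free_rat fr) /gen_rank /zrank dimvS // sub_span // => x.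
  move=> /mapP[v /mapP[g gB ->] ->]; apply: map_f; apply: map_f.
  by move: gB; rewrite !mem_enum !inE => /andP[].
have h2 : (gen_rank [set~ f]%SET <= r)%N.
  by apply: leq_trans (dimvS (subvf _)) _; rewrite dimvf dim_matrix; clear; lia.
have h3 : gen_rank [set~ f]%SET != r.
  apply/eqP => h; have /(span_without fco) := zspan_spanning (enum_uniq _) h.
  by apply; rewrite inE mem_enum !inE eqxx.
apply/eqP; rewrite eqn_leq; apply/andP; split; first by rewrite ltn_neqAle h3 h2.
by apply: leq_trans (_ : #|B :\ f|.+1 <= _)%N; rewrite ?ltnS // card1.
Qed.

(** [p] is a primitive integer vector on the line of [f^B]; any [g <> f] vanishes on it, since
    otherwise exchange would give a basis without [f]. Primitivity supplies [w] with [<p, w> = 1],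
    so an integral [<y, p>] can be removed by an integer translation, which moves [y] into the
    hyperplane. A mere multiple such as [D f^B] would exclude too many [y]. *)
Lemma coloop_vec f B : (forall B, B \in bases L -> f \in B) -> B \in bases L ->
  exists p : 'rV[int]_r, (forall g, g != f -> lval g p = 0) /\
  forall y, echar (dot y (realvec R p)) = 1 ->
    exists w, hyperplane [set~ f]%SET (y - realvec R w).
Proof.
move=> fco HB; have fB := fco B HB.
have [D [u [D0 uD]]] := dual_int HB.
have DR0 : (D%:R : R) != 0 by rewrite pnatr_eq0 -lt0n.
have u0 : u f != 0.
  apply/eqP => h; have := uD f fB; rewrite h => /(congr1 (dot (vec f))).
  rewrite dotZr (dualE HB) // eqxx mulr1 dotC => /esym/eqP.
  rewrite (_ : realvec R 0 = 0) ?dot0l; first by rewrite (negbTE DR0).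
  by apply/rowP => j; rewrite !mxE.
have [n [p [w [n0 up pw]]]] := primitive_vec u0.
have nR0 : (n%:R : R) != 0 by rewrite pnatr_eq0 -lt0n.
have np : n%:R *: realvec R p = D%:R *: dual B f.
  rewrite -uD //; apply/rowP => j; rewrite !mxE up intrM mulrC; congr (_ * _).
have dp x : dot x (realvec R p) = D%:R / n%:R * dot x (dual B f).
  have := congr1 (dot x) np; rewrite !dotZr => h.
  by rewrite mulrAC -h mulrAC mulfV // mul1r.
have g0 g : g != f -> dot (vec g) (dual B f) = 0.
  move=> gf; case: (boolP (g \in B)) => gB; first by rewrite (dualE HB) // (negbTE gf).
  apply/eqP; apply: contraT => h; have := fco _ (exchange HB fB h).
  by rewrite !inE eqxx eq_sym (negbTE gf).
exists p; split=> [g gf|y /echar_eq1[m ym]].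
  by apply/eqP; rewrite -(eqr_int R) -dot_vec dp g0 // mulr0.
exists (\row_j (w 0 j * m)); split; first exact: coloop_rank fco HB.
set z := y - _; have z0 : dot z (dual B f) = 0.
  have : dot z (realvec R p) = 0.
    rewrite /z dotBl ym dotC dot_realvec /idot.
    under eq_bigr do rewrite mxE mulrA.
    by rewrite -mulr_suml -/(idot p w) pw mul1r subrr.
  rewrite dp => /eqP; rewrite !mulf_eq0 invr_eq0 (negbTE DR0) (negbTE nR0) /=.
  by move/eqP.
apply/span_vecP; exists (fun g => if g \in B then dot z (dual B g) else 0).
rewrite {1}[z](dual_expand HB) (big_setD1 f fB) /= z0 scale0r add0r.
rewrite [LHS]big_mkcond [RHS]big_mkcond /=; apply: eq_bigr => g _.
rewrite !inE.
by case: (g \in B); case: (g != f); rewrite ?scale0r.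
Qed.

Context (phi : 'rV[R]_r) (D : nat) (u : {set L} -> L -> 'rV[int]_r).
Hypotheses (D0 : (0 < D)%N) (uD : forall B f, B \in bases L -> f \in B ->
  realvec R (u B f) = D%:R *: dual B f).
Hypothesis gp : generic L phi.

(** Differencing along [K] makes the sums continuous in [y], so their value at [y] is the limit from
    the [nonintegral] points [y + e phi], where [expansion] gives it. Right continuity of [c]
    identifies that limit as [P y] times [c y k], and [P y] is nonzero because [y] is not
    excluded. *)
Lemma expansion_cvg c k y B : B \in bases L -> expansion phi u [set: L]%SET c ->
  ~ excluded k y -> ccvg \oo (Zpart [set: L]%SET k y) (c y k).
Proof.
move=> HB [c1 c2 _ _] nex.
(* Every element of exponent 1 outside [K] is avoided by some basis, as [smooth_bound] requires. *)
pose K : {set L} := [set f | (k f == 1%N) && [forall (B | B \in bases L), f \in B]]%SET.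
have Kco f : f \in K -> forall B, B \in bases L -> f \in B.
  by rewrite inE => /andP[_ /forall_inP].
have /choice[p Hp] f : exists p : 'rV[int]_r, f \in K ->
    (forall g, g != f -> lval g p = 0) /\ echar (dot y (realvec R p)) != 1.
  case: (boolP (f \in K)) => fK; last by exists 0.
  have [p [p1 p2]] := coloop_vec (Kco f fK) HB; exists p => _; split=> //.
  apply/eqP => /p2[w hw]; apply: nex; exists f.
    by split; [apply: coloop_tildeL; exact: Kco | move: fK; rewrite inE => /andP[/eqP]].
  by exists (y - realvec R w) => //; exists w => //; rewrite subrK.
have hu f g : f \in K -> g \in [set: L]%SET -> g != f -> lval g (p f) = 0.
  by move=> fK _; apply: (Hp f fK).1.
have hm f : f \in [set: L]%SET -> f \notin K -> k f = 1%N ->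
    exists B, [/\ B \in bases L, B \subset [set: L]%SET & f \notin B].
  move=> _; rewrite inE => + kf; rewrite kf eqxx /= negb_forall => /existsP[B'].
  by rewrite negb_imply => /andP[HB' fB']; exists B'; split=> //; apply: finset.subsetT.
have BT := finset.subsetT B; have KT := finset.subsetT K.
have /choice[s Hs] e := @smooth_has_sum _ _ _ [set: L]%SET B K k p HB BT hm (y + e *: phi).
have [s0 Hs0] := @smooth_has_sum _ _ _ [set: L]%SET B K k p HB BT hm y.
pose P y' := \prod_(f in K) (1 - echar (dot y' (realvec R (p f)))).
have ZE y' N : Zpart [set: L]%SET k y' N = \sum_(v <- vbox N) echar (dot y' (realvec R v)) *
    \prod_(f in [set: L]%SET) qfac k f (lval f v).
  by rewrite /Zpart big1 ?mul1r // => f; rewrite inE.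
have lin v : dot (y + e *: phi) (realvec R v) @[e --> 0^'+] --> dot y (realvec R v).
  by under eq_fun do rewrite dotDl dotZl; apply: cvg_right_lin.
have P0 : P y != 0.
  apply/prodf_neq0 => f fK; rewrite subr_eq0 eq_sym; exact: (Hp f fK).2.
have sc : ccvg 0^'+ s s0.
  exact: (@smooth_continuous _ _ _ [set: L]%SET B K k p HB BT hm R 0^'+ _
    (fun e => y + e *: phi) y s s0 lin Hs Hs0).
have sP : s0 = P y * c y k.
  apply: (@ccvg_unique _ _ (0 : R)^'+ _ s) => //.
  apply: near_eq_ccvg (_ : ccvg 0^'+ (fun e => P (y + e *: phi) * c (y + e *: phi) k) _).
    apply: filterS (nonintegral_right D0 uD gp y) => e yn.
    have h1 := smooth_ccvg HB BT KT hu hm (Hs e).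
    apply: (@ccvg_unique _ _ \oo _ _ _ _ _ h1).
    by apply: eq_ccvg (ccvgMl (P (y + e *: phi)) (c1 _ k yn)) => N /=; rewrite ZE.
  apply: ccvgM; last exact: c2.
  apply: ccvg_prod => f fK; apply: ccvgB; first exact: ccvg_cst.
  exact: ccvg_echar.
have h := smooth_ccvg HB BT KT hu hm Hs0.
rewrite -[c y k](mulKf P0) -sP.
by apply: eq_ccvg (ccvgMl (P y)^-1 h) => N /=; rewrite mulKf.
Qed.

End Coloop.

(** * Uniqueness of the Taylor coefficients *)

Section ZsumPart.
Context {R : realType} {r : nat} {L : {fset 'rV[int]_r * R[i]}}.
Implicit Types (f : L) (k : {ffun L -> nat}) (y : 'rV[R]_r) (v : 'rV[int]_r).

Lemma pnode_aff f v : pnode (off f) (lval f v) = twopii R * aff f (realvec R v).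
Proof. by rewrite /pnode /aff dot_vec rmorph_int. Qed.

Lemma box_vbox k N : box k N `<=` [set` vbox N].
Proof.
move=> v [vN _ _] /=; rewrite mem_vbox; apply/forallP => j.
by have := vN j; rewrite -lez_nat abszE.
Qed.

Lemma fset_box k N : fset_set (box k N : set 'rV[int]_r) =
  [fset v in vbox N | `[< box k N v >]]%fset.
Proof.
have fin := sub_finite_set (@box_vbox k N) (finite_fset _).
apply/fsetP => v; rewrite in_fset_set // !inE /=.
apply/idP/andP => [/set_mem vk|[_ vk]]; last by apply/mem_set/asboolP.
by split; [exact: (@box_vbox k N) | apply/asboolP].
Qed.

(** For [k f = 0] the factor is [- [f(v) = 0]], which accounts both for the sign and for the
    condition on [v]; for [k f > 0] the default [0^-1 = 0] removes the points with [f(v) = 0]. *)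
Lemma Zsum_Zpart k y N :
  Zsum k y N = (\prod_(f : L) - (twopii R ^+ k f)) * Zpart [set: L]%SET k y N.
Proof.
have fin := sub_finite_set (@box_vbox k N) (finite_fset _).
rewrite /Zsum /Zpart fsbig_finite // fset_box -big_fset_condE.
rewrite [\prod_(f | f \notin _) _]big1 => [|f]; last by rewrite inE.
rewrite mul1r !mulr_sumr big_mkcond /=; apply: eq_big_seq => v vN.
have -> : \prod_(f in [set: L]%SET) qfac k f (lval f v) = \prod_f qfac k f (lval f v).
  by apply: eq_bigl => f; rewrite inE.
rewrite [RHS]mulrCA -big_split /=.
have fac0 f : k f = 0%N -> - (twopii R ^+ k f) * qfac k f (lval f v) =
    - (aff f (realvec R v) == 0)%:R.
  move=> k0; rewrite /qfac pnode_aff k0 /qcoef eqxx expr0 mulN1r.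
  by rewrite mulf_eq0 (negbTE twopii_neq0).
have facS f : (0 < k f)%N -> - (twopii R ^+ k f) * qfac k f (lval f v) =
    aff f (realvec R v) ^- k f.
  move=> k0; rewrite /qfac pnode_aff /qcoef gtn_eqF // mulrNN.
  rewrite [(twopii R * _) ^+ _]exprMn invfM mulrA mulfV ?mul1r //.
  by rewrite expf_neq0 // twopii_neq0.
case: asboolP => [[_ v1 v2]|nv].
  rewrite mulrCA; congr (_ * _); rewrite [RHS](bigID (fun f => (0 < k f)%N)) /= mulrC.
  congr (_ * _); first by apply: eq_bigr => f kf; rewrite facS.
  rewrite (eq_bigr (fun=> - 1)) => [|f]; last first.
    by rewrite -eqn0Ngt => /eqP k0; rewrite fac0 // v2 // eqxx.
  rewrite prodr_const; congr (_ ^+ _); apply: eq_card => f.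
  by rewrite inE -[RHS]/(~~ (0 < k f)%N) eqn0Ngt.
suff [f f0] : exists f, - (twopii R ^+ k f) * qfac k f (lval f v) = 0.
  by rewrite (bigD1 f) //= f0 mul0r mulr0.
apply: contrapT => h; apply: nv; split=> [j|f kf|f kf].
- by move: vN; rewrite mem_vbox => /forallP/(_ j); rewrite -lez_nat abszE.
- apply/eqP => a0; apply: h; exists f; rewrite facS // a0 expr0n gtn_eqF //.
  exact: invr0.
- apply: contrapT => /eqP a0; apply: h; exists f.
  by rewrite fac0 // (negbTE a0) oppr0.
Qed.

End ZsumPart.

Section Digits.

Lemma digits_unique (b n : nat) (x y : nat -> nat) :
  (forall i, x i < b)%N -> (forall i, y i < b)%N ->
  (\sum_(i < n) x i * b ^ i = \sum_(i < n) y i * b ^ i)%N ->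
  forall i, (i < n)%N -> x i = y i.
Proof.
elim: n x y => // n IH x y xb yb; rewrite !big_ord_recl /= !expn0 !muln1 => h.
have b0 : (0 < b)%N by apply: leq_ltn_trans (xb 0%N).
have sh (z : nat -> nat) : (\sum_(i < n) z (bump 0 i) * b ^ bump 0 i =
    (\sum_(i < n) z i.+1 * b ^ i) * b)%N.
  by rewrite big_distrl /=; apply: eq_bigr => i _; rewrite /bump /= add1n expnS mulnCA mulnC.
rewrite !sh in h.
have h0 : x 0%N = y 0%N.
  have := congr1 (modn^~ b) h; rewrite /= ![(_ + _ * b)%N]addnC !modnMDl.
  by rewrite !modn_small.
move: h; rewrite h0 => /addnI/eqP; rewrite eqn_pmul2r // => /eqP h.
case=> // i iN; exact: (IH (fun i => x i.+1) (fun i => y i.+1)).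
Qed.

End Digits.

Section Unique.
Context {R : realType} {T : finType}.
Implicit Types (k : {ffun T -> nat}).

(* On a curve t_f = s^(w f) the monomials become powers of s, and the weights
   can be chosen such that the smallest exponent is attained only once. *)
Lemma weights_exist (P : {ffun T -> nat} -> Prop) k1 : P k1 ->
  exists (w : T -> nat) k0, [/\ forall f, (0 < w f)%N, injective w, P k0 &
    forall k, P k -> k != k0 -> (\sum_f w f * k0 f < \sum_f w f * k f)%N].
Proof.
move=> Pk1.
have [m mP mmin] : exists2 m, (exists2 k, P k & deg k = m) & forall k, P k -> (m <= deg k)%N.
  have ex : exists m, `[< exists2 k, P k & deg k = m >].
    by exists (deg k1); apply/asboolP; exists k1.
  case: (ex_minnP ex) => m /asboolP mP mmin; exists m => // k Pk.
  by apply: mmin; apply/asboolP; exists k.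
(* As [W > m S], a minimal weight forces the minimal degree [m]; among exponents of that degree all
   entries are at most [m], and their digits in base [m + 2] separate them. Base [m + 1] would be 1
   for [m = 0], and the weights could coincide. *)
pose dg k := (\sum_f k f * m.+2 ^ enum_rank f)%N.
pose S := (\sum_(f : T) m.+2 ^ enum_rank f)%N.
pose W := (m * S).+1.
pose w (f : T) := (W + m.+2 ^ enum_rank f)%N.
have wE k : (\sum_f w f * k f = W * deg k + dg k)%N.
  rewrite /deg /dg big_distrr /= -big_split /=; apply: eq_bigr => f _.
  by rewrite mulnDl [(k f * _)%N]mulnC.
have kle k f : (k f <= deg k)%N by rewrite /deg (bigD1 f) //= leq_addr.
have dgle k : (dg k <= deg k * S)%N.
  by rewrite /dg /S big_distrr /=; apply: leq_sum => f _; rewrite leq_mul2r kle orbT.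
have [k0 Pk0 kmin] : exists2 k0, P k0 & forall k, P k ->
    (\sum_f w f * k0 f <= \sum_f w f * k f)%N.
  have ex : exists n, `[< exists2 k, P k & (\sum_f w f * k f = n)%N >].
    by exists (\sum_f w f * k1 f)%N; apply/asboolP; exists k1.
  case: (ex_minnP ex) => n /asboolP[k0 Pk0 <-] nmin; exists k0 => // k Pk.
  by apply: nmin; apply/asboolP; exists k.
have degm k : P k -> (\sum_f w f * k f <= \sum_f w f * k0 f)%N -> deg k = m.
  move=> Pk; have [k2 Pk2 k2m] := mP; have := kmin k2 Pk2; rewrite !wE => h1 h2.
  have h3 := leq_trans h2 h1; apply/eqP; rewrite eqn_leq mmin // andbT leqNgt.
  apply/negP => mk; move: h3; rewrite k2m leqNgt => /negP; apply.
  have := dgle k2; rewrite k2m => h4.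
  have : (W * m.+1 <= W * deg k)%N by rewrite leq_mul2l mk orbT.
  by rewrite mulnS => h5; move: h4 h5; rewrite /W; clear; lia.
exists w, k0; split=> //.
- move=> f g /addnI/eqP; rewrite eqn_exp2l.
    by move=> /eqP/ord_inj/enum_rank_inj.
  by [].
- move=> k Pk kk0; rewrite ltn_neqAle kmin // andbT; apply: contra kk0 => /eqP e.
  have dk : deg k = m by apply: degm => //; rewrite e.
  have dk0 : deg k0 = m by apply: degm.
  move: e; rewrite !wE dk dk0 => /addnI e.
  pose x k' i : nat := if insub i is Some j then fun_of_fin k' (enum_val (j : 'I_#|T|)) else 0%N.
  have xb k' i : deg k' = m -> (x k' i < m.+2)%N.
    by rewrite /x => <-; case: insubP => // j _ _; rewrite ltnS leqW.
  have re k' : dg k' = (\sum_(i < #|T|) x k' i * m.+2 ^ i)%N.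
    rewrite /dg (reindex (@enum_val T T)) /=; last first.
      exact: (onW_bij _ (@enum_val_bij T)).
    by apply: eq_bigr => i _; rewrite enum_valK /x valK.
  apply/eqP/ffunP => f; rewrite !re in e.
  have := digits_unique (fun i => xb k0 i dk0) (fun i => xb k i dk) e (ltn_ord (enum_rank f)).
  by rewrite /x valK enum_rankK => ->.
Qed.

(** A term with index outside [J0] is the difference of two partial sums close to [s], so
    convergence of the net alone bounds all terms. *)
Lemma has_sum_terms_bounded (I : choiceType) (a : I -> R[i]) s : has_sum a s ->
  exists2 K : R, 0 <= K & forall i, cnorm (a i) <= K.
Proof.
move=> /(_ 1 ltr01)/totallyP[J0 HJ].
have S0 : 0 <= \sum_(j <- J0) cnorm (a j) by apply: sumr_ge0 => j _; apply: cnorm_ge0.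
exists (2 + \sum_(j <- J0) cnorm (a j)); first by rewrite addr_ge0.
move=> i; case: (boolP (i \in J0)) => iJ.
  rewrite (big_fsetD1 i iJ) /= addrCA lerDl addr_ge0 // sumr_ge0 // => j _.
  exact: cnorm_ge0.
have h1 := HJ (i |` J0)%fset (fsubsetU1 _ _); have h2 := HJ J0 (fsubset_refl _).
rewrite /= in h1 h2; rewrite big_fsetU1 //= in h1.
have -> : a i = (a i + \sum_(j <- J0) a j - s) - (\sum_(j <- J0) a j - s) by ring.
apply: le_trans (cnormB _ _) _; apply: le_trans (ltW (ltrD h1 h2)) _.
by have e2 : 1 + 1 = 2 :> R; [ring | rewrite e2 lerDl].
Qed.

Lemma poly_right_neq0 (p : {poly R[i]}) : p != 0 ->
  \forall s \near 0^'+, p.[s%:C] != 0.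
Proof.
move=> p0; have [rs pE] := closed_field_poly_normal p.
have H : \forall s \near 0^'+, s%:C \notin rs.
  elim: (rs : seq R[i]) => [|z zs IH]; first by apply: filterE => s.
  have hz : \forall s \near 0^'+, s%:C != z.
    have [z0|z0] := ltP 0 (complex.Re z).
      apply: (near_right z0) => s /andP[_ sz]; apply/eqP => h.
      by move: sz; rewrite -h /= ltxx.
    apply: (near_right ltr01) => s /andP[s0 _]; apply/eqP => h.
    by move: z0; rewrite -h /= leNgt s0.
  by apply: filterS2 hz IH => s; rewrite inE negb_or => -> ->.
apply: filterS H => s sr; rewrite pE hornerZ mulf_neq0 ?lead_coef_eq0 //.
by rewrite -[_ == 0]/(root _ _) root_prod_XsubC.
Qed.

End Unique.

Section TaylorUnique.
Context {R : realType} {r : nat} {L : {fset 'rV[int]_r * R[i]}}.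
Implicit Types (f g : L) (B : {set L}) (k : {ffun L -> nat}) (w : L -> nat).

Definition curve w (s : R) : {ffun L -> R[i]} := [ffun f => s%:C ^+ w f].

Lemma mono_curve w s k : mono (curve w s) k = s%:C ^+ (\sum_f w f * k f)%N.
Proof.
rewrite /mono; elim/big_rec2: _ => [|f x n _ ->]; first by rewrite expr0.
by rewrite ffunE exprD exprM.
Qed.

(** Along the curve each [den] with [g] outside [B] is a polynomial in [s], and injectivity of [w]
    prevents its term [s^(w g)] from cancelling; such a polynomial has finitely many zeros. *)
Lemma regular_right w : (forall f, (0 < w f)%N) -> injective w ->
  \forall s \near 0^'+, regular L (curve w s).
Proof.
move=> w0 winj.
have H1 (p : {set L} * L) : \forall s \near 0^'+, p.2 \notin p.1 ->
    den (curve w s) p.1 p.2 != 0.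
  case: p => B g /=; case: (boolP (g \in B)) => gB; first by apply: filterE.
  pose c : R[i] := twopii R * off g -
    \sum_(f in B) twopii R * off f * (dot (vec g) (dual B f))%:C.
  pose p : {poly R[i]} := 'X^(w g) -
    \sum_(f in B) (dot (vec g) (dual B f))%:C *: 'X^(w f) - c%:P.
  have p0 : p != 0.
    apply/eqP => /(congr1 (fun q : {poly R[i]} => q`_(w g))).
    rewrite /p !coefB coefXn eqxx coef_sum big1 => [|f fB].
      by rewrite coefC coef0 gtn_eqF // !subr0 => /eqP; rewrite oner_eq0.
    rewrite coefZ coefXn; case: eqP => [/winj gf|_]; last by rewrite mulr0.
    by move: gB; rewrite gf fB.
  apply: filterS (poly_right_neq0 p0) => s; rewrite /p => hs _; move: hs.
  rewrite !hornerE horner_sum /den /tshift !ffunE.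
  suff -> : s%:C ^+ w g -
      \sum_(f in B) ((dot (vec g) (dual B f))%:C *: 'X^(w f)).[s%:C] - c =
    s%:C ^+ w g - twopii R * off g -
      \sum_(f in B) (curve w s f - twopii R * off f) * (dot (vec g) (dual B f))%:C by [].
  under [in RHS]eq_bigr do rewrite ffunE mulrBl.
  rewrite sumrB /c; under [in LHS]eq_bigr do rewrite hornerZ hornerXn mulrC.
  by ring.
have H2 f : \forall s \near 0^'+, cexp (tshift (curve w s) f) != 1.
  have [s0 s00 hs] := cexp_shift_neq1 (off f).
  apply: (@near_right _ (Num.min s0 1)); first by rewrite lt_min s00 ltr01.
  move=> s /andP[sp]; rewrite lt_min => /andP[ss s1].
  rewrite /tshift ffunE; apply: hs; rewrite cnormX cnorm_real gtr0_norm //.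
  rewrite exprn_gt0 //=; apply: le_lt_trans ss.
  by rewrite -[leRHS]expr1 ler_wiXn2l // ltW.
have h1 := @filter_forall R _ (fun (p : {set L} * L) s =>
  p.2 \notin p.1 -> den (curve w s) p.1 p.2 != 0) 0^'+ _ H1.
have h2 := @filter_forall R _ (fun f s => cexp (tshift (curve w s) f) != 1) 0^'+ _ H2.
apply: filterS2 (h1 _) (h2 _) => s {}h1 {}h2 B HB; split=> [g gB|f fB].
  exact: (h1 (B, g)).
exact: h2.
Qed.

(** On the curve of [weights_exist] the series is a sum of powers of [s] whose lowest exponent
    belongs to a single nonzero coefficient, so [lead_term_neq0] contradicts its vanishing at small
    regular points. *)
Lemma taylor_unique (b : {ffun L -> nat} -> R[i]) (K M rho : R) :
  0 <= K -> 1 <= M -> (forall k, cnorm (b k) <= K * M ^+ deg k) -> 0 < rho ->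
  (forall t : {ffun L -> R[i]}, (forall f, cnorm (t f) < rho) -> regular L t ->
    has_sum (fun k => b k * mono t k) 0) ->
  forall k, b k = 0.
Proof.
move=> K0 M1 bK rho0 hb k1; apply: contrapT => bk1.
have [w [k0 [w0 winj bk0 wmin]]] := weights_exist (P := fun k => b k <> 0) bk1.
have M0 : 0 < M by apply: lt_le_trans M1.
pose s1 : R := (2 * M)^-1; have s10 : 0 < s1 by rewrite invr_gt0 mulr_gt0.
have s11 : s1 <= 1 by rewrite invf_le1 ?mulr_gt0 //; lra.
have bs : bounded_sums (fun k => cnorm (b k) * s1 ^+ (\sum_f w f * k f)%N).
  have : abs_summable (fun k => b k * mono [ffun _ : L => s1%:C] k).
    apply: (deg_summable K0 (ltW M0) bK) => f; rewrite ffunE cnorm_real gtr0_norm //.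
    by rewrite mulVf // gt_eqF ?mulr_gt0.
  apply: bounded_sums_le => k; rewrite cnormM ler_wpM2l ?cnorm_ge0 //.
  rewrite /mono cnorm_prod (eq_bigr (fun f => s1 ^+ k f)) => [|f _]; last first.
    by rewrite ffunE cnormX cnorm_real gtr0_norm.
  rewrite prod_expr_deg ler_wiXn2l // ?(ltW s10) // /deg; apply: leq_sum => f _.
  by rewrite leq_pmull.
have [|k /eqP kk0 /eqP bk|s0 s00 hs] := lead_term_neq0 (i0 := k0) s10 bs.
- exact/eqP.
- by apply: wmin => //; apply/eqP.
have : \forall s \near (0 : R)^'+, False.
  near=> s.
  have sp : 0 < s by near: s; exact: nbhs_right_gt.
  have ss : s < s0 by near: s; exact: nbhs_right_lt.
  have sr : s < rho by near: s; exact: nbhs_right_lt.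
  have s1' : s < 1 by near: s; exact: nbhs_right_lt.
  have rg : regular L (curve w s) by near: s; exact: regular_right.
  have : has_sum (fun k => b k * mono (curve w s) k) 0.
    apply: hb => // f; rewrite ffunE cnormX cnorm_real gtr0_norm //.
    by apply: le_lt_trans sr; rewrite -[leRHS]expr1 ler_wiXn2l // ltW.
  move=> /(eq_has_sum (fun k => congr1 (fun z => b k * z) (mono_curve w s k))) h.
  by have := hs s _ _ h; rewrite sp ss eqxx => /(_ isT).
by move=> /filter_ex[].
Unshelve. all: by end_near. Qed.

End TaylorUnique.

Section Assembly.
Context {R : realType} {r : nat} {L : {fset 'rV[int]_r * R[i]}} (phi : 'rV[R]_r).
Implicit Types (k : {ffun L -> nat}) (y : 'rV[R]_r) (t : {ffun L -> R[i]}).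

Lemma sub_genT y t : sub_gen phi [set: L]%SET y t = Fgen L phi y t.
Proof.
rewrite /sub_gen /Fgen; apply: eq_big => [B|B /andP[HB _]].
  by rewrite finset.subsetT andbT.
rewrite -mulrA; congr (_ * _); first by apply: eq_bigl => g; rewrite inE.
by rewrite /base_fun sum_quotE.
Qed.

Definition kfact k : R[i] := \prod_(f : L) ((k f)`!)%:R.

Lemma kfact_neq0 k : kfact k != 0.
Proof. by apply/prodf_neq0 => f _; rewrite pnatr_eq0 -lt0n fact_gt0. Qed.

Lemma taylor_term (C : {ffun L -> nat} -> R[i]) t k :
  C k * \prod_(f : L) (t f ^+ k f / ((k f)`!)%:R) = (C k / kfact k) * mono t k.
Proof. by rewrite big_split /= prodfV -/(kfact k) -/(mono t k) mulrA mulrAC. Qed.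

Lemma partial_sum_has_sum (C : {ffun L -> nat} -> R[i]) t s :
  (summability.partial_sum
      (fun k => C k * \prod_(f : L) (t f ^+ k f / ((k f)`!)%:R))
      @ summability.totally --> (s : (R[i] : numFieldType))) <->
  has_sum (fun k => (C k / kfact k) * mono t k) s.
Proof.
have E : summability.partial_sum (fun k => C k * \prod_(f : L) (t f ^+ k f / ((k f)`!)%:R)) =1
    (fun J => \sum_(k <- J) (C k / kfact k) * mono t k).
  move=> J; rewrite /summability.partial_sum big_seq_fsetE.
  by apply: eq_bigr => k _; rewrite taylor_term.
split=> [/ccvgP h|h].
  exact: eq_ccvg E h.
by apply/ccvgP; apply: eq_ccvg (fsym E) h.
Qed.

End Assembly.

Theorem theorem2p5 (R : realType) (r : nat) (r_gt0 : (0 < r)%N)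
    (L : {fset 'rV[int]_r * R[i]})
    (L_neq0 : forall f : L, ivec f != 0)
    (L_rank : gen_rank [set: L]%SET = r)
    (phi : 'rV[R]_r) (phi_generic : generic L phi)
    (y : 'rV[R]_r) :
  (exists C : {ffun L -> nat} -> R[i], taylor0 (regular L) (Fgen L phi y) C) /\
  (forall C : {ffun L -> nat} -> R[i], taylor0 (regular L) (Fgen L phi y) C ->
    forall k : {ffun L -> nat}, ~ excluded k y ->
      Zsum k y @ \oo -->
        ((\prod_(f : L) - (twopii R ^+ k f / ((k f)`!)%:R)) * C k
          : (R[i] : numFieldType))).
Proof.
have [B HB _] : exists2 B, B \in bases L & B \subset [set g in enum [set: L]%SET]%SET.
  by apply: subset_bases; apply: zspan_spanning L_rank; exact: enum_uniq.
have [D [u [D0 uD]]] := common_dual L.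
have [c Hc] := expansion_exists D0 uD phi_generic HB (finset.subsetT B).
have [_ _ c3 c4] := Hc.
have [K [M [K0 M1 cK]]] := c3 y; have [rho rho0 crho] := c4 y.
have M0 : 0 < M by apply: lt_le_trans M1.
have norm_lt (z : R[i]) (e : R) : (`|z| < e%:C) = (cnorm z < e) by rewrite normE ltcR.
split.
  exists (fun k => c y k * kfact k).
  (* [G] is the sum of the series itself, which exists also where the formula is singular. *)
  exists (Num.min rho (2 * M)^-1),
    (fun t => xget 0 [set s | has_sum (fun k => c y k * mono t k) s]).
  split=> [|t tr]; first by rewrite lt_min rho0 invr_gt0 mulr_gt0.
  have tr1 f : cnorm (t f) < rho.
    by have := tr f; rewrite norm_lt lt_min => /andP[].
  have tr2 f : cnorm (t f) * (2 * M) <= 1.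
    have := tr f; rewrite norm_lt lt_min => /andP[_].
    by rewrite -[_^-1]mul1r ltr_pdivlMr ?mulr_gt0 // => /ltW.
  have [s hs] := abs_summable_has_sum (deg_summable K0 (ltW M0) cK tr2).
  set G := xget 0 _; have hx : has_sum (fun k => c y k * mono t k) G.
    exact: (xgetI 0 (P := [set s | has_sum (fun k => c y k * mono t k) s]) hs).
  split=> [rt|].
    by apply: has_sum_unique hx _; rewrite -sub_genT; apply: crho.
  apply/partial_sum_has_sum; apply: eq_has_sum hx => k.
  by rewrite mulfK // kfact_neq0.
move=> C [rho' [G [rho'0 HG]]] k nex.
have CE k' : C k' / kfact k' = c y k'.
  (* Evaluation at a constant point gives a Cauchy-type bound: the terms of a convergent series are
     bounded, so the coefficients grow at most geometrically, as [taylor_unique] needs. *)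
  pose t0 : R := rho' / 2; have t00 : 0 < t0 by rewrite divr_gt0.
  have t0r : t0 < rho' by rewrite /t0; lra.
  pose t : {ffun L -> R[i]} := [ffun _ => t0%:C].
  have tn f : cnorm (t f) = t0 by rewrite ffunE cnorm_real gtr0_norm.
  have tr f : `|t f| < rho'%:C by rewrite norm_lt tn.
  have [_ /partial_sum_has_sum/has_sum_terms_bounded[K1 K10 hK1]] := HG t tr.
  have V0 : 0 <= t0^-1 by rewrite invr_ge0 ltW.
  have CK j : cnorm (C j / kfact j) <= K1 * t0^-1 ^+ deg j.
    rewrite exprVn ler_pdivlMr ?exprn_gt0 //; apply: le_trans (hK1 j).
    rewrite [cnorm (_ * mono _ _)]cnormM /mono cnorm_prod -prod_expr_deg.
    rewrite le_eqVlt; apply/orP; left; apply/eqP.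
    by congr (_ * _); apply: eq_bigr => f _; rewrite cnormX tn.
  apply/eqP; rewrite -subr_eq0; apply/eqP.
  apply: (@taylor_unique _ _ _ (fun k => C k / kfact k - c y k) (K1 + K) (t0^-1 + M)
    (Num.min rho rho')).
  - by rewrite addr_ge0.
  - by rewrite (le_trans M1) // lerDr.
  - move=> k''; apply: le_trans (cnormB _ _) _; rewrite mulrDl; apply: lerD.
      apply: le_trans (CK _) _; rewrite ler_wpM2l //; apply: lerXn2r; rewrite ?nnegrE //.
        by rewrite addr_ge0 // ltW.
      by rewrite lerDl ltW.
    apply: le_trans (cK _) _; rewrite ler_wpM2l //; apply: lerXn2r; rewrite ?nnegrE ?(ltW M0) //.
      by rewrite addr_ge0 // ltW.
    by rewrite lerDr.
  - by rewrite lt_min rho0.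
  move=> t' t'r rt.
  have r1 f : cnorm (t' f) < rho by have := t'r f; rewrite lt_min => /andP[].
  have r2 f : `|t' f| < rho'%:C by rewrite norm_lt; have := t'r f; rewrite lt_min => /andP[].
  have [/(_ rt) Gt /partial_sum_has_sum hC] := HG t' r2.
  have hc := crho t' r1 rt; rewrite sub_genT -Gt in hc.
  rewrite -(subrr (G t')); apply: eq_has_sum (has_sumB hC hc) => k''.
  by rewrite mulrBl.
have hZ := expansion_cvg D0 uD phi_generic HB Hc nex.
have -> : (\prod_(f : L) - (twopii R ^+ k f / ((k f)`!)%:R)) * C k =
    (\prod_(f : L) - (twopii R ^+ k f)) * c y k.
  rewrite -CE mulrA mulrAC; congr (_ * _).
  by rewrite /kfact -prodfV -big_split /=; apply: eq_bigr => f _; rewrite mulNr.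
apply/ccvgP; apply: eq_ccvg (ccvgMl _ hZ) => N /=.
by rewrite Zsum_Zpart.
Qed.
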